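(* Let $K\subset\hat{\mathbb{C}}$ be a compactum, $f:\hat{\mathbb{C}}\to\hat{\mathbb{C}}$ a rational function of degree at least $2$, $L=f^{-1}(K)$, and $\pi_L:L\to\mathcal{D}_L^{PS}$ the natural projection. Define $\approx$ on $K$ by $x\approx y$ iff $\pi_L(f^{-1}(x))=\pi_L(f^{-1}(y))$. Then $\approx$ is a closed equivalence relation on $K$ and contains $\overline{R_K}$.
   Context: For disjoint simple closed curves $J_1,J_2\subset\hat{\mathbb{C}}$, $U(J_1,J_2)$ is the component of $\hat{\mathbb{C}}\setminus(J_1\cup J_2)$ with boundary $J_1\cup J_2$. The Schönflies relation $R_K$: $x\ne y$ satisfy $(x,y)\in R_K$ if there exist disjoint simple closed curves $J_1\ni x$, $J_2\ni y$ such that $\overline{U(J_1,J_2)}\cap K$ contains an infinite sequence of distinct components $P_n$ each meeting both $J_1$ and $J_2$ whose Hausdorff limit contains $\{x,y\}$; $\overline{R_K}$ is its closure in $K\times K$. A Peano space is a compactum with at most countably many non-degenerate components, each locally connected, and for each $C>0$ only finitely many of diameter $>C$. $\mathcal{D}_L^{PS}$ is the finest monotone (upper semicontinuous, into subcontinua) decomposition of $L$ whose quotient hyperspace is a Peano space (its existence is known). *)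

(* Defs.v *)
From mathcomp Require Import all_boot all_algebra.
From mathcomp Require Import all_classical all_reals all_analysis.
From mathcomp Require Import complex.
Import GRing.Theory Num.Theory.
Import numFieldNormedType.Exports.
Local Open Scope classical_set_scope.
Local Open Scope ring_scope.

Set Implicit Arguments. Unset Strict Implicit. Unset Printing Implicit Defensive.

Section Sphere.
Variable R : realType.

Notation V3 := 'rV[R]_3.

Definition i0 : 'I_3 := @Ordinal 3 0 isT.
Definition i1 : 'I_3 := @Ordinal 3 1 isT.
Definition i2 : 'I_3 := @Ordinal 3 2 isT.

(* The Riemann sphere \hat C, realized as the unit sphere in R^3. *)
Definition S2 : set V3 :=
  [set v | v ord0 i0 ^+ 2 + v ord0 i1 ^+ 2 + v ord0 i2 ^+ 2 = 1].

(* Extended complex plane C u {oo}: None stands for oo. *)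
Definition extC := option R[i].

Definition stereo (v : V3) : extC :=
  if v ord0 i2 == 1 then None
  else Some (Complex (v ord0 i0 / (1 - v ord0 i2)) (v ord0 i1 / (1 - v ord0 i2))).

Definition stereo_inv (z : extC) : V3 :=
  match z with
  | None => \row_(i < 3) [:: 0; 0; 1]`_i
  | Some w =>
      let r := complex.Re w ^+ 2 + complex.Im w ^+ 2 in
      \row_(i < 3) ([:: 2 * complex.Re w; 2 * complex.Im w; r - 1]`_i / (r + 1))
  end.

(* A rational function p/q, with p,q coprime, acting on C u {oo}. *)
Definition rat_eval (p q : {poly R[i]}) (z : extC) : extC :=
  match z with
  | Some w => if q.[w] != 0 then Some (p.[w] / q.[w]) else None
  | None =>
      if (size q < size p)%N then None
      else if size p == size q then Some (lead_coef p / lead_coef q)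
      else Some 0
  end.

Definition rat_degree (p q : {poly R[i]}) : nat := (maxn (size p) (size q)).-1.

Definition is_rational_of_degree_ge2 (p q : {poly R[i]}) : Prop :=
  coprimep p q /\ (2 <= rat_degree p q)%N.

Definition rat_S2 (p q : {poly R[i]}) (v : V3) : V3 :=
  stereo_inv (rat_eval p q (stereo v)).

Definition simple_closed_curve (J : set V3) : Prop :=
  J `<=` S2 /\
  exists g : R -> V3,
    {within `[0, 1], continuous g} /\ g 0 = g 1 /\
    {in `[0, 1[ &, injective g} /\ J = g @` `[0, 1].

(* U(J1,J2): the component of S2 \ (J1 u J2) whose boundary is J1 u J2.
   Such a component is open in S2, so its boundary in S2 is closure U \ U. *)
Definition U_between (J1 J2 U : set V3) : Prop :=
  (exists z, (S2 `\` (J1 `|` J2)) z /\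
             U = connected_component (S2 `\` (J1 `|` J2)) z) /\
  closure U `\` U = J1 `|` J2.

Definition eps_nbhd (A : set V3) (e : R) : set V3 :=
  [set z | exists2 a, A a & `|z - a| < e].

Definition hausdorff_cvg (P : nat -> set V3) (Q : set V3) : Prop :=
  closed Q /\ Q !=set0 /\
  forall e : R, 0 < e ->
    \forall n \near \oo, P n `<=` eps_nbhd Q e /\ Q `<=` eps_nbhd (P n) e.

Definition is_component {T : topologicalType} (A C : set T) : Prop :=
  exists2 z, A z & C = connected_component A z.

Definition schoenflies_rel (K : set V3) (x y : V3) : Prop :=
  x <> y /\
  exists J1 J2 : set V3,
    simple_closed_curve J1 /\ simple_closed_curve J2 /\ J1 `&` J2 = set0 /\
    J1 x /\ J2 y /\
    exists U, U_between J1 J2 U /\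
    exists P : nat -> set V3,
      injective P /\
      (forall n, is_component (closure U `&` K) (P n)) /\
      (forall n, P n `&` J1 !=set0 /\ P n `&` J2 !=set0) /\
      exists Q, hausdorff_cvg P Q /\ Q x /\ Q y.

(* Closure of R_K in K x K (K closed, R_K c K x K, so this is the closure
   in V3 x V3). *)
Definition schoenflies_closure (K : set V3) : set (V3 * V3) :=
  closure [set xy | schoenflies_rel K xy.1 xy.2].

End Sphere.

Section Peano.
Variables (R : realType) (V : normedModType R).

Definition nondegenerate (C : set V) : Prop := exists a b, C a /\ C b /\ a <> b.

Definition locally_connected_set (P : set V) : Prop :=
  forall x, P x -> forall e : R, 0 < e ->
    exists U : set V,
      (exists O : set V, open O /\ U = P `&` O) /\
      connected U /\ U x /\ U `<=` ball x e.

Definition peano_space (Y : set V) : Prop :=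
  compact Y /\
  countable [set C | is_component Y C /\ nondegenerate C] /\
  (forall C, is_component Y C -> locally_connected_set C) /\
  (forall c : R, 0 < c ->
     finite_set [set C | is_component Y C /\
                         exists a b, C a /\ C b /\ c < `|a - b|]).
End Peano.

Section Decomp.
Variable R : realType.
Notation V3 := 'rV[R]_3.

Definition monotone_decomposition (L : set V3) (D : set (set V3)) : Prop :=
  (forall A, D A -> A !=set0 /\ A `<=` L /\ compact A /\ connected A) /\
  (forall A B, D A -> D B -> A `&` B !=set0 -> A = B) /\
  (forall x, L x -> exists2 A, D A & A x) /\
  (forall A W, D A -> open W -> A `<=` W ->
     exists W', open W' /\ A `<=` W' /\
       forall B, D B -> B `&` W' !=set0 -> B `<=` W).

(* The quotient (hyperspace) L/D is a Peano space: it is realized as the image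
   of L under a continuous map g into a normed space whose fibres on L are
   exactly the elements of D (g(L) is then homeomorphic to L/D, since L is
   compact and the target Hausdorff). *)
Definition peano_quotient (L : set V3) (D : set (set V3)) : Prop :=
  exists (V : normedModType R) (g : V3 -> V),
    {within L, continuous g} /\
    (forall a b, L a -> L b ->
       (g a = g b <-> exists2 A, D A & A a /\ A b)) /\
    peano_space (g @` L).

Definition refines (D D' : set (set V3)) : Prop :=
  forall A, D A -> exists2 B, D' B & A `<=` B.

Definition finest_peano_decomposition (L : set V3) (D : set (set V3)) : Prop :=
  monotone_decomposition L D /\ peano_quotient L D /\
  forall D', monotone_decomposition L D' -> peano_quotient L D' -> refines D D'.

Definition proj_set (D : set (set V3)) (S : set V3) : set (set V3) :=
  [set A | D A /\ A `&` S !=set0].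

End Decomp.

(* Main.v *)
(**
Let [g : L -> Y] be the monotone map onto a Peano space whose fibres are the
elements of the decomposition. Then [x ~ y] says that every point over [x] has
the same [g]-value as some point over [y], and conversely. This is a closed
condition because [f] is open and [L] is compact.

Let [(x, y)] be a Schoenflies pair, with curves [J1], [J2], annulus [U] and
components [P n], and let [f u = x]. For large [n] there is a component [M n] of
the preimage of [P n] close to [u]; it maps onto [P n], so along a subsequence it
also approaches a point [v] with [f v = y]. We claim [g u = g v]. As [g] is
monotone and [Y] is locally connected with few large components, [M n] contains
a continuum [F n] with small [g]-image that meets the preimages of both [J1] and
[J2]: otherwise a small connected neighbourhood in [Y] would have a connected
preimage in the preimage of the closure of [U] meeting several of the [M n].

The sets [F n] approach both [u] and [v]. If they stayed away from [u], choose a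
connected piece of [U] near [x], and let [B] be a component of its preimage
clustering at [u]. By pigeonhole three of the [M n], cut along [B], touch the
same [B] and the same two components of the preimages of the complementary
discs beyond [J1] and [J2]. These six connected sets draw [K_{3,3}] on the
sphere, which is impossible. So [g u] and [g v] are both close to the small set
[g (F n)]. Only the continuity, openness and finite fibres of [f] are used; the
planar facts (Jordan separation, local connectivity of the sides of a curve,
non-planarity of [K_{3,3}]) all come from continuous choices of angles.
*)

Require Import Defs.
From mathcomp Require Import all_boot all_order all_algebra.
From mathcomp Require Import all_classical all_reals all_analysis.
From mathcomp Require Import complex.
From mathcomp Require Import ring lra.
Import Order.TTheory GRing.Theory Num.Theory.
Import ComplexField.Normc.
Import numFieldNormedType.Exports.
Local Open Scope classical_set_scope.
Local Open Scope ring_scope.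
Set Implicit Arguments. Unset Strict Implicit. Unset Printing Implicit Defensive.

(** The preimage of the annulus has no usable shape: it may be disconnected, and critical values may
    lie on [J1] or [J2], so neither the curves nor the annulus lift. What survives is that an open
    map with finite fibres sends each component of the preimage of a connected open set onto that
    set. Hence there are finitely many such components, which is what makes the pigeonhole possible.
    A second obstacle is that [M n] comes close to [u] while its small part [F n] might run
    elsewhere, and continua need not contain arcs. Thickened connected sets do contain paths, and a
    parity count on [K_{3,3}] replaces any ordering of the crossings. In that graph the piece [B] is
    exceptional: its closure may touch those of the two components over the discs, so one vertex is
    exempt from the separation condition. A fourth crossing supplies a point outside the drawing
    from which the sphere is projected to the plane. *)

Definition infinite_idx (I : set nat) := forall N, exists2 n, (N <= n)%N & I n.

(** * Continuity, closedness and compactness in metric form *)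

Section MetricTools.
Variable R : realType.
Implicit Types V W : normedModType R.

Definition cont_on V W (A : set V) (f : V -> W) :=
  forall x, A x -> forall e : R, 0 < e ->
    exists2 d, 0 < d & forall y, A y -> `|y - x| < d -> `|f y - f x| < e.

Lemma nbhs_norm_ballP V (x : V) (B : set V) :
  nbhs x B <-> exists2 d : R, 0 < d & forall y, `|y - x| < d -> B y.
Proof.
rewrite -nbhs_ballE; split => [[d d0 dB]|[d d0 dB]].
  exists d => // y yx; apply: dB; rewrite -ball_normE /ball_/= distrC //.
by exists d => // y; rewrite -ball_normE /ball_/= distrC => /dB.
Qed.

Lemma cont_onP V W (A : set V) (f : V -> W) :
  {within A, continuous f} <-> cont_on A f.
Proof.
split.
  move=> /subspace_continuousP cf x Ax e e0.
  have /cf/cvgrPdist_lt/(_ e e0) := Ax.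
  rewrite near_withinE => /nbhs_norm_ballP[d d0 dB]; exists d => // y Ay yx.
  by rewrite distrC; apply: dB.
move=> cf; apply/subspace_continuousP => x Ax.
apply/cvgrPdist_lt => e e0; rewrite near_withinE.
have [d d0 dB] := cf x Ax e e0.
apply/nbhs_norm_ballP; exists d => // y yx Ay.
by rewrite distrC; apply: dB.
Qed.

Lemma cont_continuous V W (f : V -> W) : continuous f -> forall A, cont_on A f.
Proof. by move=> cf A; apply/cont_onP; apply: continuous_subspaceT. Qed.

Lemma cont_onS V W (A B : set V) (f : V -> W) : A `<=` B -> cont_on B f -> cont_on A f.
Proof.
move=> AB cf x Ax e e0; have [d d0 dB] := cf x (AB _ Ax) e e0.
by exists d => // y Ay; apply: dB; apply: AB.
Qed.

Lemma closure_normP V (A : set V) x :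
  closure A x <-> forall e : R, 0 < e -> exists2 y, A y & `|y - x| < e.
Proof.
split=> [cA e e0|cA B /nbhs_norm_ballP[d d0 dB]].
  have /cA[y [Ay By]] : nbhs x [set y | `|y - x| < e].
    by apply/nbhs_norm_ballP; exists e.
  by exists y.
by have [y Ay yx] := cA _ d0; exists y; split=> //; exact: dB.
Qed.

Lemma closed_normP V (A : set V) :
  closed A <-> forall x, (forall e : R, 0 < e -> exists2 y, A y & `|y - x| < e) -> A x.
Proof.
split=> [cA x h|cA]; first by apply: cA; apply/closure_normP.
by move=> x /closure_normP h; apply: cA.
Qed.

Lemma open_normP V (A : set V) :
  open A <-> forall x, A x -> exists2 d : R, 0 < d & forall y, `|y - x| < d -> A y.
Proof.
split=> [oA x Ax|oA].
  by apply/nbhs_norm_ballP; exact: open_nbhs_nbhs.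
by rewrite openE => x /oA /nbhs_norm_ballP.
Qed.

Lemma image_cpt V W (A : set V) (f : V -> W) : cont_on A f -> compact A -> compact (f @` A).
Proof. by move=> /cont_onP; exact: continuous_compact. Qed.

Lemma image_conn V W (A : set V) (f : V -> W) : cont_on A f -> connected A -> connected (f @` A).
Proof. by move=> /cont_onP cf cA; exact: connected_continuous_connected. Qed.

Lemma cpt_closed V (A : set V) : compact A -> closed A.
Proof. by apply: compact_closed; exact: norm_hausdorff. Qed.

Lemma sub_cpt V (A B : set V) : closed B -> compact A -> B `<=` A -> compact B.
Proof. by move=> cB cA; exact: subclosed_compact. Qed.

Lemma closed_preimage V W (A : set V) (f : V -> W) (Z : set W) :
  cont_on A f -> closed A -> closed Z -> closed (A `&` f @^-1` Z).
Proof.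
move=> cf /closed_normP cA /closed_normP cZ; apply/closed_normP => x xA.
have Ax : A x by apply: cA => e /xA [y [Ay _] yx]; exists y.
split=> //; apply: cZ => e e0; have [d d0 dB] := cf x Ax e e0.
by have [y [Ay Zy] yx] := xA _ d0; exists (f y) => //; apply: dB.
Qed.

Lemma closed_cball V (c : V) (e : R) : closed [set z | `|z - c| <= e].
Proof.
apply/closed_normP => x xA; rewrite /= leNgt; apply/negP => ex.
have [|y /= ye yx] := xA (`|x - c| - e); first by rewrite subr_gt0.
have := ler_normB (y - c) (y - x); rewrite opprB.
have -> : y - c + (x - y) = x - c by rewrite addrC addrA subrK.
move=> h; lra.
Qed.

Lemma conn_clopen V (A G : set V) : connected A -> G `<=` A -> G !=set0 ->
  closed G -> closed (A `\` G) -> G = A.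
Proof.
move=> cA GA G0 cG cAG; apply: cA => //.
  exists (~` (A `\` G)); first by exact: closed_openC.
  apply/seteqP; split=> [x Gx|x [Ax nx]]; first by split; [exact: GA|case].
  by apply: contrapT => nG; apply: nx.
by exists G => //; apply/seteqP; split=> [x Gx|x []//]; split=> //; exact: GA.
Qed.

(** Compactness is applied to the tails of [I], so the cluster point is approached along [I] itself
    and further conditions can be imposed on the indices afterwards. *)
Lemma cluster_seq V (A : set V) (u : nat -> V) (I : set nat) :
  compact A -> infinite_idx I -> (forall n, I n -> A (u n)) ->
  exists2 x, A x & forall e : R, 0 < e -> infinite_idx (I `&` [set n | `|u n - x| < e]).
Proof.
move=> cA iI IA.
pose F := u @ within I (\oo : set_system nat).
have FF : ProperFilter F.
  apply: fmap_proper_filter; apply: Build_ProperFilter_ex => P [N _ NP].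
  by have [n Nn In] := iI N; exists n; apply: NP.
have FA : F A by exists 0%N => // n _ /= In; exact: IA.
have [x [Ax cx]] := cA F FF FA.
exists x => // e e0 N.
have F1 : F (u @` (I `&` [set n | (N <= n)%N])).
  by exists N => // n /= Nn In; exists n.
have N1 : nbhs x [set y | `|y - x| < e] by apply/nbhs_norm_ballP; exists e.
by have [y [[n [In Nn] <-] ynx]] := cx _ _ F1 N1; exists n.
Qed.

Lemma subsequence V (u : nat -> V) (I : set nat) x :
  (forall e : R, 0 < e -> infinite_idx (I `&` [set n | `|u n - x| < e])) ->
  exists phi : nat -> nat, [/\ forall k, (phi k < phi k.+1)%N, forall k, I (phi k) &
    forall k, `|u (phi k) - x| < k.+1%:R^-1].
Proof.
move=> ux.
have /choice[c cP] : forall p : nat * nat, exists n, (p.2 <= n)%N /\ I n /\ `|u n - x| < p.1.+1%:R^-1.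
  move=> [k N]; have [|n Nn [In un]] := ux k.+1%:R^-1 _ N; first by rewrite invr_gt0.
  by exists n.
pose fix phi k := if k is j.+1 then c (j.+1, (phi j).+1) else c (0, 0)%N.
exists phi; split => [k|k|k].
- by have [/=] := cP (k.+1, (phi k).+1).
- by case: k => [|k] /=; [have [_ []] := cP (0, 0)%N|have [_ []] := cP (k.+1, (phi k).+1)].
- by case: k => [|k]; [have [_ []] := cP (0, 0)%N|have [_ []] := cP (k.+1, (phi k).+1)].
Qed.

Lemma natSinv_lt (e : R) : 0 < e -> exists N, forall n, (N <= n)%N -> n.+1%:R^-1 < e.
Proof.
by move=> e0; have [N _ HN] := near_infty_natSinv_lt (PosNum e0); exists N.
Qed.

Lemma cpt_dist V (A B : set V) : compact A -> closed B -> A `&` B = set0 ->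
  exists2 r : R, 0 < r & forall a b, A a -> B b -> r <= `|a - b|.
Proof.
move=> cA /closed_normP cB AB; apply: contrapT => H.
have /choice[u uP] : forall n, exists a : V, A a /\ exists2 b, B b & `|a - b| < n.+1%:R^-1.
  move=> n; apply: contrapT => Hn; apply: H; exists n.+1%:R^-1; first by rewrite invr_gt0.
  move=> a b Aa Bb; rewrite leNgt; apply/negP => ab; apply: Hn; exists a; split=> //.
  by exists b.
have [||x Ax xu] := @cluster_seq V A u setT cA.
- by move=> N; exists N.
- by move=> n _; have [] := uP n.
suff : (A `&` B) x by rewrite AB.
split=> //; apply: cB => e e0.
have e2 : 0 < e / 2 by rewrite divr_gt0.
have [N HN] := natSinv_lt e2.
have [n Nn [_ /= un]] := xu _ e2 N.
have [_ [b Bb ab]] := uP n; exists b => //.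
have {ab} ab := lt_trans ab (HN _ Nn).
have -> : b - x = (u n - x) - (u n - b) by rewrite opprB [RHS]addrC addrA subrK.
apply: le_lt_trans (ler_normB _ _) _; lra.
Qed.

(* In a compact space components and quasi-components agree. *)
Lemma component_clopen V (X Z : set V) s : compact X -> X s -> closed Z ->
  connected_component X s `&` Z = set0 ->
  exists G, [/\ G `<=` X, G s, closed G, closed (X `\` G) & G `&` Z = set0].
Proof.
move=> cX Xs clZ CZ.
pose GG := [set G | [/\ G `<=` X, G s, closed G & closed (X `\` G)]].
have GGI G G' : GG G -> GG G' -> GG (G `&` G').
  move=> [GX Gs cG cXG] [GX' Gs' cG' cXG']; split.
  - by move=> x [/GX].
  - by [].
  - exact: closedI.
  - by rewrite setDIr; exact: closedU.
have GGX : GG X.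
  by split=> //; [exact: cpt_closed|rewrite setDv; exact: closed0].
pose Q := \bigcap_(G in GG) G.
(* A closed set missed by [Q] is missed by a single member of [GG]: otherwise the traces of these
   members, stable under intersection, would cluster at a point of [Q]. *)
have claim Y : closed Y -> Q `&` Y = set0 -> exists2 G, GG G & G `&` Y = set0.
  move=> clY QY; apply: contrapT => H.
  pose F : set_system V := [set B | exists2 G, GG G & G `&` Y `<=` B].
  have FF : ProperFilter F.
    apply: Build_ProperFilter_ex.
      move=> B [G GGG GB].
      have /set0P[x GYx] : G `&` Y != set0.
        by apply/eqP => G0; apply: H; exists G.
      by exists x; exact: GB.
    split.
    - by exists X.
    - move=> B B' [G GGG GB] [G' GGG' GB']; exists (G `&` G'); first exact: GGI.
      by move=> x [[Gx G'x] Yx]; split; [exact: GB|exact: GB'].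
    - by move=> B B' BB' [G GGG GB]; exists G => // x /GB /BB'.
  have FX : F X by exists X => // x [].
  have [x [Xx cx]] := cX F FF FX.
  suff : (Q `&` Y) x by rewrite QY.
  have key G : GG G -> (G `&` Y) x.
    move=> GGG; have [GX Gs cG _] := GGG.
    have /closure_id -> : closed (G `&` Y) by exact: closedI.
    by move=> B nB; apply: (cx (G `&` Y) B) => //; exists G.
  split; last by have [] := key X GGX.
  by move=> G /key[].
have Qs : Q s by move=> G [].
have QX : Q `<=` X by move=> x; apply.
have cQ : closed Q by apply: closed_bigI => G [].
(* Some member of [GG] lies in the disjoint open thickenings of the two parts; removing the
   thickening of [E1] leaves a member of [GG] that misses [E1], although it must contain [Q]. *)
have sep E0 E1 : closed E0 -> closed E1 -> E0 `&` E1 = set0 -> Q = E0 `|` E1 -> E0 s -> E1 = set0.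
  move=> c0 c1 E01 QE E0s.
  have [|r r0 rP] := @cpt_dist V E0 E1 _ c1 E01.
    by apply: (sub_cpt c0 cX) => x E0x; apply: QX; rewrite QE; left.
  pose O0 := [set x | exists2 a, E0 a & `|x - a| < r / 2].
  pose O1 := [set x | exists2 a, E1 a & `|x - a| < r / 2].
  have oO E : open [set x : V | exists2 a, E a & `|x - a| < r / 2].
    apply/open_normP => x [a Ea xa]; exists (r / 2 - `|x - a|); first by rewrite subr_gt0.
    move=> y yx; exists a => //.
    have -> : y - a = (y - x) + (x - a) by rewrite addrA subrK.
    by apply: le_lt_trans (ler_normD _ _) _; rewrite -ltrBrDr.
  have O01 x : O0 x -> ~ O1 x.
    move=> [a Ea xa] [b Eb xb]; have := rP _ _ Ea Eb.
    have -> : a - b = (x - b) - (x - a) by rewrite opprB [RHS]addrC addrA subrK.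
    by move=> /le_trans/(_ (ler_normB _ _)) h; clear -h xa xb; lra.
  have E0O0 : E0 `<=` O0 by move=> x Ex; exists x => //; rewrite subrr normr0 divr_gt0.
  have E1O1 : E1 `<=` O1 by move=> x Ex; exists x => //; rewrite subrr normr0 divr_gt0.
  have [||G [GX Gs cG cXG] GO] := claim (~` (O0 `|` O1)).
  - by apply: open_closedC; apply: openU; exact: oO.
  - by rewrite -subset0 => x [/[!QE] -[/E0O0|/E1O1] h]; apply; [left|right].
  have GO' x : G x -> O0 x \/ O1 x.
    by move=> Gx; apply: contrapT => nx; have : (G `&` ~` (O0 `|` O1)) x by []; rewrite GO.
  have : GG (G `\` O1).
    split.
    - by move=> x [/GX].
    - by split=> // /(O01 _ (E0O0 _ E0s)).
    - by rewrite setDE; apply: closedI => //; apply: open_closedC; exact: oO.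
    - have -> : X `\` (G `\` O1) = (X `\` G) `|` (G `\` O0).
        apply/seteqP; split=> x.
          move=> [Xx nx]; have [Gx|] := pselect (G x); last by left.
          have [h|/[dup] h _] := pselect (O1 x); last by exfalso; apply: nx.
          by right; split=> // /O01.
        move=> [[Xx nGx]|[Gx nx]]; first by split=> // -[].
        by split; [exact: GX|move=> [_]; apply; have [] := GO' _ Gx].
      apply: closedU => //; rewrite setDE; apply: closedI => //.
      by apply: open_closedC; exact: oO.
  move=> GG1; rewrite -subset0 => x E1x.
  have : Q x by rewrite QE; right.
  by move=> /(_ _ GG1)[_]; apply; exact: E1O1.
have connQ : connected Q.
  move=> B B0 [C oC BC] [D cD BD].
  have cB : closed B by rewrite BD; exact: closedI.
  have cQB : closed (Q `\` B).
    have -> : Q `\` B = Q `&` ~` C.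
      rewrite BC; apply/seteqP; split=> x [Qx h]; split=> //.
        by move=> Cx; apply: h.
      by move=> [].
    by apply: closedI => //; exact: open_closedC.
  have BQ : B `<=` Q by rewrite BD => x [].
  have dj : B `&` (Q `\` B) = set0 by rewrite -subset0 => x [Bx []].
  have un : Q = B `|` (Q `\` B) by rewrite setDUK.
  have [Bs|nBs] := pselect (B s).
    by have := sep B _ cB cQB dj un Bs; move=> E; rewrite [RHS]un E setU0.
  rewrite setIC in dj; rewrite setUC in un.
  have := sep _ B cQB cB dj un (conj Qs nBs).
  by move=> B00; move: B0; rewrite B00 => -[].
have [|G [GX Gs cG cXG] GZ] := claim Z clZ.
  rewrite -subset0 => x [Qx Zx]; rewrite -CZ; split=> //.
  exact: (connected_component_max Qs QX connQ).
by exists G.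
Qed.

End MetricTools.

(** * Closure properties of relative continuity *)

Section ContOn.
Variable R : realType.
Implicit Types V W U : normedModType R.

Lemma cont_on_cst V W (A : set V) (c : W) : cont_on A (fun=> c).
Proof. by move=> x Ax e e0; exists 1 => // y _ _; rewrite subrr normr0. Qed.

Lemma cont_on_id V (A : set V) : cont_on A id.
Proof. by move=> x Ax e e0; exists e. Qed.

Lemma cont_onD V W (A : set V) (f g : V -> W) :
  cont_on A f -> cont_on A g -> cont_on A (fun x => f x + g x).
Proof.
by move=> /cont_onP cf /cont_onP cg; apply/cont_onP => x; apply: cvgD; [exact: cf|exact: cg].
Qed.

Lemma cont_onN V W (A : set V) (f : V -> W) :
  cont_on A f -> cont_on A (fun x => - f x).
Proof. by move=> /cont_onP cf; apply/cont_onP => x; apply: cvgN; exact: cf. Qed.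

Lemma cont_onB V W (A : set V) (f g : V -> W) :
  cont_on A f -> cont_on A g -> cont_on A (fun x => f x - g x).
Proof. by move=> cf cg; apply: cont_onD => //; exact: cont_onN. Qed.

Lemma cont_onM V (A : set V) (f g : V -> R) :
  cont_on A f -> cont_on A g -> cont_on A (fun x => f x * g x).
Proof.
by move=> /cont_onP cf /cont_onP cg; apply/cont_onP => x; apply: cvgM; [exact: cf|exact: cg].
Qed.

Lemma cont_onZ V W (A : set V) (f : V -> R) (g : V -> W) :
  cont_on A f -> cont_on A g -> cont_on A (fun x => f x *: g x).
Proof.
by move=> /cont_onP cf /cont_onP cg; apply/cont_onP => x; apply: cvgZ; [exact: cf|exact: cg].
Qed.

Lemma cont_onV V (A : set V) (f : V -> R) :
  cont_on A f -> (forall x, A x -> f x != 0) -> cont_on A (fun x => (f x)^-1).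
Proof.
move=> /cont_onP/subspace_continuousP cf f0; apply/cont_onP/subspace_continuousP => x Ax.
by apply: cvgV; [exact: f0|exact: cf].
Qed.

Lemma cont_on_comp V W U (A : set V) (B : set W) (f : V -> W) (g : W -> U) :
  cont_on A f -> cont_on B g -> (forall x, A x -> B (f x)) -> cont_on A (fun x => g (f x)).
Proof.
move=> cf cg AB x Ax e e0; have [d d0 dg] := cg _ (AB _ Ax) e e0.
have [d' d'0 df] := cf x Ax d d0; exists d' => // y Ay yx.
by apply: dg; [exact: AB|exact: df].
Qed.

Lemma cont_on_compT V W U (A : set V) (f : V -> W) (g : W -> U) :
  cont_on A f -> continuous g -> cont_on A (fun x => g (f x)).
Proof. by move=> cf cg; apply: (cont_on_comp (B := setT)) => //; exact: cont_continuous. Qed.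

Lemma cont_on_eq V W (A : set V) (f g : V -> W) :
  (forall x, A x -> f x = g x) -> cont_on A f -> cont_on A g.
Proof.
move=> fg cf x Ax e e0; have [d d0 dB] := cf x Ax e e0; exists d => // y Ay yx.
by rewrite -!fg//; exact: dB.
Qed.

Lemma cont_on_norm V W (A : set V) (f : V -> W) :
  cont_on A f -> cont_on A (fun x => `|f x|).
Proof. by move=> /cont_onP cf; apply/cont_onP => x; apply: cvg_norm; exact: cf. Qed.

Lemma cont_on_sum V W (A : set V) (n : nat) (f : nat -> V -> W) :
  (forall i, (i < n)%N -> cont_on A (f i)) -> cont_on A (fun x => \sum_(i < n) f i x).
Proof.
elim: n => [|n IHn] cf.
  by apply: (cont_on_eq (f := fun=> 0)); [move=> x _; rewrite big_ord0|exact: cont_on_cst].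
apply: (cont_on_eq (f := fun x => \sum_(i < n) f i x + f n x)).
  by move=> x _; rewrite big_ord_recr.
by apply: cont_onD; [apply: IHn => i /ltnW/cf|exact: cf].
Qed.

Lemma pair_norm_lt V W (p : V * W) (e : R) : (`|p| < e) = (`|p.1| < e) && (`|p.2| < e).
Proof. by rewrite prod_normE gt_max. Qed.

Lemma cont_on_pair V W U (A : set V) (f : V -> W) (g : V -> U) :
  cont_on A f -> cont_on A g -> cont_on A (fun x => (f x, g x)).
Proof.
move=> cf cg x Ax e e0; have [d d0 df] := cf x Ax e e0; have [d' d'0 dg] := cg x Ax e e0.
exists (Num.min d d'); first by rewrite lt_min d0.
move=> y Ay; rewrite lt_min => /andP[yd yd'].
by rewrite pair_norm_lt /= df ?dg.
Qed.

Lemma cont_on_fst V W U (A : set V) (f : V -> W * U) :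
  cont_on A f -> cont_on A (fun x => (f x).1).
Proof.
move=> cf x Ax e e0; have [d d0 df] := cf x Ax e e0; exists d => // y Ay yx.
by have := df _ Ay yx; rewrite pair_norm_lt => /andP[].
Qed.

Lemma cont_on_snd V W U (A : set V) (f : V -> W * U) :
  cont_on A f -> cont_on A (fun x => (f x).2).
Proof.
move=> cf x Ax e e0; have [d d0 df] := cf x Ax e e0; exists d => // y Ay yx.
by have := df _ Ay yx; rewrite pair_norm_lt => /andP[].
Qed.

Lemma cont_on_glue V W (A B : set V) (f : V -> W) : closed A -> closed B ->
  cont_on A f -> cont_on B f -> cont_on (A `|` B) f.
Proof.
by move=> cA cB /cont_onP fA /cont_onP fB; apply/cont_onP; exact: withinU_continuous.
Qed.

(** The part of [X] where [phi (g x)] is at least [e] away from [phi y] is compact, so its image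
    under [g] is closed, and it misses [y]. *)
Lemma cont_on_quotient V W U (X : set V) (g : V -> W) (phi : W -> U) : compact X ->
  cont_on X g -> cont_on X (fun x => phi (g x)) -> cont_on (g @` X) phi.
Proof.
move=> cX cg cpg y [x0 Xx0 gx0] e e0.
pose C := X `&` (fun x => phi (g x)) @^-1` [set z | e <= `|z - phi y|].
have cZ : closed [set z : U | e <= `|z - phi y|].
  apply/closed_normP => z hz; rewrite /= leNgt; apply/negP => ze.
  have [|w /= ew wz] := hz (e - `|z - phi y|); first by rewrite subr_gt0.
  have := ler_normD (w - z) (z - phi y); rewrite addrA subrK; lra.
have cC : closed C by apply: closed_preimage => //; exact: cpt_closed.
have cptC : compact C by apply: (sub_cpt cC cX) => x [].
have cg' : cont_on C g by apply: cont_onS cg => x [].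
have clI := cpt_closed (image_cpt cg' cptC).
have nIy : ~ (g @` C) y.
  by move=> [x [Xx /= ex] gx]; move: ex; rewrite gx subrr normr0 leNgt e0.
have /open_normP/(_ y nIy)[d d0 dB] := closed_openC clI.
exists d => // z [x Xx gxz] zy; rewrite ltNge; apply/negP => ez.
by apply: (dB z zy); exists x => //; split=> //=; rewrite gxz.
Qed.

End ContOn.

(** * Angles in the plane *)

Section Angles.
Variable R : realType.
Local Notation plane := (R * R)%type.
Implicit Types p q w z : plane.

Definition dot p q := p.1 * q.1 + p.2 * q.2.
Definition crs p q := p.1 * q.2 - p.2 * q.1.

(* The direction of [q] is that of [p] turned by the angle [t]. *)
Definition rotto (t : R) p q := exists2 k, 0 < k &
  q = (k * (cos t * p.1 - sin t * p.2), k * (sin t * p.1 + cos t * p.2)).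

Lemma rotto0 p : rotto 0 p p.
Proof. by exists 1 => //; rewrite cos0 sin0 !mul1r !mul0r subr0 add0r; case: p. Qed.

Lemma rotto_trans s t p q w : rotto s p q -> rotto t q w -> rotto (s + t) p w.
Proof.
move=> [k k0 ->] [l l0 ->]; exists (l * k); first exact: mulr_gt0.
by rewrite /= cosD sinD; congr (_, _); ring.
Qed.

Lemma rotto_sym t p q : rotto t p q -> rotto (- t) q p.
Proof.
move=> [k k0 ->]; exists k^-1; first by rewrite invr_gt0.
have kk : k^-1 * k = 1 by rewrite mulVf ?gt_eqF.
have cs := cos2Dsin2 t.
have e1 : p.1 = k^-1 * k * (cos t ^+ 2 + sin t ^+ 2) * p.1 by rewrite kk cs !mul1r.
have e2 : p.2 = k^-1 * k * (cos t ^+ 2 + sin t ^+ 2) * p.2 by rewrite kk cs !mul1r.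
by rewrite cosN sinN [LHS]surjective_pairing {1}e1 {1}e2 /=; congr (_, _); ring.
Qed.

Lemma dot_gt0 p : p != 0 -> 0 < dot p p.
Proof.
move=> p0; rewrite /dot -!expr2 lt_neqAle addr_ge0 ?sqr_ge0// andbT eq_sym.
rewrite paddr_eq0 ?sqr_ge0// !sqrf_eq0; apply: contraNN p0 => /andP[/eqP a /eqP b].
by apply/eqP; rewrite [p]surjective_pairing a b.
Qed.

Lemma rotto_dot t p q : rotto t p q -> p != 0 ->
  0 < cos t * dot p q + sin t * crs p q /\ sin t * dot p q = cos t * crs p q.
Proof.
move=> [k k0 ->] /dot_gt0; rewrite /dot /crs /= => p0; split; last by ring.
have -> : cos t * (p.1 * (k * (cos t * p.1 - sin t * p.2)) +
     p.2 * (k * (sin t * p.1 + cos t * p.2))) +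
   sin t * (p.1 * (k * (sin t * p.1 + cos t * p.2)) -
     p.2 * (k * (cos t * p.1 - sin t * p.2))) =
  k * (cos t ^+ 2 + sin t ^+ 2) * (p.1 * p.1 + p.2 * p.2) by ring.
by rewrite cos2Dsin2 mulr1 mulr_gt0.
Qed.

Lemma rotto_neq0 t p q : rotto t p q -> p != 0 -> q != 0.
Proof.
move=> h p0; have [+ _] := rotto_dot h p0; apply: contraTneq => ->.
by rewrite /dot /crs /= !mulr0 subr0 addr0 !mulr0 addr0 ltxx.
Qed.

Lemma rotto_cos1 t p : rotto t p p -> p != 0 -> cos t = 1.
Proof.
move=> h p0; have [] := rotto_dot h p0; have d0 := dot_gt0 p0.
have -> : crs p p = 0 by rewrite /crs; ring.
rewrite !mulr0 addr0 => c0 /eqP; rewrite mulf_eq0 (gt_eqF d0) orbF => /eqP s0.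
have ct : 0 < cos t by rewrite -(pmulr_lgt0 _ d0).
by have := sin0cos1 s0; rewrite gtr0_norm.
Qed.

(** Angles are determined up to full turns. The condition [cos = 1] expresses this congruence
    throughout without naming an integer. *)
Lemma rotto_uniq s t p q : p != 0 -> rotto s p q -> rotto t p q -> cos (s - t) = 1.
Proof. by move=> p0 h /rotto_sym/(rotto_trans h)/rotto_cos1; apply. Qed.

Lemma cos1_sin0 (t : R) : cos t = 1 -> sin t = 0.
Proof. by move=> c1; apply: cos1sin0; rewrite c1 normr1. Qed.

Lemma rotto_shift s t p q : rotto t p q -> cos s = 1 -> rotto (t + s) p q.
Proof.
move=> h c1; apply: rotto_trans h _; exists 1 => //.
by rewrite c1 (cos1_sin0 c1) !mul1r !mul0r subr0 add0r; case: q.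
Qed.

(** The principal branch, a true angle only in the half plane [0 < dot p q], where the quotient is
    its tangent. *)
Definition arg p q := atan (crs p q / dot p q).

Lemma rotto_arg p q : 0 < dot p q -> rotto (arg p q) p q.
Proof.
move=> d0.
have p0 : p != 0 by apply: contraTneq d0 => ->; rewrite /dot /= !mul0r addr0 ltxx.
have P0 := dot_gt0 p0.
have c0 : 0 < cos (arg p q).
  by apply: cos_gt0_pihalf; rewrite atan_gtNpi2 atan_ltpi2.
have st : sin (arg p q) = cos (arg p q) * (crs p q / dot p q).
  by rewrite -(atanK (crs p q / dot p q)) /tan mulrCA mulfV ?mulr1// gt_eqF.
exists (dot p q / (cos (arg p q) * dot p p)); first by rewrite divr_gt0// mulr_gt0.
have cn := lt0r_neq0 c0; have dn := lt0r_neq0 d0; have Pn := lt0r_neq0 P0.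
have f1 : cos (arg p q) * p.1 - sin (arg p q) * p.2 = cos (arg p q) / dot p q * (q.1 * dot p p).
  rewrite st; transitivity (cos (arg p q) / dot p q * (dot p q * p.1 - crs p q * p.2)).
    by rewrite mulrBr !mulrA divfK//; ring.
  by congr (_ * _); rewrite /dot /crs; ring.
have f2 : sin (arg p q) * p.1 + cos (arg p q) * p.2 = cos (arg p q) / dot p q * (q.2 * dot p p).
  rewrite st; transitivity (cos (arg p q) / dot p q * (crs p q * p.1 + dot p q * p.2)).
    by rewrite mulrDr !mulrA divfK//; ring.
  by congr (_ * _); rewrite /dot /crs; ring.
rewrite f1 f2 [LHS]surjective_pairing; congr (_, _).
all: by field; rewrite cn dn Pn.
Qed.

Lemma rotto_opp p : rotto pi p (- p).
Proof.
by exists 1 => //; rewrite cospi sinpi !mul1r !mul0r subr0 add0r !mulN1r; case: p.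
Qed.

Lemma rotto_ex p q : p != 0 -> q != 0 -> exists t, rotto t p q.
Proof.
move=> p0 q0; have P0 := dot_gt0 p0; have Q0 := dot_gt0 q0.
have [d|d|d] := ltgtP (dot p q) 0.
- have d' : 0 < dot p (- q) by move: d; rewrite /dot /=; lra.
  by exists (arg p (- q) + pi); have := rotto_trans (rotto_arg d') (rotto_opp _); rewrite opprK.
- by exists (arg p q); exact: rotto_arg.
have c0 : crs p q != 0.
  apply/eqP => c0; have : dot p p * dot q q = dot p q ^+ 2 + crs p q ^+ 2.
    by rewrite /dot /crs; ring.
  by rewrite d c0 expr0n addr0 => /eqP; rewrite mulf_eq0 !gt_eqF.
have e1 : dot p p * q.1 = - crs p q * p.2 + dot p q * p.1 by rewrite /dot /crs; ring.
have e2 : dot p p * q.2 = crs p q * p.1 + dot p q * p.2 by rewrite /dot /crs; ring.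
have Pn := lt0r_neq0 P0.
have g1 : q.1 = - crs p q * p.2 / dot p p.
  by apply: (mulfI Pn); rewrite e1 d mul0r addr0; field.
have g2 : q.2 = crs p q * p.1 / dot p p.
  by apply: (mulfI Pn); rewrite e2 d mul0r addr0; field.
have [c|c|c] := ltgtP (crs p q) 0; last by rewrite c eqxx in c0.
  exists (- (pi / 2)); exists (- crs p q / dot p p); first by rewrite divr_gt0// oppr_gt0.
  rewrite cosN sinN cos_pihalf sin_pihalf [LHS]surjective_pairing g1 g2.
  by congr (_, _); field.
exists (pi / 2); exists (crs p q / dot p p); first by rewrite divr_gt0.
rewrite cos_pihalf sin_pihalf [LHS]surjective_pairing g1 g2.
by congr (_, _); field.
Qed.

(** The plane carries the sup norm, so displacements are compared with the larger coordinate; below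
    half of it they cannot outweigh its square. *)
Lemma dot_close_aux (a b u v : R) : `|u| * 2 < Num.max `|a| `|b| ->
  `|v| * 2 < Num.max `|a| `|b| -> 0 < a * (a + u) + b * (b + v).
Proof.
wlog le12 : u v a b / `|a| <= `|b|.
  move=> H; have [le12|/ltW le21] := leP `|a| `|b|.
    by move=> hu hv; apply: H => //; rewrite (max_idPr le12).
  by move=> hu hv; rewrite addrC; apply: H => //; rewrite maxC (max_idPl le21).
rewrite (max_idPr le12); move: le12; case: (ger0P a) => a0; case: (ger0P b) => b0;
 case: (ger0P u) => u0; case: (ger0P v) => v0; nra.
Qed.

Lemma dot_close p q : `|q - p| * 2 < `|p| -> 0 < dot p q.
Proof.
rewrite !prod_normE /= /dot => h.
have := @dot_close_aux p.1 p.2 (q.1 - p.1) (q.2 - p.2); rewrite !addrA ![_ + q.1]addrC ![_ + q.2]addrC !addrK.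
by apply; apply: le_lt_trans h; rewrite ler_wpM2r// le_max lexx ?orbT.
Qed.

Lemma cont_on_dot (V : normedModType R) (A : set V) (f g : V -> plane) :
  cont_on A f -> cont_on A g -> cont_on A (fun x => dot (f x) (g x)).
Proof.
move=> cf cg; apply: cont_onD; apply: cont_onM;
by [apply: cont_on_fst|apply: cont_on_snd].
Qed.

Lemma cont_on_arg (V : normedModType R) (A : set V) (f g : V -> plane) :
  cont_on A f -> cont_on A g -> (forall x, A x -> 0 < dot (f x) (g x)) ->
  cont_on A (fun x => arg (f x) (g x)).
Proof.
move=> cf cg d0; apply: cont_on_compT; last by move=> x; exact: continuous_atan.
apply: cont_onM.
  by apply: cont_onB; apply: cont_onM; by [apply: cont_on_fst|apply: cont_on_snd].
apply: cont_onV; first exact: cont_on_dot.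
by move=> x Ax; apply: lt0r_neq0; exact: d0.
Qed.

(** The values lie in a discrete set. If two of them differed, the intermediate value theorem would
    give a gap [d] in []0, pi]] with [cos d = 1], against injectivity of the cosine on [[0, pi]]. *)
Lemma cos1_const (V : normedModType R) (X : set V) (f : V -> R) : connected X -> cont_on X f ->
  (forall x, X x -> cos (f x) = 1) -> forall x y, X x -> X y -> f x = f y.
Proof.
move=> cX cf c1.
suff H x y : X x -> X y -> ~ f x < f y.
  move=> x y Xx Xy; apply/eqP; rewrite eq_le !leNgt.
  by apply/andP; split; apply/negP; exact: H.
move=> Xx Xy fxy.
have /connected_intervalP iX := image_conn cf cX.
pose d := Num.min pi (f y - f x).
have d0 : 0 < d by rewrite lt_min pi_gt0 subr_gt0.
have [|z Xz fz] := iX _ _ (ex_intro2 _ _ x Xx erefl) (ex_intro2 _ _ y Xy erefl) (f x + d).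
  by rewrite lerDl (ltW d0)/= -lerBrDl ge_min lexx orbT.
have cd : cos d = 1.
  have -> : d = f z - f x by rewrite fz addrC addKr.
  by rewrite cosB !c1// (cos1_sin0 (c1 _ Xx)) mulr0 addr0 mulr1.
have : d = 0.
  apply: (@cos_inj R); rewrite ?in_itv/= ?lexx ?pi_ge0 ?cd ?cos0//.
  by rewrite (ltW d0)/= ge_min lexx.
by move=> dd; rewrite dd ltxx in d0.
Qed.

End Angles.

(** * Continuous choice of angle on star-shaped sets *)

Section Lifting.
Variable R : realType.
Implicit Types V : normedModType R.
Local Notation plane := (R * R)%type.

Lemma cpt_bounded V (A : set V) : compact A -> exists2 M : R, 0 < M & forall x, A x -> `|x| <= M.
Proof.
move=> cA; apply: contrapT => H.
have /choice[u uP] : forall n : nat, exists x, A x /\ n.+1%:R < `|x|.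
  move=> n; apply: contrapT => Hn; apply: H; exists n.+1%:R => // x Ax.
  by rewrite leNgt; apply/negP => xn; apply: Hn; exists x.
have [||x Ax xu] := @cluster_seq R V A u setT cA.
- by move=> N; exists N.
- by move=> n _; have [] := uP n.
have [N] : exists N : nat, `|x| + 1 < N%:R.
  by exists (Num.bound (`|x| + 1)); apply: archi_boundP; rewrite addr_ge0.
have [n Nn [_ /= un]] := xu 1 ltr01 N; have [_ nu] := uP n.
have N2 : N%:R <= n.+1%:R :> R by rewrite ler_nat ltnW.
have := ler_normD (u n - x) x; rewrite subrK => h1 h2.
move: N2 nu h1 h2 un; move: (N%:R : R) (n.+1%:R : R) => a b; lra.
Qed.

Definition star V (c : V) (X : set V) :=
  X c /\ forall x (t : R), X x -> 0 <= t <= 1 -> X (c + t *: (x - c)).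

Lemma star_connected V (c : V) (X : set V) : star c X -> connected X.
Proof.
move=> [Xc sX].
have -> : X = \bigcup_(x in X) ((fun t : R => c + t *: (x - c)) @` `[0, 1]).
  apply/seteqP; split=> [x Xx|x [y Xy [t]]].
    exists x => //; exists 1; first by rewrite /= in_itv/= ler01 lexx.
    by rewrite scale1r addrC subrK.
  by rewrite /= in_itv/= => t01 <-; exact: sX.
apply: bigcup_connected.
  exists c => x Xx; exists 0; first by rewrite /= in_itv/= lexx ler01.
  by rewrite scale0r addr0.
move=> x Xx; apply: image_conn; last exact: segment_connected.
apply: cont_onD; first exact: cont_on_cst.
by apply: cont_onZ; [exact: cont_on_id|exact: cont_on_cst].
Qed.

(** Each ray from [0] is cut into [N.+1] steps so short that consecutive values of [h] make an acute
    angle, with one [N] for all rays by compactness. The sum of the principal angles along the ray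
    depends continuously on its end point. *)
Lemma lift_star V (X : set V) (h : V -> plane) : compact X -> star 0 X ->
  cont_on X h -> (forall z, X z -> h z != 0) ->
  exists2 T : V -> R, cont_on X T & forall z, X z -> rotto (T z) (h 0) (h z).
Proof.
move=> cX [X0 sX] ch h0.
have {}sX z (t : R) : X z -> 0 <= t <= 1 -> X (t *: z).
  by move=> Xz t01; have := sX z t Xz t01; rewrite subr0 add0r.
have fr n i : (i <= n.+1)%N -> 0 <= (i%:R / n.+1%:R : R) <= 1.
  by move=> ni; rewrite divr_ge0//= ler_pdivrMr ?ltr0n// mul1r ler_nat.
have [N NP] : exists N, forall z i, X z -> (i <= N)%N ->
    `|h ((i.+1%:R / N.+1%:R) *: z) - h ((i%:R / N.+1%:R) *: z)| * 2 <
    `|h ((i%:R / N.+1%:R) *: z)|.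
  apply: contrapT => H.
  have /choice[f fP] : forall n, exists p : V * nat, X p.1 /\ (p.2 <= n)%N /\
    ~ (`|h ((p.2.+1%:R / n.+1%:R) *: p.1) - h ((p.2%:R / n.+1%:R) *: p.1)| * 2 <
    `|h ((p.2%:R / n.+1%:R) *: p.1)|).
    move=> n; apply: contrapT => Hn; apply: H; exists n => z i Xz ni.
    by apply: contrapT => Hz; apply: Hn; exists (z, i).
  pose w n := ((f n).2%:R / n.+1%:R : R) *: (f n).1.
  have [M M0 MP] := cpt_bounded cX.
  have [||x Xx xw] := @cluster_seq R V X w setT cX.
  - by move=> N; exists N.
  - by move=> n _; have [? [ni _]] := fP n; apply: sX => //; apply: fr; exact: leqW.
  have hx : 0 < `|h x| by rewrite normr_gt0 h0.
  have [|d d0 dP] := ch x Xx (`|h x| / 8); first by rewrite divr_gt0.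
  have [|N HN] := @natSinv_lt R (d / (2 * M)); first by rewrite divr_gt0// mulr_gt0.
  have d2 : 0 < d / 2 by rewrite divr_gt0.
  have [n Nn [_ /= wn]] := xw _ d2 N.
  have [Xf [ni nf]] := fP n; apply: nf.
  have h1 : `|h (w n) - h x| < `|h x| / 8.
    apply: dP; first by apply: sX => //; apply: fr; exact: leqW.
    by apply: lt_trans wn _; rewrite ltr_pdivrMr// ltr_pMr// ltr1n.
  pose w' := ((f n).2.+1%:R / n.+1%:R : R) *: (f n).1.
  have w'w : `|w' - w n| < d / 2.
    rewrite /w' /w -scalerBl -mulrBl -natrB// subSnn mul1r normrZ gtr0_norm ?invr_gt0//.
    apply: le_lt_trans (_ : n.+1%:R^-1 * M < _).
      by rewrite ler_wpM2l ?invr_ge0// MP.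
    by rewrite -ltr_pdivlMr// (lt_le_trans (HN _ Nn))// -mulrA invfM.
  have h2 : `|h w' - h x| < `|h x| / 8.
    apply: dP; first by apply: sX => //; exact: fr.
    have -> : w' - x = (w' - w n) + (w n - x) by rewrite addrA subrK.
    apply: le_lt_trans (ler_normD _ _) _; move: w'w wn; clear; lra.
  have h3 : `|h w' - h (w n)| <= `|h w' - h x| + `|h (w n) - h x|.
    have -> : h w' - h (w n) = (h w' - h x) - (h (w n) - h x).
      by rewrite opprB addrA subrK.
    exact: ler_normB.
  have h4 : `|h x| <= `|h (w n)| + `|h (w n) - h x|.
    have := ler_normB (h (w n)) (h (w n) - h x); rewrite opprB addrC subrK; apply.
  rewrite -/w'; move: h1 h2 h3 h4; rewrite -/(w n); clear -hx; lra.
pose T z := \sum_(i < N.+1) arg (h ((i%:R / N.+1%:R) *: z)) (h ((i.+1%:R / N.+1%:R) *: z)).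
have dotP z i : X z -> (i < N.+1)%N ->
   0 < dot (h ((i%:R / N.+1%:R) *: z)) (h ((i.+1%:R / N.+1%:R) *: z)).
  by move=> Xz iN; apply: dot_close; exact: NP.
exists T.
  apply: (@cont_on_sum R V R X N.+1
    (fun i z => arg (h ((i%:R / N.+1%:R) *: z)) (h ((i.+1%:R / N.+1%:R) *: z)))) => i iN.
  have cs j : (j <= N.+1)%N -> cont_on X (fun z => h ((j%:R / N.+1%:R) *: z)).
    move=> jN; apply: (@cont_on_comp _ _ _ _ X X _ h) => //.
      by apply: cont_onZ; [exact: cont_on_cst|exact: cont_on_id].
    by move=> x Xx; apply: sX => //; exact: fr.
  by apply: cont_on_arg; [apply: cs; exact: ltnW|exact: cs|move=> x Xx; exact: dotP].
move=> z Xz.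
suff H m : (m <= N.+1)%N -> rotto (\sum_(i < m) arg (h ((i%:R / N.+1%:R) *: z))
    (h ((i.+1%:R / N.+1%:R) *: z))) (h 0) (h ((m%:R / N.+1%:R) *: z)).
  by have := H N.+1 (leqnn _); rewrite divff ?scale1r.
elim: m => [|m IHm] mN; first by rewrite big_ord0 mul0r scale0r; exact: rotto0.
rewrite big_ord_recr /=; apply: rotto_trans (IHm (ltnW mN)) _.
by apply: rotto_arg; exact: dotP.
Qed.

End Lifting.

(** * Connected sets and paths *)

Section Connectivity.
Variable R : realType.
Implicit Types V : normedModType R.

(** The points of [S] with [P] and those without form relatively open sets. As [y] and [z] can be
    exchanged, a one-way implication near each point is enough. *)
Lemma connected_local V (S : set V) (P : V -> Prop) : connected S ->
  (forall x, S x -> exists2 d : R, 0 < d &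
    forall y z, S y -> S z -> `|y - x| < d -> `|z - x| < d -> P y -> P z) ->
  forall x y, S x -> S y -> P x -> P y.
Proof.
move=> cS loc x y Sx Sy Px.
have opn (Q : V -> Prop) : open [set z | exists2 w, S w /\ Q w & exists2 d : R, 0 < d &
    (forall y z, S y -> S z -> `|y - w| < d -> `|z - w| < d -> P y -> P z) /\ `|z - w| < d].
  apply/open_normP => z [w Sw [d d0 [h zw]]]; exists (d - `|z - w|); first by rewrite subr_gt0.
  move=> z' zz'; exists w => //; exists d => //; split=> //.
  have -> : z' - w = (z' - z) + (z - w) by rewrite addrA subrK.
  by apply: le_lt_trans (ler_normD _ _) _; rewrite -ltrBrDr.
have E : [set z | S z /\ P z] = S.
  apply: cS; first by exists x.
    eexists; first exact: (opn P).
    apply/seteqP; split=> [z [Sz Pz]|z [Sz [w [Sw Pw] [d d0 [h zw]]]]]; split=> //.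
      have [d d0 h] := loc z Sz; exists z => //; exists d => //; split=> //.
      by rewrite subrr normr0.
    by apply: (h w) => //; rewrite subrr normr0.
  exists (~` [set z | exists2 w, S w /\ ~ P w & exists2 d : R, 0 < d &
    (forall y z, S y -> S z -> `|y - w| < d -> `|z - w| < d -> P y -> P z) /\ `|z - w| < d]).
    by apply: open_closedC; exact: (opn (fun z => ~ P z)).
  apply/seteqP; split=> [z [Sz Pz]|z [Sz nz]]; split=> //.
    move=> [w [Sw nPw] [d d0 [h zw]]]; apply: nPw; apply: (h z) => //.
    by rewrite subrr normr0.
  apply: contrapT => nPz; apply: nz; have [d d0 h] := loc z Sz.
  by exists z => //; exists d => //; split=> //; rewrite subrr normr0.
by have : S y by []; rewrite -E => -[].
Qed.

Lemma ball_star V (c : V) (d : R) : 0 < d -> star c [set y | `|y - c| < d].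
Proof.
move=> d0; split=> [|x t /= xc /andP[t0 t1]] /=; first by rewrite subrr normr0.
rewrite addrC addKr normrZ ger0_norm//; apply: le_lt_trans xc.
by rewrite ler_piMl.
Qed.

Lemma cball_star V (c : V) (d : R) : 0 <= d -> star c [set y | `|y - c| <= d].
Proof.
move=> d0; split=> [|x t /= xc /andP[t0 t1]] /=; first by rewrite subrr normr0.
rewrite addrC addKr normrZ ger0_norm//; apply: le_trans xc.
by rewrite ler_piMl.
Qed.

Lemma open_ball V (c : V) (d : R) : open [set y | `|y - c| < d].
Proof.
apply/open_normP => z zw; exists (d - `|z - c|); first by rewrite subr_gt0.
move=> z' zz' /=; have -> : z' - c = (z' - z) + (z - c) by rewrite addrA subrK.
by apply: le_lt_trans (ler_normD _ _) _; rewrite -ltrBrDr.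
Qed.

Lemma component_open V (O : set V) x : open O -> open (connected_component O x).
Proof.
move=> /open_normP oO; apply/open_normP => y Cy.
have [d d0 dO] := oO y (connected_component_sub Cy).
exists d => // z zy; apply: connected_component_trans Cy _.
exists [set y' | `|y' - y| < d] => //; split=> //=; first by rewrite subrr normr0.
by apply: star_connected; exact: ball_star.
Qed.

Lemma closure_component V (O : set V) x :
  open O -> closure (connected_component O x) `&` O `<=` connected_component O x.
Proof.
move=> oO y [/closure_normP cy Oy].
have /open_normP := component_open y oO.
move=> /(_ y (connected_component_refl Oy))[d d0 dP].
have [z Cz zy] := cy d d0.
by apply: connected_component_trans Cz _; apply: connected_component_sym; exact: dP.
Qed.

Definition path_in V (G : set V) (a b : V) := exists g : R -> V,
  [/\ cont_on setT g, g 0 = a, g 1 = b & forall t, 0 <= t <= 1 -> G (g t)].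

Lemma path_in_refl V (G : set V) a : G a -> path_in G a a.
Proof. by move=> Ga; exists (fun=> a); split=> //; exact: cont_on_cst. Qed.

Lemma path_inS V (G G' : set V) a b : G `<=` G' -> path_in G a b -> path_in G' a b.
Proof. by move=> GG [g [cg ga gb gG]]; exists g; split=> // t /gG/GG. Qed.

Lemma path_in_seg V (G : set V) a b :
  (forall t, 0 <= t <= 1 -> G (a + t *: (b - a))) -> path_in G a b.
Proof.
move=> GG; exists (fun t => a + t *: (b - a)); split=> //.
- apply: cont_onD; first exact: cont_on_cst.
  by apply: cont_onZ; [exact: cont_on_id|exact: cont_on_cst].
- by rewrite scale0r addr0.
- by rewrite scale1r addrC subrK.
Qed.

Lemma path_in_sym V (G : set V) a b : path_in G a b -> path_in G b a.
Proof.
move=> [g [cg ga gb gG]]; exists (fun t => g (1 - t)); split.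
- apply: (@cont_on_comp _ _ _ _ setT setT _ g) => //.
  by apply: cont_onB; [exact: cont_on_cst|exact: cont_on_id].
- by rewrite subr0.
- by rewrite subrr.
- by move=> t /andP[t0 t1]; apply: gG; rewrite subr_ge0 t1/= lerBlDr lerDl.
Qed.

Lemma path_in_trans V (G : set V) a b c : path_in G a b -> path_in G b c -> path_in G a c.
Proof.
have z2 : 0 <= 1 / 2 :> R by lra.
have o2 : 1 / 2 <= 1 :> R by lra.
have e1 : 2 * 1 - 1 = 1 :> R by lra.
have lo (t : R) : 0 <= t -> t <= 1 / 2 -> 0 <= 2 * t <= 1.
  by move=> *; apply/andP; split; lra.
have hi (t : R) : t <= 1 -> 1 / 2 <= t -> 0 <= 2 * t - 1 <= 1.
  by move=> *; apply/andP; split; lra.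
(* [mn] is the minimum of [2 * t] and [1], [mx] the maximum of [2 * t - 1] and [0]. One of the two
   paths always rests at the common point, so [g (mn t) + h (mx t) - g 1] is the concatenation,
   continuous on the whole line. *)
pose mn t : R := (2 * t + 1 - `|2 * t - 1|) / 2.
pose mx t : R := (2 * t - 1 + `|2 * t - 1|) / 2.
have mnE t : t <= 1 / 2 -> mn t = 2 * t.
  by move=> t2; rewrite /mn ler0_norm; lra.
have mnE' t : 1 / 2 <= t -> mn t = 1.
  by move=> t2; rewrite /mn ger0_norm; lra.
have mxE t : t <= 1 / 2 -> mx t = 0.
  by move=> t2; rewrite /mx ler0_norm; lra.
have mxE' t : 1 / 2 <= t -> mx t = 2 * t - 1.
  by move=> t2; rewrite /mx ger0_norm; lra.
move=> [g [cg ga gb gG]] [h [ch hb hc hG]].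
have c2 : cont_on setT (fun t : R => 2 * t - 1).
  apply: cont_onB; last exact: cont_on_cst.
  by apply: cont_onM; [exact: cont_on_cst|exact: cont_on_id].
have cmn : cont_on setT mn.
  apply: cont_onM; last exact: cont_on_cst.
  apply: cont_onB; last exact: cont_on_norm.
  apply: cont_onD; last exact: cont_on_cst.
  by apply: cont_onM; [exact: cont_on_cst|exact: cont_on_id].
have cmx : cont_on setT mx.
  apply: cont_onM; last exact: cont_on_cst.
  by apply: cont_onD => //; exact: cont_on_norm.
exists (fun t => g (mn t) + h (mx t) - g 1); split.
- apply: cont_onB; last exact: cont_on_cst.
  by apply: cont_onD; [apply: (cont_on_comp (B := setT) cmn)|apply: (cont_on_comp (B := setT) cmx)].
- by rewrite mnE// mxE// mulr0 hb gb addrK.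
- by rewrite mnE'// mxE'// e1 addrC addKr.
move=> t /andP[t0 t1]; have [t2|/ltW t2] := leP t (1 / 2).
  by rewrite mnE// mxE// hb gb addrK; apply: gG; exact: lo.
by rewrite mnE'// mxE'// addrC addKr; apply: hG; exact: hi.
Qed.

Lemma path_in_star V (G : set V) c a b : star c G -> G a -> G b -> path_in G a b.
Proof.
move=> [Gc sG] Ga Gb; apply: (@path_in_trans _ _ _ c); first apply: path_in_sym.
  by apply: path_in_seg => t; exact: sG.
by apply: path_in_seg => t; exact: sG.
Qed.

Lemma open_connected_path V (G : set V) a b : open G -> connected G -> G a -> G b -> path_in G a b.
Proof.
move=> /open_normP oG cG Ga Gb.
apply: (@connected_local V G (fun y => path_in G a y) cG _ a b) => //; last exact: path_in_refl.
move=> x Gx; have [d d0 dG] := oG x Gx; exists d => // y z Gy Gz yx zx.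
move=> /path_in_trans; apply; apply: (path_inS (G := [set y | `|y - x| < d])); first by move=> w /= /dG.
by apply: (path_in_star (ball_star x d0)).
Qed.

(** A connected set need not contain any arc, but jumps inside [N] within balls of radius [r] can be
    filled by segments through the centres. *)
Lemma nbhd_path V (N : set V) (r : R) a b : 0 < r -> connected N -> N a -> N b ->
  path_in [set z | exists2 w, N w & `|z - w| < r] a b.
Proof.
move=> r0 cN Na Nb.
apply: (@connected_local V N (fun y => path_in _ a y) cN _ a b) => //; last first.
  by apply: path_in_refl; exists a => //; rewrite subrr normr0.
move=> x Nx; exists r => // y z Ny Nz yx zx.
move=> /path_in_trans; apply; apply: (path_inS (G := [set y | `|y - x| < r])); first by move=> w /= wx; exists x.
by apply: (path_in_star (ball_star x r0)).
Qed.

End Connectivity.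

Section PlaneSets.
Variable R : realType.
Local Notation plane := (R * R)%type.
Implicit Types p q z : plane.

Lemma plane_cball_cpt (c : plane) (d : R) : compact [set z | `|z - c| <= d].
Proof.
have -> : [set z | `|z - c| <= d] = `[c.1 - d, c.1 + d] `*` `[c.2 - d, c.2 + d].
  apply/seteqP; split=> z /=; rewrite prod_normE ge_max /= !ler_norml !in_itv/= !lerBrDl !lerBlDl.
    move=> /andP[/andP[a b] /andP[a' b']]; split; apply/andP; split; lra.
  by move=> [/andP[a b] /andP[a' b']]; apply/andP; split; apply/andP; split; lra.
by apply: compact_setX; exact: segment_compact.
Qed.

Lemma plane_closed_cpt (A : set plane) (M : R) : closed A -> (forall z, A z -> `|z| <= M) -> compact A.
Proof.
move=> cA AM; apply: (sub_cpt cA (@plane_cball_cpt 0 M)) => z Az /=.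
by rewrite subr0 AM.
Qed.

Lemma path_image (G : set plane) a b : path_in G a b ->
  exists K, [/\ compact K, connected K, K a, K b & K `<=` G].
Proof.
move=> [g [cg ga gb gG]]; exists (g @` `[0, 1]); split.
- by apply: image_cpt; [exact: cont_onS cg|exact: segment_compact].
- by apply: image_conn; [exact: cont_onS cg|exact: segment_connected].
- by exists 0 => //=; rewrite in_itv/= lexx ler01.
- by exists 1 => //=; rewrite in_itv/= lexx ler01.
- by move=> _ [t /= t01 <-]; apply: gG; rewrite in_itv in t01.
Qed.

(** Connected compacta through [g0] form a directed family. If none contained [X], the remainders
    would cluster at some [x] in [X]; adding a path to [x] and a closed ball around it clears the
    remainder there. *)
Lemma cpt_conn_hull (G X : set plane) g0 : open G -> connected G -> G g0 -> compact X -> X `<=` G ->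
  exists K, [/\ compact K, connected K, X `<=` K & K `<=` G].
Proof.
move=> oG cG Gg cX XG.
pose KK := [set K | [/\ compact K, connected K, K g0 & K `<=` G]].
apply: contrapT => H.
have K0 : KK [set g0].
  by split=> //; [exact: compact_set1|exact: connected1|move=> _ ->].
pose F : set_system plane := [set B | exists2 K, KK K & X `\` K `<=` B].
have FF : ProperFilter F.
  apply: Build_ProperFilter_ex.
    move=> B [K [cK conK Kg KG] XKB].
    have /set0P[x xK] : X `\` K != set0.
      apply/eqP => XK; apply: H; exists K; split=> // x Xx; apply: contrapT => nKx.
      by have : (X `\` K) x by []; rewrite XK.
    by exists x; exact: XKB.
  split.
  - by exists [set g0].
  - move=> B B' [K [cK conK Kg KG] XKB] [K' [cK' conK' Kg' KG'] XKB']; exists (K `|` K').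
      split; [exact: compactU|by apply: connectedU => //; exists g0|by left|].
      by move=> x [/KG|/KG'].
    by move=> x [Xx nx]; split; [apply: XKB|apply: XKB']; split=> // ?; apply: nx; [left|right].
  - by move=> B B' BB' [K KKK GB]; exists K => // x /GB /BB'.
have FX : F X by exists [set g0] => // x [].
have [x [Xx cx]] := cX F FF FX.
have /open_normP/(_ x (XG _ Xx))[d d0 dG] := oG.
have [K [cK conK Kg Kx KG]] := path_image (open_connected_path oG cG Gg (XG _ Xx)).
have d2 : 0 < d / 2 by rewrite divr_gt0.
have KB : KK (K `|` [set z | `|z - x| <= d / 2]).
  split.
  - by apply: compactU => //; exact: plane_cball_cpt.
  - apply: connectedU => //; last by apply: star_connected; apply: cball_star; exact: ltW.
    by exists x; split=> //=; rewrite subrr normr0 ltW.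
  - by left.
  - move=> z [/KG//|/= zx]; apply: dG; apply: le_lt_trans zx _.
    by rewrite ltr_pdivrMr// ltr_pMr// ltr1n.
have nb : nbhs x [set z | `|z - x| < d / 2].
  by apply/nbhs_norm_ballP; exists (d / 2).
have [z [[Xz nz] /= zx]] := cx (X `\` (K `|` [set z | `|z - x| <= d / 2])) _
  (ex_intro2 _ _ _ KB (fun _ => id)) nb.
by apply: nz; right; exact: ltW.
Qed.

End PlaneSets.

(** * Angle functions on plane sets and the winding obstruction *)

Section AngleOn.
Variable R : realType.
Local Notation plane := (R * R)%type.
Local Notation I01 := (`[0, 1]%classic : set R).
Implicit Types (A X O : set plane) (p q a : plane).

(** In complex terms, a continuous branch of the argument of [g / f] on [A]. *)
Definition angle_on A (f g : plane -> plane) :=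
  exists2 T : plane -> R, cont_on A T & forall z, A z -> rotto (T z) (f z) (g z).

(** On the connected overlap the two branches differ by a constant multiple of a full turn, which is
    absorbed into the second one. *)
Lemma angle_on_glue A B f g : closed A -> closed B -> connected (A `&` B) ->
  (forall z, A z -> f z != 0) -> angle_on A f g -> angle_on B f g -> angle_on (A `|` B) f g.
Proof.
move=> cA cB cAB f0 [T cT rT] [S cS rS].
have [c c1 cP] : exists2 c : R, cos c = 1 & forall z, A z -> B z -> T z = S z + c.
  have [[w [Aw Bw]]|AB0] := pselect (A `&` B !=set0); last first.
    by exists 0; [exact: cos0|move=> z Az Bz; exfalso; apply: AB0; exists z].
  have cTS z : (A `&` B) z -> cos (T z - S z) = 1.
    by move=> [Az Bz]; apply: (rotto_uniq (f0 _ Az)); [exact: rT|exact: rS].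
  exists (T w - S w); first exact: cTS.
  move=> z Az Bz; apply/eqP; rewrite addrC -subr_eq; apply/eqP.
  apply: (@cos1_const R _ (A `&` B) (fun z => T z - S z)) => //.
  by apply: cont_onB; [apply: cont_onS cT => ? []|apply: cont_onS cS => ? []].
pose U z := if z \in A then T z else S z + c.
exists U.
  apply: cont_on_glue => //.
    by apply: cont_on_eq cT => z Az; rewrite /U mem_set.
  apply: (cont_on_eq (f := fun z => S z + c)).
    by move=> z Bz; rewrite /U; case: ifPn => // /set_mem Az; rewrite cP.
  by apply: cont_onD => //; exact: cont_on_cst.
move=> z ABz; rewrite /U; case: ifPn => [/set_mem/rT//|nA].
apply: rotto_shift => //; apply: rS; case: ABz => // Az.
by rewrite mem_set in nA.
Qed.

(** Moving [q] a little inside [S] turns [z - q] by a principal angle, for all [z] in [X] at once.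
    These turns accumulate along the connected [S], starting from the zero angle at [p]. *)
Lemma angle_on_connected X (S : set plane) p q : compact X -> connected S ->
  X `&` S = set0 -> S p -> S q -> angle_on X (fun z => z - p) (fun z => z - q).
Proof.
move=> cX cS XS Sp Sq.
apply: (@connected_local R _ S (fun q => angle_on X (fun z => z - p) (fun z => z - q)) cS _ p q) => //.
  move=> x Sx.
  have [||r r0 rP] := @cpt_dist R _ X [set x] cX.
  - by apply: cpt_closed; exact: compact_set1.
  - by rewrite -subset0 -XS => z [Xz] /= zx; split=> //; rewrite zx.
  exists (r / 8); first by rewrite divr_gt0.
  move=> y z Sy Sz yx zx [T cT rT].
  have dt w : X w -> 0 < dot (w - y) (w - z).
    move=> Xw; apply: dot_close.
    have h1 := rP w x Xw erefl.
    have h2 : `|w - z - (w - y)| <= `|y - x| + `|z - x|.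
      have -> : w - z - (w - y) = (y - x) - (z - x).
        by rewrite !opprB addrC addrA subrK addrA subrK.
      exact: ler_normB.
    have h3 : `|w - x| <= `|w - y| + `|y - x|.
      have -> : w - x = (w - y) + (y - x) by rewrite addrA subrK.
      exact: ler_normD.
    move: h1 h2 h3 yx zx r0; clear.
    move: `|w - x| `|w - z - (w - y)| `|w - y| `|y - x| `|z - x| => a b c d e.
    lra.
  have cs v : cont_on X (fun w => w - v).
    by apply: cont_onB; [exact: cont_on_id|exact: cont_on_cst].
  exists (fun w => T w + arg (w - y) (w - z)).
    by apply: cont_onD => //; exact: cont_on_arg.
  move=> w Xw; apply: rotto_trans (rT w Xw) _; apply: rotto_arg; exact: dt.
exists (fun=> 0); first exact: cont_on_cst.
by move=> z _; exact: rotto0.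
Qed.

Lemma itv_star0 : star 0 I01.
Proof.
split; first by rewrite /= in_itv/= lexx ler01.
move=> x t /=; rewrite !in_itv/= add0r subr0 => /andP[x0 x1] /andP[t0 t1].
by rewrite mulr_ge0//= mulr_ile1.
Qed.

(** The argument of [g t - a] lifts as a function of the parameter, and injectivity makes it a
    function of the point. On a closed curve this transfer breaks down. *)
Lemma angle_on_arc (g : R -> plane) a : cont_on I01 g ->
  (forall s t, 0 <= s <= 1 -> 0 <= t <= 1 -> g s = g t -> s = t) ->
  (forall t, 0 <= t <= 1 -> g t != a) ->
  angle_on (g @` I01) (fun=> (1, 0)) (fun z => z - a).
Proof.
move=> cg ig ga.
have e0 : (1, 0) != 0 :> plane by apply/eqP => -[] /eqP; rewrite oner_eq0.
have [|z z01|T cT rT] := @lift_star R _ I01 (fun t => g t - a) (@segment_compact R 0 1) itv_star0.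
- by apply: cont_onB => //; exact: cont_on_cst.
- by rewrite subr_eq0; apply: ga; move: z01; rewrite /= in_itv.
have i0 : I01 0 by have [] := itv_star0.
have [t0 rt0] : exists t, rotto t (1, 0) (g 0 - a).
  by apply: rotto_ex => //; rewrite subr_eq0; apply: ga; rewrite lexx ler01.
have /choice[f fP] : forall z, exists t, (g @` I01) z -> I01 t /\ g t = z.
  move=> z; have [[t t01 gt]|nz] := pselect ((g @` I01) z); first by exists t.
  by exists 0.
have fg t : I01 t -> f (g t) = t.
  move=> t01; have [|h1 h2] := fP (g t); first by exists t.
  apply: ig; first by move: h1; rewrite /= in_itv.
    by move: t01; rewrite /= in_itv.
  by [].
exists (fun z => t0 + T (f z)).
  apply: cont_on_quotient => //; try exact: segment_compact.
  apply: (cont_on_eq (f := fun t => t0 + T t)); first by move=> t t01; rewrite fg.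
  by apply: cont_onD => //; exact: cont_on_cst.
move=> _ [t t01 <-]; rewrite fg//; apply: rotto_trans rt0 _; exact: rT.
Qed.

Definition rotv (t : R) p : plane := (cos t * p.1 - sin t * p.2, sin t * p.1 + cos t * p.2).
Definition unitv p : plane := (Num.sqrt (dot p p))^-1 *: p.

Lemma rottoE t p q : rotto t p q -> exists2 k, 0 < k & q = k *: rotv t p.
Proof. by move=> [k k0 ->]; exists k. Qed.

Lemma unitv_scale k p : 0 < k -> unitv (k *: p) = unitv p.
Proof.
move=> k0; rewrite /unitv.
have -> : dot (k *: p) (k *: p) = k ^+ 2 * dot p p.
  by rewrite /dot /= /GRing.scale /=; ring.
rewrite sqrtrM ?sqr_ge0// sqrtr_sqr gtr0_norm// scalerA invfM mulrAC mulVf ?mul1r//.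
exact: lt0r_neq0.
Qed.

Lemma dot_unitv p : p != 0 -> dot (unitv p) (unitv p) = 1.
Proof.
move=> /dot_gt0 d0; rewrite /unitv; set k := (_)^-1.
have -> : dot (k *: p) (k *: p) = k ^+ 2 * dot p p.
  by rewrite /dot /= /GRing.scale /=; ring.
by rewrite /k exprVn sqr_sqrtr ?mulVf ?gt_eqF// ltW.
Qed.

Lemma unitv_neq0 p : p != 0 -> unitv p != 0.
Proof.
move=> /dot_unitv; apply: contra_eqN => /eqP ->.
by rewrite /dot /= !mulr0 addr0 eq_sym oner_eq0.
Qed.

Lemma rotto_unitv p : p != 0 -> rotto 0 p (unitv p).
Proof.
move=> /dot_gt0 d0; exists (Num.sqrt (dot p p))^-1; first by rewrite invr_gt0 sqrtr_gt0.
by rewrite cos0 sin0 !mul0r !mul1r subr0 add0r.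
Qed.

Lemma rotv_neq0 t p : p != 0 -> rotv t p != 0.
Proof.
move=> p0; apply: (@rotto_neq0 R t p) => //; exists 1 => //.
by rewrite !mul1r.
Qed.

Lemma cont_on_unitv (V : normedModType R) (A : set V) (f : V -> plane) :
  cont_on A f -> (forall x, A x -> f x != 0) -> cont_on A (fun x => unitv (f x)).
Proof.
move=> cf f0; apply: cont_onZ => //; apply: cont_onV.
  apply: (@cont_on_compT R V R R A (fun x => dot (f x) (f x)) (@Num.sqrt R)); last exact: sqrt_continuous.
  exact: cont_on_dot.
by move=> x Ax; rewrite gt_eqF// sqrtr_gt0 dot_gt0// f0.
Qed.

Lemma cont_on_rotv (V : normedModType R) (A : set V) (t : V -> R) (f : V -> plane) :
  cont_on A t -> cont_on A f -> cont_on A (fun x => rotv (t x) (f x)).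
Proof.
move=> ct cf.
have cc : cont_on A (fun x => cos (t x)) by apply: cont_on_compT ct _; exact: continuous_cos.
have cs : cont_on A (fun x => sin (t x)) by apply: cont_on_compT ct _; exact: continuous_sin.
have c1 := cont_on_fst cf; have c2 := cont_on_snd cf.
by apply: cont_on_pair; [apply: cont_onB|apply: cont_onD]; apply: cont_onM.
Qed.

Lemma unit_norm_ge p : dot p p = 1 -> 1 / 2 <= `|p|.
Proof.
rewrite /dot prod_normE => h; rewrite leNgt; apply/negP; rewrite gt_max => /andP[].
by rewrite !ltr_norml => /andP[a b] /andP[c d]; nra.
Qed.

(* A map of the closed disc into the punctured plane that restricts to the
   standard circle on the boundary would have winding number both 0 and 1. *)
Lemma winding_obstruction O A a (k : plane -> plane) : open O -> O a -> compact A ->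
  (exists M : R, forall z, O z -> `|z| <= M) -> closure O `\` O `<=` A ->
  cont_on setT k -> (forall z, closure O z -> k z != 0) ->
  ~ angle_on A k (fun z => z - a).
Proof.
move=> oO Oa cA [M MP] OA ck k0 [T cT rT].
have [B B0 BP] := cpt_bounded (image_cpt cT cA).
have [] := @continuous_bounded_extension _ R (@pseudometric_normal R _) A (cpt_closed cA) T B B0.
- exact/cont_onP.
- by move=> x Ax; apply: BP; exists x.
move=> S [TS /cont_continuous cS _].
(* Inside [O] the vector [k] is turned by [S], the Tietze extension of the angle; outside, the field
   points away from [a]. Both agree on the frontier of [O], which lies in [A], so [F] is continuous
   and never vanishes. *)
pose F z := if z \in O then unitv (rotv (S z) (k z)) else unitv (z - a).
have za z : ~ O z -> z - a != 0.
  by move=> nO; rewrite subr_eq0; apply: contra_notN nO => /eqP ->.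
have cF : cont_on setT F.
  have -> : setT = closure O `|` ~` O.
    by apply/seteqP; split=> // z _; have [Oz|nO] := pselect (O z); [left; exact: subset_closure|right].
  apply: cont_on_glue; [exact: closed_closure|exact: open_closedC| |].
    apply: (cont_on_eq (f := fun z => unitv (rotv (S z) (k z)))).
      move=> z cOz; rewrite /F; case: ifPn => // nO.
      have Az : A z by apply: OA; split=> // Oz; rewrite mem_set in nO.
      have [l l0 ->] := rottoE (rT z Az); rewrite unitv_scale//.
      by rewrite TS// mem_set.
    apply: cont_on_unitv; last by move=> z cOz; apply: rotv_neq0; exact: k0.
    by apply: cont_on_rotv; [exact: cS|exact: cont_onS ck].
  apply: (cont_on_eq (f := fun z => unitv (z - a))).
    by move=> z nO; rewrite /F; case: ifPn => // /set_mem.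
  by apply: cont_on_unitv => //; apply: cont_onB; [exact: cont_on_id|exact: cont_on_cst].
have F0 z : F z != 0.
  rewrite /F; case: ifPn => [/set_mem Oz|nO].
    by apply: unitv_neq0; apply: rotv_neq0; apply: k0; exact: subset_closure.
  by apply: unitv_neq0; apply: za => Oz; rewrite mem_set in nO.
(* Euclidean unit vectors have sup norm at least [1 / 2], so this radius puts the whole circle
   around [a] outside [O]. *)
pose r : R := 2 * (M + `|a| + 1).
have r0 : 0 < r.
  have := MP a Oa; have := normr_ge0 a; rewrite /r; lra.
pose w (t : R) : plane := (r * cos (t * (pi *+ 2)), r * sin (t * (pi *+ 2))).
have w0 t : w t != 0.
  apply/eqP => wt; have rn := lt0r_neq0 r0.
  have c0 : cos (t * (pi *+ 2)) = 0 by apply: (mulfI rn); rewrite mulr0; exact: (congr1 fst wt).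
  have s0 : sin (t * (pi *+ 2)) = 0 by apply: (mulfI rn); rewrite mulr0; exact: (congr1 snd wt).
  by have := cos2Dsin2 (t * (pi *+ 2)); rewrite c0 s0 expr0n addr0 => /eqP; rewrite eq_sym oner_eq0.
have cw : cont_on setT w.
  have ct : cont_on setT (fun t : R => t * (pi *+ 2)).
    by apply: cont_onM; [exact: cont_on_id|exact: cont_on_cst].
  apply: cont_on_pair; (apply: cont_onM; first exact: cont_on_cst).
    by apply: cont_on_compT ct _; exact: continuous_cos.
  by apply: cont_on_compT ct _; exact: continuous_sin.
have nOw t : ~ O (a + w t).
  move=> Ow; have := MP _ Ow; have : r / 2 <= `|w t|.
    have -> : w t = r *: (cos (t * (pi *+ 2)), sin (t * (pi *+ 2))) by [].
    rewrite normrZ gtr0_norm// ler_pM2l//.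
    have := @unit_norm_ge (cos (t * (pi *+ 2)), sin (t * (pi *+ 2))).
    by rewrite /dot /= -!expr2 cos2Dsin2 mul1r; apply.
  have := ler_normB (a + w t) a; rewrite addrC addKr.
  move: r0; rewrite /r; move: `|w t| `|a + w t| `|a| => x y z; lra.
pose h (x : plane) := F (a + x.1 *: w x.2).
have ch : cont_on setT h.
  apply: (@cont_on_comp _ _ _ _ setT setT _ F) => //.
  apply: cont_onD; first exact: cont_on_cst.
  apply: cont_onZ; first by apply: cont_on_fst; exact: cont_on_id.
  apply: (@cont_on_comp _ _ _ _ setT setT _ w) => //.
  by apply: cont_on_snd; exact: cont_on_id.
pose X : set plane := I01 `*` I01.
have sX : star 0 X.
  have [I0 Is] := itv_star0.
  split; first by split.
  move=> x t [x1 x2] t01; split; [exact: Is x1 t01|exact: Is x2 t01].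
have [|z Xz|L cL rL] := @lift_star R _ X h (compact_setX (@segment_compact R 0 1) (@segment_compact R 0 1)) sX.
- exact: cont_onS ch.
- exact: F0.
have I0 : I01 0 by have [] := itv_star0.
have I1 : I01 1 by rewrite /= in_itv/= lexx ler01.
have conI : connected I01 by exact: segment_connected.
have w01 : w 0 = w 1 by rewrite /w mul0r mul1r cos0 sin0 cos2pi sin2pi.
have cLx s : I01 s -> cont_on I01 (fun t => L (s, t)).
  move=> Is; apply: cont_on_comp cL _ => [|t It]; last by split.
  by apply: cont_on_pair; [exact: cont_on_cst|exact: cont_on_id].
have cLy s : I01 s -> cont_on I01 (fun t => L (t, s)).
  move=> Is; apply: cont_on_comp cL _ => [|t It]; last by split.
  by apply: cont_on_pair; [exact: cont_on_id|exact: cont_on_cst].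
(* [L] lifts the angle of [F] in polar coordinates. Its increase over one revolution is independent
   of the radius, yet it is zero at radius parameter [0], where [h] is constant, and a full turn at
   [1]. *)
have E1 : L (0, 1) - L (0, 0) = L (1, 1) - L (1, 0).
  apply: (@cos1_const R _ I01 (fun s => L (s, 1) - L (s, 0))) => //.
    by apply: cont_onB; exact: cLy.
  move=> s Is; apply: (@rotto_uniq R _ _ (h 0) (h (s, 0))); [exact: F0| |exact: (rL (s, 0) (conj Is I0))].
  by have := rL (s, 1) (conj Is I1); rewrite /h /= -w01.
have E2 : L (0, 0) = L (0, 1).
  apply/eqP; rewrite -subr_eq0 -[X in _ == X](subrr (L (0, 1))); apply/eqP.
  apply: (@cos1_const R _ I01 (fun t => L (0, t) - L (0, 1))) => //.
    by apply: cont_onB; [exact: cLx|exact: cont_on_cst].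
  move=> t It; apply: (@rotto_uniq R _ _ (h 0) (h (0, t))); [exact: F0|exact: (rL (0, t) (conj I0 It))|].
  by have := rL (0, 1) (conj I0 I1); rewrite /h /= !scale0r.
have hE t : h (1, t) = unitv (w t).
  rewrite /h /F /= scale1r; case: ifPn => [/set_mem/nOw//|_].
  by rewrite addrC addKr.
have H t : I01 t -> cos (L (1, t) - (L (1, 0) + t * (pi *+ 2))) = 1.
  move=> It; apply: (@rotto_uniq R _ _ (h 0) (h (1, t))); [exact: F0|exact: (rL (1, t) (conj I1 It))|].
  apply: rotto_trans (rL (1, 0) (conj I1 I0)) _; rewrite !hE.
  rewrite -[t * _]addr0; apply: rotto_trans (rotto_unitv (w0 t)).
  rewrite -[t * _]add0r -[X in X + _]oppr0; apply: rotto_trans (rotto_sym (rotto_unitv (w0 0))) _.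
  exists 1 => //; rewrite /w mul0r cos0 sin0 !mulr0 !mulr1 !mul1r subr0 addr0.
  by congr (_, _); rewrite mulrC.
have : L (1, 0) - (L (1, 0) + 0 * (pi *+ 2)) = L (1, 1) - (L (1, 0) + 1 * (pi *+ 2)).
  apply: (@cos1_const R _ I01 (fun t => L (1, t) - (L (1, 0) + t * (pi *+ 2)))) => //.
  apply: cont_onB; first exact: cLx.
  apply: cont_onD; first exact: cont_on_cst.
  by apply: cont_onM; [exact: cont_on_id|exact: cont_on_cst].
move: E1; rewrite E2 subrr; have := @pi_gt0 R; rewrite mulr2n.
move: (pi : R) (L (1, 0)) (L (1, 1)); clear => x y z; lra.
Qed.

End AngleOn.

(** * Simple closed curves in the plane *)

Section JordanCurves.
Variable R : realType.
Local Notation plane := (R * R)%type.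
Local Notation I01 := (`[0, 1]%classic : set R).

Definition loop (V : normedModType R) (g : R -> V) := [/\ cont_on I01 g, g 0 = g 1 &
  forall s t, 0 <= s < 1 -> 0 <= t < 1 -> g s = g t -> s = t].

Lemma loop_inj (V : normedModType R) (g : R -> V) s t : loop g -> 0 < s < 1 -> 0 <= t <= 1 -> g s = g t -> s = t.
Proof.
move=> [cg g01 ig] /andP[s0 s1] /andP[t0 t1] gst.
have s01 : 0 <= s < 1 by rewrite ltW.
have [t1'|t1'] := ltP t 1; first by apply: ig => //; rewrite t0.
have E : t = 1 by apply/eqP; rewrite eq_le t1.
have : s = 0 by apply: ig => //; [rewrite lexx ltr01|rewrite gst E].
by move=> E0; rewrite E0 ltxx in s0.
Qed.

(** Local statements about curves are proved at the base point [g 0]; a cyclic shift of the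
    parameter brings any point there. *)
Lemma loop_rebase (V : normedModType R) (g : R -> V) x : loop g -> (g @` I01) x ->
  exists h, [/\ loop h, h 0 = x & h @` I01 = g @` I01].
Proof.
move=> Lg Jx.
have [t0 /andP[t00 t01] gx] : exists2 t0, 0 <= t0 < 1 & g t0 = x.
  have [cg g01 ig] := Lg; have [t + gx] := Jx; rewrite /= in_itv /= => /andP[t0 t1].
  have [t1'|t1'] := ltP t 1; first by exists t => //; rewrite t0.
  exists 0; first by rewrite lexx ltr01.
  by rewrite g01 -gx; congr g; apply/eqP; rewrite eq_le t1 t1'.
have [cg g01 ig] := Lg.
pose h t := if t + t0 < 1 then g (t + t0) else g (t + t0 - 1).
have hE t : 1 <= t + t0 -> h t = g (t + t0 - 1) by rewrite /h ltNge => ->.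
have hE' t : t + t0 <= 1 -> h t = g (t + t0).
  rewrite /h; case: ltP => // tt tt'.
  have -> : t + t0 = 1 by apply/eqP; rewrite eq_le tt tt'.
  by rewrite subrr.
have h0 : h 0 = x by rewrite hE' add0r// ltW.
have h1 : h 1 = x by rewrite hE; [rewrite addrAC subrr add0r|rewrite lerDl].
exists h; split=> //.
- split; [|by rewrite h0 h1|].
  + have -> : I01 = `[0, 1 - t0] `|` `[1 - t0, 1].
      clear -t00 t01; apply/seteqP; split=> t; rewrite /= !in_itv/=.
        by move=> /andP[a b]; have [tt|/ltW tt] := leP t (1 - t0); [left|right]; apply/andP.
      by move=> [|] /andP[a b]; apply/andP; split; lra.
    apply: cont_on_glue; [exact: interval_closed|exact: interval_closed| |].
      apply: (cont_on_eq (f := fun t => g (t + t0))).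
        by move=> t; rewrite /= in_itv/= => /andP[a b]; rewrite hE'// -lerBrDr.
      apply: (@cont_on_comp _ _ _ _ _ I01 _ g) => //.
        by apply: cont_onD; [exact: cont_on_id|exact: cont_on_cst].
      by clear -t00 t01; move=> t; rewrite /= !in_itv/= => /andP[a b]; apply/andP; split; lra.
    apply: (cont_on_eq (f := fun t => g (t + t0 - 1))).
      by move=> t; rewrite /= in_itv/= => /andP[a b]; rewrite hE// -lerBlDr.
    apply: (@cont_on_comp _ _ _ _ _ I01 _ g) => //.
      apply: cont_onD; last exact: cont_on_cst.
      by apply: cont_onD; [exact: cont_on_id|exact: cont_on_cst].
    by clear -t00 t01; move=> t; rewrite /= !in_itv/= => /andP[a b]; apply/andP; split; lra.
  + move=> s t s01 u01; rewrite /h.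
    have A u : 0 <= u < 1 -> u + t0 < 1 -> 0 <= u + t0 < 1.
      by clear -t00 t01; move=> /andP[a b] c; apply/andP; split; lra.
    have B u : 0 <= u < 1 -> 1 <= u + t0 -> 0 <= u + t0 - 1 < 1.
      by clear -t00 t01; move=> /andP[a b] c; apply/andP; split; lra.
    case: ltP => a; case: ltP => b /ig E.
    * by have := E (A _ s01 a) (A _ u01 b); exact: addIr.
    * have := E (A _ s01 a) (B _ u01 b); move: s01 u01; clear.
      by move=> /andP[a b] /andP[c d] e; exfalso; lra.
    * have := E (B _ s01 a) (A _ u01 b); move: s01 u01; clear.
      by move=> /andP[a b] /andP[c d] e; exfalso; lra.
    * by have := E (B _ s01 a) (B _ u01 b) => /addIr /addIr.
- apply/seteqP; split=> [_ [t + <-]|_ [t + <-]]; rewrite /= in_itv/= => /andP[a b].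
    have [tt|/ltW tt] := leP (t + t0) 1.
      by exists (t + t0); rewrite ?hE'//= in_itv/= tt addr_ge0.
    exists (t + t0 - 1); rewrite ?hE//= in_itv/= subr_ge0 tt/=.
    by move: a b t00 t01; clear; lra.
  have [tt|tt] := leP t0 t.
    exists (t - t0); last by rewrite hE' subrK.
    rewrite /= in_itv/= subr_ge0 tt/=.
    by move: a b t00 t01; clear; lra.
  exists (t - t0 + 1).
    by rewrite /= in_itv/=; move: a b t00 t01 tt; clear => *; apply/andP; split; lra.
  rewrite hE; first by congr g; clear; lra.
  by move: a b t00 t01 tt; clear; lra.
Qed.

Lemma loop_ends (V : normedModType R) (g : R -> V) (e : R) : loop g -> 0 < e -> exists2 n : R, 0 < n < 1 / 2 &
  forall t, 0 <= t <= 1 -> (t < n \/ 1 - n < t) -> `|g t - g 0| < e.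
Proof.
move=> [cg g01 _] e0.
have [|d d0 dP] := cg 0 _ e e0; first by rewrite /= in_itv/= lexx ler01.
have [|d' d'0 dP'] := cg 1 _ e e0; first by rewrite /= in_itv/= lexx ler01.
pose n := Num.min (Num.min d d') (1 / 4).
have nd : n <= d by rewrite /n !ge_min lexx.
have nd' : n <= d' by rewrite /n !ge_min lexx orbT.
have n4 : n <= 1 / 4 by rewrite /n !ge_min lexx !orbT.
have n0 : 0 < n by rewrite /n !lt_min d0 d'0/=; lra.
exists n; first by rewrite n0/=; lra.
move=> t /andP[a b] [tn|tn].
  apply: dP; first by rewrite /= in_itv/= a.
  by rewrite subr0 ger0_norm//; lra.
rewrite g01; apply: dP'; first by rewrite /= in_itv/= a.
by rewrite ler0_norm//; lra.
Qed.

End JordanCurves.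

(** * Jordan separation and local connectivity of the sides of a curve *)

Section JordanPlane.
Variable R : realType.
Local Notation plane := (R * R)%type.
Local Notation I01 := (`[0, 1]%classic : set R).
Implicit Types (g : R -> plane).

Lemma itv_sub01 (a b : R) : 0 <= a -> b <= 1 -> (`[a, b] : set R) `<=` I01.
Proof.
move=> a0 b1 t; rewrite /= !in_itv/= => /andP[at_ tb].
by rewrite (le_trans a0 at_) (le_trans tb b1).
Qed.

Lemma loop_arc_cpt (V : normedModType R) (g : R -> V) (a b : R) : loop g -> 0 <= a -> b <= 1 -> compact (g @` `[a, b]).
Proof.
move=> [cg _ _] a0 b1; apply: image_cpt; last exact: segment_compact.
by apply: cont_onS cg; exact: itv_sub01.
Qed.

Lemma loop_arc_conn (V : normedModType R) (g : R -> V) (a b : R) : loop g -> 0 <= a -> b <= 1 -> connected (g @` `[a, b]).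
Proof.
move=> [cg _ _] a0 b1; apply: image_conn; last exact: segment_connected.
by apply: cont_onS cg; exact: itv_sub01.
Qed.

(** The bound [0 < a] keeps the coincidence [g 0 = g 1] from spoiling injectivity on the arc. *)
Lemma loop_arc_angle g (a b : R) p : loop g -> 0 < a -> a < b -> b <= 1 ->
  ~ (g @` `[a, b]) p -> angle_on (g @` `[a, b]) (fun=> (1, 0)) (fun z => z - p).
Proof.
move=> Lg a0 ab b1 np.
have ba : 0 < b - a by rewrite subr_gt0.
pose s t := a + t * (b - a).
have sI t : 0 <= t <= 1 -> a <= s t <= b.
  move=> /andP[t0 t1]; rewrite /s lerDl mulr_ge0// ?(ltW ba)//= -lerBrDl.
  by rewrite ler_piMl// ltW.
have -> : g @` `[a, b] = (g \o s) @` I01.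
  apply/seteqP; split=> [_ [t + <-]|_ [t + <-]]; rewrite /= in_itv/=.
    move=> /andP[at_ tb]; exists ((t - a) / (b - a)).
      rewrite /= in_itv/=; apply/andP; split; first by apply: divr_ge0; [rewrite subr_ge0|exact: ltW].
      by rewrite ler_pdivrMr// mul1r lerD2r.
    by rewrite /= /s divfK ?gt_eqF// addrC subrK.
  by move=> /sI; exists (s t) => //; rewrite /= in_itv.
have [cg g01 ig] := Lg.
apply: angle_on_arc.
- apply: (@cont_on_comp _ _ _ _ _ I01 s g) => //.
    apply: cont_onD; first exact: cont_on_cst.
    by apply: cont_onM; [exact: cont_on_id|exact: cont_on_cst].
  move=> t; rewrite /= !in_itv/= => /sI/andP[h1 h2].
  by rewrite (le_trans (ltW a0) h1) (le_trans h2 b1).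
- have E u v : 0 <= u <= 1 -> 0 <= v <= 1 -> u < v -> g (s u) <> g (s v).
    move=> u01 v01 uv; have suv : s u < s v by rewrite /s ltrD2l ltr_pM2r.
    have /andP[u1 u2] := sI _ u01; have /andP[v1 v2] := sI _ v01.
    move=> /(loop_inj Lg) h; suff : s u = s v by move=> h'; rewrite h' ltxx in suv.
    apply: h; apply/andP; split.
    + exact: lt_le_trans a0 u1.
    + exact: lt_le_trans suv (le_trans v2 b1).
    + exact: le_trans (ltW a0) v1.
    + exact: le_trans v2 b1.
  move=> u v u01 v01 guv; have [h|h|//] := ltgtP u v.
    by have := E _ _ u01 v01 h.
  by exfalso; exact: (E _ _ v01 u01 h (esym guv)).
- move=> t /sI t01; apply/eqP => gp; apply: np; exists (s t) => //; rewrite /= in_itv.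
Qed.

Lemma closed_far (V : normedModType R) (S : set V) (r : R) : closed [set z | forall a, S a -> r <= `|z - a|].
Proof.
apply/closed_normP => z hz a Sa; rewrite leNgt; apply/negP => za.
have [|y yS yz] := hz (r - `|z - a|); first by rewrite subr_gt0.
have := yS a Sa; have := ler_normD (y - z) (z - a); rewrite addrA subrK => h1 h2.
move: h1 h2 yz; move: `|y - a| `|y - z| `|z - a| => u v w; clear; lra.
Qed.

Lemma closed_sphere (V : normedModType R) (c : V) (r : R) : closed [set z | `|z - c| = r].
Proof.
have -> : [set z | `|z - c| = r] = [set z | `|z - c| <= r] `&` [set z | forall a, [set c] a -> r <= `|z - a|].
  apply/seteqP; split=> z /=; first by move=> <-; split=> // a ->.
  by move=> [h1 h2]; apply/eqP; rewrite eq_le h1 h2.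
by apply: closedI; [exact: closed_cball|exact: closed_far].
Qed.

Lemma plane_sphere_cpt (c : plane) (r : R) : compact [set z | `|z - c| = r].
Proof.
by apply: (sub_cpt (@closed_sphere _ c r) (@plane_cball_cpt R c r)) => z /= ->.
Qed.

Lemma closure_ball_sub (V : normedModType R) (c : V) (r : R) : closure [set z | `|z - c| < r] `<=` [set z | `|z - c| <= r].
Proof.
move=> z; rewrite closureE => /(_ [set z | `|z - c| <= r]); apply; split; first exact: closed_cball.
by move=> y /= /ltW.
Qed.

(* If the complement of [J] were connected, the angle functions of
   [(z - c) / (z - d)] obtained on the two sides of a small circle around [c]
   (off the first and off the second arc of [J] from [c] to [d]) would glue. *)
Lemma loop_separates g : loop g -> ~ connected (~` (g @` I01)).
Proof.
move=> Lg cG.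
have h2 : 0 < (1 / 2 : R) < 1 by apply/andP; split; lra.
have [h20 h21] := andP h2.
pose A := g @` `[0, 1 / 2]; pose B := g @` `[1 / 2, 1].
pose J := g @` I01.
have cA : compact A by apply: loop_arc_cpt => //; exact: ltW.
have cB : compact B by apply: loop_arc_cpt => //; exact: ltW.
have conA : connected A by apply: loop_arc_conn => //; exact: ltW.
have conB : connected B by apply: loop_arc_conn => //; exact: ltW.
have cJ : compact J by exact: loop_arc_cpt.
have [cg g01 ig] := Lg.
pose c := g 0; pose d := g (1 / 2).
have Ac : A c by exists 0 => //; rewrite /= in_itv/= lexx ltW.
have Ad : A d by exists (1 / 2) => //; rewrite /= in_itv/= lexx ltW.
have Bd : B d by exists (1 / 2) => //; rewrite /= in_itv/= lexx ltW.
have Bc : B c by exists 1; rewrite /c ?g01//= in_itv/= lexx ltW.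
have cd : d - c != 0.
  rewrite subr_eq0; apply/eqP => /(loop_inj Lg h2); rewrite lexx ler01 => /(_ erefl) E.
  by rewrite E ltxx in h20.
have AB z : A z -> B z -> z = c \/ z = d.
  move=> [s + <-] [t + gts]; rewrite /= !in_itv/= => /andP[s0 s2] /andP[t2 t1].
  have [s0'|s0'] := ltP 0 s; last by left; congr g; apply/eqP; rewrite eq_le s0 s0'.
  right; have : s = t.
    apply: (loop_inj Lg) => //.
      by rewrite s0' (le_lt_trans s2 h21).
    by rewrite t1 (le_trans (ltW h20) t2).
  by move=> st; congr g; apply/eqP; rewrite eq_le s2 {1}st t2.
have JAB : J = A `|` B.
  apply/seteqP; split=> [_ [t + <-]|_ [|] [t + <-]]; rewrite /= !in_itv/= => /andP[a b].
  - have [t2|/ltW t2] := leP t (1 / 2); [left|right]; exists t => //; rewrite /= in_itv/=; exact/andP.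
  - by exists t => //; rewrite /= in_itv/= a (le_trans b (ltW h21)).
  - by exists t => //; rewrite /= in_itv/= b (le_trans (ltW h20) a).
pose r := `|d - c| / 2.
have dc0 : 0 < `|d - c| by rewrite normr_gt0.
have r0 : 0 < r by rewrite divr_gt0.
have rd : r < `|d - c| by rewrite /r ltr_pdivrMr// ltr_pMr// ltr1n.
pose S : set plane := [set z | `|z - c| = r].
have cS : compact S by exact: plane_sphere_cpt.
have nSc : ~ S c by rewrite /S /= subrr normr0 => rr; rewrite -rr ltxx in r0.
have nSd : ~ S d by rewrite /S /= => rr; rewrite rr ltxx in rd.
pose SA := S `&` A; pose SB := S `&` B.
have [e e0 eP] : exists2 e : R, 0 < e & forall a b, SA a -> SB b -> e <= `|a - b|.
  apply: cpt_dist.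
  - by apply: (sub_cpt _ cA) => [|z []//]; apply: closedI; exact: cpt_closed.
  - by apply: closedI; exact: cpt_closed.
  - rewrite -subset0 => z [[Sz Az] [_ Bz]].
    by have [zc|zd] := AB z Az Bz; [apply: nSc; rewrite -zc|apply: nSd; rewrite -zd].
(* Points of the circle at distance at least [e / 2] from each arc's trace on it. The traces are [e]
   apart, so no point is closer than [e / 2] to both, and the two sets cover the circle. *)
pose XA := S `&` [set z | forall a, SA a -> e / 2 <= `|z - a|].
pose XB := S `&` [set z | forall a, SB a -> e / 2 <= `|z - a|].
have e2 : 0 < e / 2 by rewrite divr_gt0.
have cXA : compact XA by apply: (sub_cpt _ cS) => [|z []//]; apply: closedI; [exact: cpt_closed|exact: closed_far].
have cXB : compact XB by apply: (sub_cpt _ cS) => [|z []//]; apply: closedI; [exact: cpt_closed|exact: closed_far].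
have XAA z : XA z -> ~ A z.
  by move=> [Sz h] Az; have := h z (conj Sz Az); rewrite subrr normr0 leNgt e2.
have XBB z : XB z -> ~ B z.
  by move=> [Sz h] Bz; have := h z (conj Sz Bz); rewrite subrr normr0 leNgt e2.
have SX : S `<=` XA `|` XB.
  move=> z Sz; apply: contrapT => nX.
  have [a Sa za] : exists2 a, SA a & `|z - a| < e / 2.
    apply: contrapT => H; apply: nX; left; split=> // a Sa; rewrite leNgt.
    by apply/negP => za; apply: H; exists a.
  have [b Sb zb] : exists2 b, SB b & `|z - b| < e / 2.
    apply: contrapT => H; apply: nX; right; split=> // b Sb; rewrite leNgt.
    by apply/negP => zb; apply: H; exists b.
  have := eP _ _ Sa Sb; have := ler_normB (z - b) (z - a).
  rewrite opprB [z - b + _]addrC addrA subrK; move: za zb; clear; lra.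
have oG : open (~` J) by apply: closed_openC; exact: cpt_closed.
have [v0 Gv0] : exists v0, (~` J) v0.
  have [M M0 MP] := cpt_bounded cJ; exists (M + 1, 0) => /MP.
  rewrite prod_normE /= normr0 ge_max => /andP[+ _].
  have M1 : 0 < M + 1 by rewrite addr_gt0.
  by rewrite gtr0_norm// leNgt ltrDl ltr01.
(* The assumed connectedness of the complement enters here: [K] absorbs the overlap of [XA] and
   [XB], so that after adding [K] to both their intersection is the connected set [K]. *)
have [|K [cK conK XK KG]] := cpt_conn_hull oG cG Gv0 (sub_cpt (closedI (cpt_closed cXA) (cpt_closed cXB)) cXA (@subIsetl _ _ _)).
  by rewrite JAB => z [/XAA nA /XBB nB] [].
have KA z : K z -> ~ A z by move=> /KG + Az; apply; rewrite -/J JAB; left.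
have KB z : K z -> ~ B z by move=> /KG + Bz; apply; rewrite -/J JAB; right.
have aA : angle_on (XA `|` K) (fun z => z - d) (fun z => z - c).
  apply: (angle_on_connected (compactU cXA cK) conA _ Ad Ac).
  by rewrite -subset0 => z [[/XAA|/KA]].
have aB : angle_on (XB `|` K) (fun z => z - d) (fun z => z - c).
  apply: (angle_on_connected (compactU cXB cK) conB _ Bd Bc).
  by rewrite -subset0 => z [[/XBB|/KB]].
have cAK : compact (XA `|` K) by exact: compactU.
have cBK : compact (XB `|` K) by exact: compactU.
have aAB : angle_on ((XA `|` K) `|` (XB `|` K)) (fun z => z - d) (fun z => z - c).
  apply: angle_on_glue => //; try exact: cpt_closed.
    by rewrite -setUIl; have -> : (XA `&` XB) `|` K = K by apply/seteqP; split=> z; [case=> // /XK|right].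
  move=> z zA; rewrite subr_eq0; apply/eqP => zd.
  by case: zA => [/XAA|/KA]; rewrite zd; apply.
apply: (@winding_obstruction R [set z | `|z - c| < r] ((XA `|` K) `|` (XB `|` K)) c (fun z => z - d)) => //.
- exact: open_ball.
- by rewrite /= subrr normr0.
- exact: compactU.
- exists (r + `|c|) => z /= zc; have := ler_normD (z - c) c; rewrite subrK; move: zc; clear; lra.
- move=> z [/closure_ball_sub /= h1 h3].
  have : S z by apply/eqP; rewrite eq_le h1 leNgt; apply/negP.
  by move=> /SX[|] h; [left; left|right; left].
- by apply: cont_onB; [exact: cont_on_id|exact: cont_on_cst].
- move=> z /closure_ball_sub /= h; rewrite subr_eq0; apply/eqP => zd.
  by rewrite zd leNgt rd in h.
Qed.

Lemma plane_far_connected (M : R) : 0 < M -> connected [set z : plane | M < `|z|].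
Proof.
move=> M0.
have cs c (X : set plane) : X c -> (forall x t, X x -> 0 <= t <= 1 -> X (c + t *: (x - c))) -> connected X.
  by move=> Xc h; apply: (@star_connected R _ c); split.
have cv (a b t : R) : M < a -> M < b -> 0 <= t <= 1 -> M < a + t * (b - a).
  move=> Ma Mb /andP[t0 t1]; have [ab|/ltW ba] := leP a b.
    by apply: lt_le_trans Ma _; rewrite lerDl mulr_ge0// subr_ge0.
  have -> : a + t * (b - a) = b + (1 - t) * (a - b) by ring.
  by apply: lt_le_trans Mb _; rewrite lerDl mulr_ge0// subr_ge0.
have cv' (a b t : R) : a < - M -> b < - M -> 0 <= t <= 1 -> a + t * (b - a) < - M.
  move=> aM bM t01; have -> : a + t * (b - a) = - (- a + t * (- b - - a)) by ring.
  by rewrite ltrN2; apply: cv => //; rewrite ltrNr.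
have M1 : M < M + 1 by rewrite ltrDl ltr01.
have M1' : - (M + 1) < - M by rewrite ltrN2.
have c1 : connected [set z : plane | M < z.1] by apply: (cs (M + 1, 0)) => // x t /= hx; exact: cv.
have c2 : connected [set z : plane | M < z.2] by apply: (cs (0, M + 1)) => // x t /= hx; exact: cv.
have c3 : connected [set z : plane | z.1 < - M] by apply: (cs (- (M + 1), 0)) => // x t /= hx; exact: cv'.
have c4 : connected [set z : plane | z.2 < - M] by apply: (cs (0, - (M + 1))) => // x t /= hx; exact: cv'.
have -> : [set z : plane | M < `|z|] = ((([set z : plane | M < z.1] `|` [set z : plane | M < z.2])
   `|` [set z : plane | z.1 < - M]) `|` [set z : plane | z.2 < - M]).
  apply/seteqP; split=> z /=; rewrite prod_normE lt_max !ltr_normr !(ltrNr M).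
    by move=> /orP[/orP[]|/orP[]]; tauto.
  by move=> [[[->|->]|->]|->]; rewrite ?orbT.
apply: connectedU => //; first by exists (M + 1, - (M + 1)); split=> //; left; left.
apply: connectedU => //; first by exists (- (M + 1), M + 1); split=> //; right.
by apply: connectedU => //; exists (M + 1, M + 1).
Qed.

(** Some component of the disconnected complement avoids the connected far region. If its frontier
    missed a point of the curve, it would lie in a proper arc, on which [z - v] has a continuous
    argument; the winding obstruction with a constant field forbids this. *)
Lemma jordan_inside g : loop g -> exists V, [/\ open V, connected V,
  exists M : R, forall z, V z -> `|z| <= M, V !=set0 &
  V `&` (g @` I01) = set0 /\ closure V = V `|` g @` I01].
Proof.
move=> Lg; set J := g @` I01.
have cJ : compact J by exact: loop_arc_cpt.
have oG : open (~` J) by apply: closed_openC; exact: cpt_closed.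
have [M M0 MP] := cpt_bounded cJ.
pose far := [set z : plane | M < `|z|].
have farG : far `<=` ~` J by move=> z /= zM /MP; rewrite leNgt zM.
have [v Gv nv] : exists2 v, (~` J) v & connected_component (~` J) v `&` far = set0.
  apply: contrapT => H; apply: (loop_separates Lg); rewrite -/J.
  have Mw : far (M + 1, 0).
    rewrite /far /= prod_normE lt_max /= gtr0_norm ?ltrDl ?ltr01// addr_gt0//.
  have -> : ~` J = connected_component (~` J) (M + 1, 0); last exact: component_connected.
  apply/seteqP; split; last exact: connected_component_sub.
  move=> v Gv; have /set0P[y [Cy fy]] : connected_component (~` J) v `&` far != set0.
    by apply/eqP => nv; apply: H; exists v.
  apply: connected_component_sym; apply: connected_component_trans Cy _.
  by exists far => //; split=> //; exact: plane_far_connected.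
pose V := connected_component (~` J) v.
have Vv : V v by exact: connected_component_refl.
have oV : open V by exact: component_open.
have VJ z : V z -> ~ J z by move=> /connected_component_sub.
have VM z : V z -> `|z| <= M.
  by move=> Vz; rewrite leNgt; apply/negP => zM; have : (V `&` far) z by []; rewrite nv.
have bV z : closure V z -> ~ V z -> J z.
  by move=> cV nV; apply: contrapT => nJ; apply: nV; exact: (closure_component oG).
exists V; split=> //.
- exact: component_connected.
- by exists M.
- by exists v.
split; first by rewrite -subset0 => z [/VJ].
apply/seteqP; split=> z.
  by move=> cV; have [Vz|nV] := pselect (V z); [left|right; exact: bV].
move=> [Vz|Jz]; first exact: subset_closure.
apply: contrapT => ncV.
have /open_normP/(_ z ncV)[e e0 eP] : open (~` closure V) by apply: closed_openC; exact: closed_closure.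
have [h [Lh h0 hJ]] := loop_rebase Lg Jz.
have [n /andP[n0 n2] nP] := loop_ends Lh e0.
have n1 : n < 1 - n by move: n2; clear; lra.
have n1' : 1 - n <= 1 by rewrite gerBl ltW.
apply: (@winding_obstruction R V (h @` `[n, 1 - n]) v (fun=> (1, 0)) oV Vv).
- by apply: loop_arc_cpt => //; exact: ltW.
- by exists M.
- move=> y [cVy nVy]; have : J y by exact: bV.
  rewrite /J -hJ => -[t + hy]; rewrite /= in_itv/= => t01; exists t => //; rewrite /= in_itv/= !leNgt.
  apply/andP; split; apply/negP => tn; apply: (eP y) cVy; rewrite -hy -h0; apply: nP => //; [left|right] => //.
- exact: cont_on_cst.
- by move=> y _; apply/eqP => -[] /eqP; rewrite oner_eq0.
apply: loop_arc_angle => // -[t + hv]; rewrite /= in_itv/= => /andP[a b].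
apply: (VJ v Vv); rewrite /J -hJ; exists t => //; rewrite /= in_itv/=.
by rewrite (le_trans (ltW n0) a) (le_trans b n1').
Qed.

(** Suppose the component [O] of [p] in the small disc minus the curve misses [q]. An angle from
    [z - q] to [z - p] exists on the curve, as [U] joins the two points, and on the circle with the
    distant arc [b], as a small disc joins them. These sets overlap in the connected [b], so the
    angles glue over the frontier of [O], against the winding obstruction. *)
Lemma loop_side_ulc g (U : set plane) (r : R) : loop g -> connected U -> U `&` (g @` I01) = set0 ->
  0 < r -> exists2 d : R, 0 < d & forall p q, U p -> U q -> `|p - g 0| < d -> `|q - g 0| < d ->
  exists D, [/\ connected D, D p, D q, forall z, D z -> `|z - g 0| < r & D `&` (g @` I01) = set0].
Proof.
move=> Lg cU UJ r0; set J := g @` I01; set x := g 0.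
have cJ : compact J by exact: loop_arc_cpt.
have [n /andP[n0 n2] nP] := loop_ends Lg r0.
have n1 : n < 1 - n by move: n2; clear; lra.
have n1' : 1 - n <= 1 by rewrite gerBl ltW.
have n1'' : 1 - n < 1 by rewrite gtrBl.
pose b := g @` `[n, 1 - n].
have cb : compact b by apply: loop_arc_cpt => //; exact: ltW.
have bJ : b `<=` J.
  move=> _ [t + <-]; rewrite /= in_itv/= => /andP[t1 t2]; exists t => //; rewrite /= in_itv/=.
  by rewrite (le_trans (ltW n0) t1) (le_trans t2 n1').
have [e e0 eP] : exists2 e : R, 0 < e & forall a c, b a -> [set x] c -> e <= `|a - c|.
  apply: cpt_dist => //; first by apply: cpt_closed; exact: compact_set1.
  rewrite -subset0 => z [[t + <-]]; rewrite /= in_itv/= => /andP[t1 t2] gtx.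
  have /(loop_inj Lg) E := gtx; have t0 : t = 0.
    apply: E; last by rewrite lexx ler01.
    by rewrite (lt_le_trans n0 t1) (le_lt_trans t2 n1'').
  by rewrite t0 leNgt n0 in t1.
exists (Num.min e r); first by rewrite lt_min e0.
move=> p q Up Uq; rewrite !lt_min => /andP[pe pr] /andP[qe qr].
pose G := [set z | `|z - x| < r] `&` ~` J.
have oG : open G by apply: openI; [exact: open_ball|apply: closed_openC; exact: cpt_closed].
have UnJ z : U z -> ~ J z by move=> Uz Jz; have : (U `&` J) z by []; rewrite UJ.
have Gp : G p by split=> //; exact: UnJ.
have Gq : G q by split=> //; exact: UnJ.
pose O := connected_component G p.
have [Oq|nOq] := pselect (O q).
  exists O; split=> //.
  - exact: component_connected.
  - exact: connected_component_refl.
  - by move=> z /connected_component_sub[].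
  - by rewrite -subset0 => z [/connected_component_sub[]].
exfalso.
pose S : set plane := [set z | `|z - x| = r].
have cS : compact S by exact: plane_sphere_cpt.
have aJ : angle_on J (fun z => z - q) (fun z => z - p).
  by apply: (angle_on_connected cJ cU) => //; rewrite setIC.
have aZ : angle_on (S `|` b) (fun z => z - q) (fun z => z - p).
  apply: (@angle_on_connected R _ [set z | `|z - x| < Num.min e r] _ _ (compactU cS cb)).
  - by apply: star_connected; apply: ball_star; rewrite lt_min e0.
  - rewrite -subset0 => z [[Sz|bz]] /=; rewrite lt_min => /andP[ze zr].
      by rewrite Sz ltxx in zr.
    by have := eP z x bz erefl; rewrite leNgt ze.
  - by rewrite /= lt_min qe.
  - by rewrite /= lt_min pe.
(* The two ends of the curve stay strictly inside the circle, so the circle can meet the curve only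
   along [b]. *)
have JZ : J `&` (S `|` b) = b.
  apply/seteqP; split=> z; last by move=> bz; split; [exact: bJ|right].
  move=> [[t + gtz] [Sz|//]]; rewrite /= in_itv/= => t01; exists t => //; rewrite /= in_itv/= !leNgt.
  apply/andP; split; apply/negP => tn.
    by have := nP t t01 (or_introl tn); rewrite gtz Sz ltxx.
  by have := nP t t01 (or_intror tn); rewrite gtz Sz ltxx.
apply: (@winding_obstruction R O (J `|` (S `|` b)) p (fun z => z - q)).
- exact: component_open.
- exact: connected_component_refl.
- by apply: compactU => //; exact: compactU.
- exists (r + `|x|) => z /connected_component_sub[/= zx _].
  by have := ler_normD (z - x) x; rewrite subrK; move: zx; clear; lra.
- move=> z [cOz nOz].
  have [Jz|nJ] := pselect (J z); [by left|right; left].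
  have h1 : `|z - x| <= r.
    apply: (@closure_ball_sub _ x r); apply: closureS cOz => y /connected_component_sub[] //.
  apply/eqP; rewrite eq_le h1 leNgt; apply/negP => zx; apply: nOz.
  by apply: (closure_component oG).
- by apply: cont_onB; [exact: cont_on_id|exact: cont_on_cst].
- move=> z cOz; rewrite subr_eq0; apply/eqP => zq; apply: nOq.
  by rewrite zq in cOz; apply: (closure_component oG).
apply: angle_on_glue => //.
- exact: cpt_closed.
- by apply: closedU; exact: cpt_closed.
- by rewrite JZ; apply: loop_arc_conn => //; exact: ltW.
- move=> z Jz; rewrite subr_eq0; apply/eqP => zq; exact: (UnJ q Uq (eq_ind _ J Jz _ zq)).
Qed.

End JordanPlane.

(** * Non-planarity of the complete bipartite graph K_{3,3} *)

Section K33Paths.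
Variable R : realType.
Local Notation plane := (R * R)%type.
Local Notation I01 := (`[0, 1]%classic : set R).
Local Notation e1 := ((1, 0) : plane).

Lemma cos1D (x y : R) : cos x = 1 -> cos y = 1 -> cos (x + y) = 1.
Proof. by move=> cx cy; rewrite cosD cx cy (cos1_sin0 cx) mul0r subr0 mulr1. Qed.

Lemma cos1B (x y : R) : cos x = 1 -> cos y = 1 -> cos (x - y) = 1.
Proof. by move=> cx cy; apply: cos1D => //; rewrite cosN. Qed.

(** Neither the reference vector nor a fixed rotation [c] affects the total change: the discrepancy
    between the lifts is a multiple of a full turn at each parameter, hence constant. *)
Lemma angle_change_uniq (f f' : R -> plane) (u u' : plane) (T T' : R -> R) c :
  u != 0 -> u' != 0 ->
  cont_on I01 T -> cont_on I01 T' ->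
  (forall t, I01 t -> rotto (T t) u (f t)) -> (forall t, I01 t -> rotto (T' t) u' (f' t)) ->
  (forall t, rotto c (f t) (f' t)) -> T 1 - T 0 = T' 1 - T' 0.
Proof.
move=> u0 u'0 cT cT' rT rT' rc.
have [d rd] := rotto_ex u0 u'0.
have E t : I01 t -> cos (T t + c - (d + T' t)) = 1.
  move=> It; apply: (rotto_uniq u0 (rotto_trans (rT t It) (rc t))).
  exact: (rotto_trans rd (rT' t It)).
have I0 : I01 0 by rewrite /= in_itv/= lexx ler01.
have I1 : I01 1 by rewrite /= in_itv/= lexx ler01.
have := @cos1_const R _ I01 (fun t => T t + c - (d + T' t)) (@segment_connected _ _ _).
move=> /(_ _ E 1 0 I1 I0) H; have : T 1 + c - (d + T' 1) = T 0 + c - (d + T' 0).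
  by apply: H; apply: cont_onB; apply: cont_onD => //; exact: cont_on_cst.
clear; lra.
Qed.

Lemma angle_along (f : R -> plane) : cont_on I01 f -> (forall t, I01 t -> f t != 0) ->
  exists2 T : R -> R, cont_on I01 T & forall t, I01 t -> rotto (T t) e1 (f t).
Proof.
move=> cf f0.
have [T cT rT] := @lift_star R _ I01 f (@segment_compact R 0 1) (itv_star0 R) cf f0.
have I0 : I01 0 by rewrite /= in_itv/= lexx ler01.
have e10 : e1 != 0 by apply/eqP => -[] /eqP; rewrite oner_eq0.
have [t0 rt0] := rotto_ex e10 (f0 0 I0).
exists (fun t => t0 + T t); first by apply: cont_onD => //; exact: cont_on_cst.
by move=> t It; apply: rotto_trans rt0 (rT t It).
Qed.

(* A drawing of K_{3,3} in the plane has two crossing independent edges: the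
   direction of [w - v], for [v] and [w] on two independent edges, is continuous,
   and adding up the 18 resulting relations between its changes along the edges
   gives a parity contradiction. *)
Lemma K33_paths (n h : 'I_3 -> plane) (e : 'I_3 -> 'I_3 -> R -> plane) :
  (forall i j, [/\ cont_on setT (e i j), e i j 0 = n i & e i j 1 = h j]) ->
  (forall i j k l s t, i != k -> j != l -> I01 s -> I01 t -> e i j s <> e k l t) -> False.
Proof.
move=> eP disj.
have I0 : I01 0 by rewrite /= in_itv/= lexx ler01.
have I1 : I01 1 by rewrite /= in_itv/= lexx ler01.
have e10 : e1 != 0 by apply/eqP => -[] /eqP; rewrite oner_eq0.
have ce i j : cont_on setT (e i j) by have [] := eP i j.
have en i j : e i j 0 = n i by have [] := eP i j.
have eh i j : e i j 1 = h j by have [] := eP i j.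
have other (i : 'I_3) : exists j, j != i.
  by have [->|i0] := eqVneq i ord0; [exists ord_max|exists ord0; rewrite eq_sym].
have n_off k l i t : i != k -> I01 t -> e k l t - n i != 0.
  move=> ik It; rewrite subr_eq0; apply/eqP => E; have [j jl] := other l.
  by apply: (disj i j k l 0 t) => //; rewrite en.
have h_off k l j t : j != l -> I01 t -> e k l t - h j != 0.
  move=> jl It; rewrite subr_eq0; apply/eqP => E; have [i ik] := other k.
  by apply: (disj i j k l 1 t) => //; rewrite eh.
have cB k l v : cont_on I01 (fun t => e k l t - v).
  by apply: cont_onB; [exact: cont_onS (ce k l)|exact: cont_on_cst].
have /choice[Tn TnP] : forall q : 'I_3 * 'I_3 * 'I_3, exists T : R -> R, q.2 != q.1.1 ->
    cont_on I01 T /\ forall t, I01 t -> rotto (T t) e1 (e q.1.1 q.1.2 t - n q.2).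
  move=> [[k l] i] /=; have [->|ik] := eqVneq i k; first by exists (fun=> 0).
  have [|T cT rT] := angle_along (cB k l (n i)); first by move=> t; exact: n_off.
  by exists T.
have /choice[Th ThP] : forall q : 'I_3 * 'I_3 * 'I_3, exists T : R -> R, q.2 != q.1.2 ->
    cont_on I01 T /\ forall t, I01 t -> rotto (T t) e1 (e q.1.1 q.1.2 t - h q.2).
  move=> [[k l] j] /=; have [->|jl] := eqVneq j l; first by exists (fun=> 0).
  have [|T cT rT] := angle_along (cB k l (h j)); first by move=> t; exact: h_off.
  by exists T.
pose Xn k l i := Tn (k, l, i) 1 - Tn (k, l, i) 0.
pose Xh k l j := Th (k, l, j) 1 - Th (k, l, j) 0.
(* Over the parameter square of two independent edges the direction of the difference has one lift,
   so its changes along the four sides balance. Exchanging point and vertex on two sides only adds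
   the constant [pi]. *)
have sq i j k l : i != k -> j != l -> Xh k l j - Xn k l i = Xh i j l - Xn i j k.
  move=> ik jl.
  pose f (x : plane) := e k l x.2 - e i j x.1.
  have sX : star 0 (I01 `*` I01 : set plane).
    have [J0 Js] := itv_star0 R.
    split; first by split.
    by move=> x t [x1 x2] t01; split; [exact: Js x1 t01|exact: Js x2 t01].
  have [||T cT rT] := @lift_star R _ (I01 `*` I01) f (compact_setX (@segment_compact R 0 1) (@segment_compact R 0 1)) sX.
  - apply: cont_onB; apply: (@cont_on_comp _ _ _ _ _ setT) => //.
      by apply: cont_on_snd; exact: cont_on_id.
    by apply: cont_on_fst; exact: cont_on_id.
  - move=> x [x1 x2]; rewrite /f subr_eq0; apply/eqP => E; exact: (disj i j k l _ _ ik jl x1 x2).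
  have f0 : f 0 != 0 by rewrite /f /= !en -(en k l); exact: n_off.
  have cTx s : I01 s -> cont_on I01 (fun t => T (s, t)).
    move=> Is; apply: cont_on_comp cT _ => [|t It]; last by split.
    by apply: cont_on_pair; [exact: cont_on_cst|exact: cont_on_id].
  have cTy s : I01 s -> cont_on I01 (fun t => T (t, s)).
    move=> Is; apply: cont_on_comp cT _ => [|t It]; last by split.
    by apply: cont_on_pair; [exact: cont_on_id|exact: cont_on_cst].
  have ki : k != i by rewrite eq_sym.
  have lj : l != j by rewrite eq_sym.
  have [cn1 rn1] := TnP (k, l, i) ik.
  have [ch1 rh1] := ThP (k, l, j) jl.
  have [cn2 rn2] := TnP (i, j, k) ki.
  have [ch2 rh2] := ThP (i, j, l) lj.
  have A1 : Xn k l i = T (0, 1) - T (0, 0).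
    apply: (angle_change_uniq e10 f0 cn1 (cTx 0 I0) rn1 (f' := fun t => f (0, t)) (c := 0)).
      by move=> t It; exact: (rT (0, t)).
    by move=> t; rewrite /f /= en; exact: rotto0.
  have A2 : Xh k l j = T (1, 1) - T (1, 0).
    apply: (angle_change_uniq e10 f0 ch1 (cTx 1 I1) rh1 (f' := fun t => f (1, t)) (c := 0)).
      by move=> t It; exact: (rT (1, t)).
    by move=> t; rewrite /f /= eh; exact: rotto0.
  have A3 : Xn i j k = T (1, 0) - T (0, 0).
    apply: (angle_change_uniq e10 f0 cn2 (cTy 0 I0) rn2 (f' := fun t => f (t, 0)) (c := pi)).
      by move=> t It; exact: (rT (t, 0)).
    by move=> t; rewrite /f /= en -[_ - e i j t]opprB; exact: rotto_opp.
  have A4 : Xh i j l = T (1, 1) - T (0, 1).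
    apply: (angle_change_uniq e10 f0 ch2 (cTy 1 I1) rh2 (f' := fun t => f (t, 1)) (c := pi)).
      by move=> t It; exact: (rT (t, 1)).
    by move=> t; rewrite /f /= eh -[_ - e i j t]opprB; exact: rotto_opp.
  rewrite A1 A2 A3 A4; clear; lra.
(* Directions within a vertex class are chosen for increasing pairs and reversed by exactly [+ pi]
   for the others; this convention is where the parity arises. *)
have vert (v : 'I_3 -> plane) : (forall i k, i != k -> v k - v i != 0) ->
    exists A : 'I_3 -> 'I_3 -> R, (forall i k, i != k -> rotto (A i k) e1 (v k - v i)) /\
    forall i k : 'I_3, (i < k)%N -> A k i = A i k + pi.
  move=> v0.
  have /choice[A0 A0P] : forall q : 'I_3 * 'I_3, exists t, q.1 != q.2 -> rotto t e1 (v q.2 - v q.1).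
    move=> [i k] /=; have [->|ik] := eqVneq i k; first by exists 0.
    by have [t rt] := rotto_ex e10 (v0 i k ik); exists t.
  exists (fun i k : 'I_3 => if (i < k)%N then A0 (i, k) else A0 (k, i) + pi); split; last first.
    by move=> i k ik; rewrite ik ltnNge (ltnW ik).
  move=> i k ik; case: ifP => [_|_]; first exact: (A0P (i, k)).
  apply: rotto_trans (A0P (k, i) _) _; first by rewrite eq_sym.
  by rewrite /= -[v k - v i]opprB; exact: rotto_opp.
have [|A [AP Aa]] := vert n; first by move=> i k ik; rewrite -(en k ord0); exact: n_off.
have [|H [HP Ha]] := vert h; first by move=> j l jl; rewrite -(eh ord0 l); exact: h_off.
have nh i j : h j - n i != 0.
  by have [k ki] := other i; rewrite -(eh k j); apply: n_off => //; rewrite eq_sym.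
have /choice[B BP] : forall q : 'I_3 * 'I_3, exists t, rotto t e1 (h q.2 - n q.1).
  by move=> [i j]; exact: rotto_ex.
(* The change along an edge minus the difference of the chosen directions at its ends, so a multiple
   of a full turn. *)
pose Mn k l i := Xn k l i - (B (i, l) - A i k).
pose Mh k l j := Xh k l j - (H j l - (B (k, j) + pi)).
have EMn k l i : i != k -> cos (Mn k l i) = 1.
  move=> ik; have [_ rT] := TnP (k, l, i) ik.
  have := rT 0 I0; have := rT 1 I1; rewrite /= en eh => r1 r0.
  have -> : Mn k l i = (Tn (k, l, i) 1 - B (i, l)) - (Tn (k, l, i) 0 - A i k).
    rewrite /Mn /Xn; clear; lra.
  apply: cos1B; first exact: (rotto_uniq e10 r1 (BP (i, l))).
  exact: (rotto_uniq e10 r0 (AP i k ik)).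
have EMh k l j : j != l -> cos (Mh k l j) = 1.
  move=> jl; have [_ rT] := ThP (k, l, j) jl.
  have := rT 0 I0; have := rT 1 I1; rewrite /= en eh => r1 r0.
  have -> : Mh k l j = (Th (k, l, j) 1 - H j l) - (Th (k, l, j) 0 - (B (k, j) + pi)).
    rewrite /Mh /Xh; clear; lra.
  apply: cos1B; first exact: (rotto_uniq e10 r1 (HP j l jl)).
  apply: (rotto_uniq e10 r0); apply: rotto_trans (BP (k, j)) _.
  by rewrite /= -[n k - h j]opprB; exact: rotto_opp.
have eqs (i k j l : 'I_3) : (i < k)%N -> j != l ->
    Mh k l j - Mn k l i - Mh i j l + Mn i j k = if (j < l)%N then pi *+ 2 else 0.
  move=> ik jl; have ik' : i != k by rewrite -val_eqE neq_ltn ik.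
  have := sq i j k l ik' jl; have := Aa i k ik; rewrite /Mn /Mh mulr2n.
  case: ifP => [jl'|/negbT jl'].
    have := Ha j l jl'; clear; lra.
  have lj : (l < j)%N by rewrite ltn_neqAle leqNgt jl' andbT val_eqE eq_sym.
  have := Ha l j lj; clear; lra.
clearbody Mh Mn.
pose o0 : 'I_3 := inord 0; pose o1 : 'I_3 := inord 1; pose o2 : 'I_3 := inord 2.
have v0 : o0 = 0%N :> nat by rewrite inordK.
have v1 : o1 = 1%N :> nat by rewrite inordK.
have v2 : o2 = 2%N :> nat by rewrite inordK.
pose Sh k := Mh k o0 o1 + Mh k o0 o2 + Mh k o1 o0 + Mh k o1 o2 + Mh k o2 o0 + Mh k o2 o1.
pose Sn k i := Mn k o0 i + Mn k o1 i + Mn k o2 i.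
have ESh k : cos (Sh k) = 1.
  by rewrite /Sh; do !apply: cos1D; apply: EMh; rewrite -val_eqE /= ?v0 ?v1 ?v2.
have ESn k i : i != k -> cos (Sn k i) = 1.
  by move=> ik; rewrite /Sn; do !apply: cos1D; exact: EMn.
have n01 : o0 != o1 by rewrite -val_eqE /= v0 v1.
have n02 : o0 != o2 by rewrite -val_eqE /= v0 v2.
have n12 : o1 != o2 by rewrite -val_eqE /= v1 v2.
(* Of the six ordered pairs [j != l], the three increasing ones contribute a full turn each. *)
have rows (i k : 'I_3) : (i < k)%N -> Sh k - Sh i + 2 * (Sn i k - Sn k i) = 6 * pi.
  move=> ik.
  have := eqs i k o0 o1 ik; have := eqs i k o0 o2 ik; have := eqs i k o1 o2 ik.
  have := eqs i k o1 o0 ik; have := eqs i k o2 o0 ik; have := eqs i k o2 o1 ik.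
  rewrite (eq_sym o1 o0) (eq_sym o2 o0) (eq_sym o2 o1) n01 n02 n12 !v0 !v1 !v2 /=.
  move=> /(_ isT) a /(_ isT) b /(_ isT) c /(_ isT) d /(_ isT) e' /(_ isT) f.
  move: a b c d e' f; rewrite /Sh /Sn mulr2n; clear; lra.
clearbody Sh Sn.
have R01 := rows o0 o1; have R02 := rows o0 o2; have R12 := rows o1 o2.
rewrite v0 v1 v2 /= in R01 R02 R12.
(* Half the sum of the three rows, whose [Sh] terms collapse to [2 * (Sh o2 - Sh o0)]. So [S] is
   [9 * pi], although each of its terms is a multiple of a full turn. *)
pose S := Sh o2 - Sh o0 + (Sn o0 o1 - Sn o1 o0) + (Sn o0 o2 - Sn o2 o0) + (Sn o1 o2 - Sn o2 o1).
have : cos S = 1.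
  rewrite /S; do !(apply: cos1D); rewrite ?cosN; first [exact: ESh|apply: ESn; by [|rewrite eq_sym]].
have -> : S = pi + (pi *+ 2) *+ 4.
  rewrite /S !mulr2n !mulrS mulr0n addr0; move: (R01 isT) (R02 isT) (R12 isT); clear; lra.
by rewrite (periodicn (@cosD2pi R)) cospi; clear; lra.
Qed.

End K33Paths.

(** * From paths to connected sets in the drawing of [K_{3,3}] *)

Section K33Sets.
Variable R : realType.
Local Notation plane := (R * R)%type.
Local Notation I01 := (`[0, 1]%classic : set R).

Lemma fin_common_pos (T : finType) (P : T -> R -> Prop) :
  (forall x r s, 0 < s -> s <= r -> P x r -> P x s) -> (forall x, exists2 r, 0 < r & P x r) ->
  exists2 r, 0 < r & forall x, P x r.
Proof.
move=> mono ex.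
suff [r r0 rP] : exists2 r, 0 < r & forall x, x \in enum T -> P x r.
  by exists r => // x; apply: rP; rewrite mem_enum.
elim: (enum T) => [|x s [r r0 rP]]; first by exists 1.
have [r' r'0 r'P] := ex x; have m0 : 0 < Num.min r r' by rewrite lt_min r0.
exists (Num.min r r') => // y; rewrite inE => /orP[/eqP ->|ys].
  by apply: mono r'P => //; rewrite ge_min lexx orbT.
by apply: mono (rP y ys) => //; rewrite ge_min lexx.
Qed.

Definition seg (a b : plane) := [set z | exists2 t : R, 0 <= t <= 1 & z = a + t *: (b - a)].

Lemma seg_cpt a b : compact (seg a b).
Proof.
have -> : seg a b = (fun t : R => a + t *: (b - a)) @` I01.
  apply/seteqP; split=> z.
    by move=> [t t01 ->]; exists t => //; rewrite /= in_itv.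
  by move=> [t + <-]; rewrite /= in_itv/= => t01; exists t.
apply: image_cpt; last exact: segment_compact.
apply: cont_onD; first exact: cont_on_cst.
by apply: cont_onZ; [exact: cont_on_id|exact: cont_on_cst].
Qed.

Lemma seg_close a b z (r : R) : `|b - a| < r -> seg a b z -> `|z - a| < r.
Proof.
move=> br [t /andP[t0 t1] ->]; rewrite addrC addKr normrZ ger0_norm//.
by apply: le_lt_trans br; rewrite ler_piMl.
Qed.

Lemma path_cpt (G : set plane) a b : path_in G a b ->
  exists K, [/\ compact K, K `<=` G & path_in K a b].
Proof.
move=> [g [cg ga gb gG]]; exists (g @` I01); split.
- by apply: image_cpt; [exact: cont_onS cg|exact: segment_compact].
- by move=> _ [t + <-]; rewrite /= in_itv/= => /gG.
- by exists g; split=> // t t01; exists t => //; rewrite /= in_itv.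
Qed.

(** The sets [N i] are thick vertices. Enlarged by at most half of their distances they remain
    disjoint, and each enlargement contains paths from [n i] to the starts of its arms. Edges with a
    common end may cross freely. *)
Lemma K33_arms (n h : 'I_3 -> plane) (N : 'I_3 -> set plane)
    (p : 'I_3 -> 'I_3 -> plane) (Arm : 'I_3 -> 'I_3 -> set plane) :
  (forall i, compact (N i) /\ connected (N i)) ->
  (forall i k, i != k -> N i `&` N k = set0) ->
  (forall i, N i (n i)) -> (forall i j, N i (p i j)) ->
  (forall i j, compact (Arm i j) /\ path_in (Arm i j) (p i j) (h j)) ->
  (forall i j k, i != k -> Arm i j `&` N k = set0) ->
  (forall i j k l, i != k -> j != l -> Arm i j `&` Arm k l = set0) -> False.
Proof.
move=> cN dN Nn Np cA AN AA.
have [r r0 rP] : exists2 r : R, 0 < r & forall q : 'I_3 * 'I_3,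
    q.1 != q.2 -> forall a b, N q.1 a -> N q.2 b -> r <= `|a - b|.
  apply: fin_common_pos => [[i k] /= s s' _ ss h' ik a b Na Nb|[i k]].
    exact: le_trans ss (h' ik a b Na Nb).
  have [->|ik] := eqVneq i k; first by exists 1 => //; rewrite eqxx.
  have [r r0 rP] := cpt_dist (cN i).1 (cpt_closed (cN k).1) (dN _ _ ik).
  by exists r.
have [s s0 sP] : exists2 r : R, 0 < r & forall q : 'I_3 * 'I_3 * 'I_3,
    q.1.1 != q.2 -> forall a b, Arm q.1.1 q.1.2 a -> N q.2 b -> r <= `|a - b|.
  apply: fin_common_pos => [[[i j] k] /= s s' _ ss h' ik a b Na Nb|[[i j] k]].
    exact: le_trans ss (h' ik a b Na Nb).
  have [->|ik] := eqVneq i k; first by exists 1 => //; rewrite eqxx.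
  have [s s0 sP] := cpt_dist (cA i j).1 (cpt_closed (cN k).1) (AN _ _ _ ik).
  by exists s.
pose t := Num.min (r / 2) s.
have t0 : 0 < t by rewrite lt_min s0 divr_gt0.
have tr : t <= r / 2 by rewrite ge_min lexx.
have ts : t <= s by rewrite ge_min lexx orbT.
pose O i := [set z | exists2 w, N i w & `|z - w| < t].
have OO i k z : i != k -> O i z -> O k z -> False.
  move=> ik [a Na za] [b Nb zb]; have := rP (i, k) ik a b Na Nb.
  have -> : a - b = (z - b) - (z - a) by rewrite opprB [RHS]addrC addrA subrK.
  move=> /le_trans/(_ (ler_normB _ _)); move: za zb tr; clear; lra.
have AO i j k z : i != k -> Arm i j z -> O k z -> False.
  move=> ik Az [b Nb zb]; have := sP (i, j, k) ik z b Az Nb.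
  by move=> /(le_trans ts); rewrite leNgt zb.
have /choice[e eP] : forall q : 'I_3 * 'I_3, exists g : R -> plane,
    [/\ cont_on setT g, g 0 = n q.1, g 1 = h q.2 & forall t, 0 <= t <= 1 -> (O q.1 `|` Arm q.1 q.2) (g t)].
  move=> [i j] /=; apply: (@path_in_trans R _ (O i `|` Arm i j) _ (p i j)).
    by move: (nbhd_path t0 (cN i).2 (Nn i) (Np i j)); apply: path_inS => z; left.
  by move: (cA i j).2; apply: path_inS => z; right.
apply: (@K33_paths R n h (fun i j => e (i, j))).
  by move=> i j; have [] := eP (i, j).
move=> i j k l a b ik jl; rewrite /= !in_itv/= => a01 b01 E.
have [_ _ _ /(_ _ a01) /= ha] := eP (i, j); have [_ _ _ /(_ _ b01) /= hb] := eP (k, l).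
rewrite -E in hb; case: ha => [Oi|Ai]; case: hb => [Ok|Ak].
- exact: (OO i k _ ik Oi Ok).
- by apply: (AO k l i _ _ Ak Oi); rewrite eq_sym.
- exact: (AO i j k _ ik Ai Ok).
- have : (Arm i j `&` Arm k l) (e (i, j) a) by [].
  by rewrite AA.
Qed.

(** An arm is a short segment from [p i j] into the open set [H j], continued by a path inside it to
    a fixed point [h j]. *)
Lemma K33_sets (N H : 'I_3 -> set plane) (p : 'I_3 -> 'I_3 -> plane) :
  (forall i, compact (N i) /\ connected (N i)) ->
  (forall i k, i != k -> N i `&` N k = set0) ->
  (forall j, open (H j) /\ connected (H j)) ->
  (forall j l, j != l -> H j `&` H l = set0) ->
  (forall i j, N i `&` H j = set0) ->
  (forall i j, N i (p i j) /\ closure (H j) (p i j)) ->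
  (forall i j l, j != ord_max -> l != j -> ~ closure (H l) (p i j)) -> False.
Proof.
move=> cN dN cH dH NH pP psep.
have [r r0 rP] : exists2 r : R, 0 < r & forall q : 'I_3 * 'I_3,
    q.1 != q.2 -> forall a b, N q.1 a -> N q.2 b -> r <= `|a - b|.
  apply: fin_common_pos => [[i k] /= s s' _ ss h' ik a b Na Nb|[i k]].
    exact: le_trans ss (h' ik a b Na Nb).
  have [->|ik] := eqVneq i k; first by exists 1 => //; rewrite eqxx.
  have [r r0 rP] := cpt_dist (cN i).1 (cpt_closed (cN k).1) (dN _ _ ik).
  by exists r.
have [s s0 sP] : exists2 s : R, 0 < s & forall q : 'I_3 * 'I_3 * 'I_3,
    q.1.2 != ord_max -> q.2 != q.1.2 -> forall z, H q.2 z -> s <= `|z - p q.1.1 q.1.2|.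
  apply: fin_common_pos => [[[i j] l] /= s s' _ ss h' j2 lj z Hz|[[i j] l] /=].
    exact: le_trans ss (h' j2 lj z Hz).
  have [[j2 lj]|nj] := pselect (j != ord_max /\ l != j); last first.
    by exists 1 => // j2 lj; exfalso; apply: nj.
  have := psep i j l j2 lj; have oC : open (~` closure (H l)) by apply: closed_openC; exact: closed_closure.
  move=> /((open_normP _).1 oC)[d d0 dP]; exists d => // _ _ z Hz.
  rewrite leNgt; apply/negP => /dP; apply; exact: subset_closure.
have /choice[h hP] : forall j, exists z, H j z.
  by move=> j; have /closure_normP/(_ 1 ltr01)[z Hz _] := (pP ord0 j).2; exists z.
have /choice[C CP] : forall q : 'I_3 * 'I_3 * R, exists x : plane * set plane, 0 < q.2 ->
    [/\ `|x.1 - p q.1.1 q.1.2| < q.2, compact x.2, x.2 `<=` H q.1.2 & path_in x.2 x.1 (h q.1.2)].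
  move=> [[i j] d] /=; have [d0|] := pselect (0 < d); last by exists (0, set0).
  have /closure_normP/(_ d d0)[q Hq qp] := (pP i j).2.
  have [K [cK KH pK]] := path_cpt (open_connected_path (cH j).1 (cH j).2 Hq (hP j)).
  by exists (q, K).
pose d0 := Num.min (r / 2) s.
have d00 : 0 < d0 by rewrite lt_min s0 divr_gt0.
have d0r : d0 <= r / 2 by rewrite ge_min lexx.
have d0s : d0 <= s by rewrite ge_min lexx orbT.
(* Points with last index may lie on the closure of another [H l]. Their segments are therefore
   chosen last, and shorter than the distance to the compact paths already fixed. *)
have [d d_gt0 dP] : exists2 d : R, 0 < d & forall q : 'I_3 * 'I_3 * 'I_3,
    forall z, (C (q.1.1, q.1.2, d0)).2 z -> d <= `|z - p q.2 ord_max|.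
  apply: fin_common_pos => [[[k l] i] /= s1 s' _ ss h' z Hz|[[k l] i] /=].
    exact: le_trans ss (h' z Hz).
  have [_ cK KH _] := CP (k, l, d0) d00.
  have [||d dd dP] := @cpt_dist R _ _ [set p i ord_max] cK.
  - by apply: cpt_closed; exact: compact_set1.
  - rewrite -subset0 => z [/KH Hz /= zp]; have : (N i `&` H l) z by split=> //; rewrite zp; exact: (pP _ _).1.
    by rewrite NH.
  - by exists d => // z Kz; exact: dP.
pose d1 := Num.min d d0.
have d10 : 0 < d1 by rewrite lt_min d_gt0.
have d1d : d1 <= d by rewrite ge_min lexx.
have d1d0 : d1 <= d0 by rewrite ge_min lexx orbT.
pose dd (j : 'I_3) := if j == ord_max then d1 else d0.
have dd0 j : 0 < dd j by rewrite /dd; case: ifP.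
have ddd0 j : dd j <= d0 by rewrite /dd; case: ifP.
pose q i j := (C (i, j, dd j)).1; pose K i j := (C (i, j, dd j)).2.
have sg i j z : seg (p i j) (q i j) z -> `|z - p i j| < dd j.
  by apply: seg_close; have [] := CP (i, j, dd j) (dd0 j).
have KH i j : K i j `<=` H j by have [] := CP (i, j, dd j) (dd0 j).
have cK i j : compact (K i j) by have [] := CP (i, j, dd j) (dd0 j).
have sN i j k z : i != k -> seg (p i j) (q i j) z -> N k z -> False.
  move=> ik /sg zp Nk; have := rP (i, k) ik _ z (pP i j).1 Nk.
  rewrite distrC; have := ddd0 j; move: zp d0r r0; clear; lra.
have sK i j k l z : j != l -> seg (p i j) (q i j) z -> K k l z -> False.
  move=> jl /sg; rewrite /dd; case: ifPn => [/eqP j2|j2] zp Kz.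
    have Kz' : (C (k, l, d0)).2 z.
      by move: Kz; rewrite /K /dd ifN// -j2 eq_sym.
    have := dP (k, l, i) z Kz'; rewrite /= -j2; move: zp d1d; clear; lra.
  have := sP (i, j, l) j2; rewrite eq_sym => /(_ jl z (KH _ _ _ Kz)) /=.
  move: zp d0s; clear; lra.
apply: (@K33_arms (fun i => p i ord0) h N p (fun i j => seg (p i j) (q i j) `|` K i j)) => //.
- by move=> i; have [] := pP i ord0.
- by move=> i j; have [] := pP i j.
- move=> i j; split; first by apply: compactU; [exact: seg_cpt|exact: cK].
  apply: (@path_in_trans R _ _ _ (q i j)).
    by apply: path_in_seg => t t01; left; exists t.
  by have [_ _ _ pK] := CP (i, j, dd j) (dd0 j); move: pK; apply: path_inS => z; right.
- move=> i j k ik; rewrite -subset0 => z [[sz|/KH Hz] Nz]; first exact: (sN i j k z).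
  by have : (N k `&` H j) z by []; rewrite NH.
- move=> i j k l ik jl; rewrite -subset0 => z [[sz|Kz] [sz'|Kz']].
  + have := sg _ _ _ sz; have := sg _ _ _ sz'; have := ddd0 j; have := ddd0 l.
    have := rP (i, k) ik _ _ (pP i j).1 (pP k l).1.
    have -> : p i j - p k l = (z - p k l) - (z - p i j) by rewrite opprB [RHS]addrC addrA subrK.
    move=> /le_trans/(_ (ler_normB _ _)); move: d0r; clear; lra.
  + exact: (sK i j k l z).
  + by apply: (sK k l i j z) => //; rewrite eq_sym.
  + have : (H j `&` H l) z by split; [exact: (KH i)|exact: (KH k)].
    by rewrite dH.
Qed.

End K33Sets.

(** * The sphere and its charts *)

Section SphereCharts.
Variable R : realType.
Local Notation V3 := 'rV[R]_3.
Local Notation plane := (R * R)%type.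
Local Notation S2 := (@S2 R).

Definition vec3 (a b c : R) : V3 := \row_(i < 3) [:: a; b; c]`_i.

Lemma vec3E a b c : (vec3 a b c ord0 i0 = a) * (vec3 a b c ord0 i1 = b) * (vec3 a b c ord0 i2 = c).
Proof. by rewrite /vec3 !mxE. Qed.

Lemma eq_vec3 (u v : V3) : u ord0 i0 = v ord0 i0 -> u ord0 i1 = v ord0 i1 -> u ord0 i2 = v ord0 i2 -> u = v.
Proof.
move=> h0 h1 h2; apply/rowP => -[[|[|[|//]]] k].
- by rewrite (_ : Ordinal k = i0)//; exact: val_inj.
- by rewrite (_ : Ordinal k = i1)//; exact: val_inj.
- by rewrite (_ : Ordinal k = i2)//; exact: val_inj.
Qed.

Lemma coord_le (v : V3) i : `|v ord0 i| <= `|v|.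
Proof.
rewrite {2}/Num.Def.normr /= mx_normrE.
exact: (le_bigmax (0 : R) (fun ij : 'I_1 * 'I_3 => `|v ij.1 ij.2|) (ord0, i)).
Qed.

Lemma norm3_lt (v : V3) (e : R) : `|v ord0 i0| < e -> `|v ord0 i1| < e -> `|v ord0 i2| < e -> `|v| < e.
Proof.
move=> h0 h1 h2; rewrite /Num.Def.normr /= mx_normrE.
apply: bigmax_lt => [|[i j] _ /=]; first exact: le_lt_trans h0.
rewrite (ord1 i); case: j => -[|[|[|//]]] k.
- by rewrite (_ : Ordinal k = i0)//; exact: val_inj.
- by rewrite (_ : Ordinal k = i1)//; exact: val_inj.
- by rewrite (_ : Ordinal k = i2)//; exact: val_inj.
Qed.

Lemma cont_on_coord (W : normedModType R) (A : set W) (f : W -> V3) i :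
  cont_on A f -> cont_on A (fun x => f x ord0 i).
Proof.
move=> cf x Ax e e0; have [d d0 dP] := cf x Ax e e0; exists d => // y Ay yx.
have -> : f y ord0 i - f x ord0 i = (f y - f x) ord0 i by rewrite !mxE.
exact: le_lt_trans (coord_le _ _) (dP y Ay yx).
Qed.

Lemma cont_on_vec3 (W : normedModType R) (A : set W) (f0 f1 f2 : W -> R) :
  cont_on A f0 -> cont_on A f1 -> cont_on A f2 -> cont_on A (fun x => vec3 (f0 x) (f1 x) (f2 x)).
Proof.
move=> c0 c1 c2 x Ax e e0.
have [d0 d00 dP0] := c0 x Ax e e0; have [d1 d10 dP1] := c1 x Ax e e0; have [d2 d20 dP2] := c2 x Ax e e0.
exists (Num.min d0 (Num.min d1 d2)); first by rewrite !lt_min d00 d10.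
move=> y Ay; rewrite !lt_min => /and3P[y0 y1 y2].
by apply: norm3_lt; rewrite [X in `|X|]mxE [X in _ + X]mxE !vec3E; [exact: dP0|exact: dP1|exact: dP2].
Qed.

Lemma S2_cpt : compact S2.
Proof.
apply: bounded_closed_compact.
  exists 1; split=> // M M1 v Sv; apply: (le_trans _ (ltW M1)); rewrite leNgt; apply/negP => v1.
  have : `|v| < `|v|; last by rewrite ltxx.
  suff H i : v ord0 i ^+ 2 <= 1 -> `|v ord0 i| < `|v|.
    have := Sv; rewrite /S2 /= => E; have s0 := sqr_ge0 (v ord0 i0).
    have s1 := sqr_ge0 (v ord0 i1); have s2 := sqr_ge0 (v ord0 i2).
    by apply: norm3_lt; apply: H; move: E s0 s1 s2; clear; lra.
  move=> vi; apply: le_lt_trans v1; rewrite -(@ler_pXn2r _ 2)// ?nnegrE//.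
  by rewrite expr1n real_normK// num_real.
have cs i : cont_on setT (fun v : V3 => v ord0 i ^+ 2).
  apply: (cont_on_eq (f := fun v : V3 => v ord0 i * v ord0 i)); first by move=> v _; rewrite expr2.
  by apply: cont_onM; apply: cont_on_coord; exact: cont_on_id.
have cf : cont_on setT (fun v : V3 => v ord0 i0 ^+ 2 + v ord0 i1 ^+ 2 + v ord0 i2 ^+ 2).
  by apply: cont_onD; [apply: cont_onD|].
have := @closed_preimage R _ _ setT _ (@set1 R 1) cf; rewrite setTI; apply; first exact: closedT.
by apply: cpt_closed; exact: compact_set1.
Qed.

Definition sproj (v : V3) : plane := (v ord0 i0 / (1 - v ord0 i2), v ord0 i1 / (1 - v ord0 i2)).
Definition sinv (p : plane) : V3 := let d := p.1 ^+ 2 + p.2 ^+ 2 + 1 in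
  vec3 (2 * p.1 / d) (2 * p.2 / d) ((d - 2) / d).

Definition north : V3 := vec3 0 0 1.

Lemma S2_north v : S2 v -> v ord0 i2 = 1 -> v = north.
Proof.
rewrite /S2 /= => + v2; rewrite v2 expr1n => E.
have s0 := sqr_ge0 (v ord0 i0); have s1 := sqr_ge0 (v ord0 i1).
have z0 : v ord0 i0 ^+ 2 = 0 by move: E s0 s1; clear; lra.
have z1 : v ord0 i1 ^+ 2 = 0 by move: E s0 s1; clear; lra.
by apply: eq_vec3; rewrite /north !vec3E//; apply/eqP; rewrite -sqrf_eq0 ?z0 ?z1.
Qed.

Lemma sinv_den (p : plane) : 0 < p.1 ^+ 2 + p.2 ^+ 2 + 1.
Proof. by rewrite ltr_wpDl// addr_ge0// sqr_ge0. Qed.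

Lemma sinv_S2 p : S2 (sinv p).
Proof.
rewrite /S2 /= /sinv !vec3E; have := sinv_den p; move: p.1 p.2 => a b d0.
by field; rewrite gt_eqF.
Qed.

Lemma sinvK p : sproj (sinv p) = p.
Proof.
rewrite /sproj /sinv !vec3E; have := sinv_den p; case: p => a b /= d0.
have -> : 1 - (a ^+ 2 + b ^+ 2 + 1 - 2) / (a ^+ 2 + b ^+ 2 + 1) = 2 / (a ^+ 2 + b ^+ 2 + 1).
  by field; rewrite gt_eqF.
by congr (_, _); field; rewrite gt_eqF//= pnatr_eq0.
Qed.

Lemma sprojK v : S2 v -> v <> north -> sinv (sproj v) = v.
Proof.
move=> Sv nv; have v2 : 1 - v ord0 i2 != 0.
  by rewrite subr_eq0 eq_sym; apply/eqP => /(S2_north Sv).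
have E : (v ord0 i0) ^+ 2 + (v ord0 i1) ^+ 2 = (1 - v ord0 i2) * (1 + v ord0 i2).
  by move: Sv; rewrite /S2 /= => Sv; rewrite -[LHS](addrK (v ord0 i2 ^+ 2)) Sv; ring.
have D : (sproj v).1 ^+ 2 + (sproj v).2 ^+ 2 + 1 = 2 / (1 - v ord0 i2).
  have -> : (sproj v).1 ^+ 2 + (sproj v).2 ^+ 2 = (v ord0 i0 ^+ 2 + v ord0 i1 ^+ 2) / (1 - v ord0 i2) ^+ 2.
    by rewrite /sproj /=; field.
  by rewrite E; field.
by apply: eq_vec3; rewrite /sinv !vec3E D /sproj /=; field; rewrite v2 ?pnatr_eq0.
Qed.

Lemma sproj_cont : cont_on (S2 `\` [set north]) sproj.
Proof.
have c i : cont_on (S2 `\` [set north]) (fun v : V3 => v ord0 i).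
  by apply: cont_on_coord; exact: cont_on_id.
have ci : cont_on (S2 `\` [set north]) (fun v : V3 => (1 - v ord0 i2)^-1).
  apply: cont_onV; first by apply: cont_onB => //; exact: cont_on_cst.
  by move=> v [Sv nv]; rewrite subr_eq0 eq_sym; apply/eqP => /(S2_north Sv).
by apply: cont_on_pair; exact: cont_onM.
Qed.

Lemma sinv_cont : cont_on setT sinv.
Proof.
have c1 : cont_on setT (fun p : plane => p.1) by apply: cont_on_fst; exact: cont_on_id.
have c2 : cont_on setT (fun p : plane => p.2) by apply: cont_on_snd; exact: cont_on_id.
have cd : cont_on setT (fun p : plane => p.1 ^+ 2 + p.2 ^+ 2 + 1).
  apply: (cont_on_eq (f := fun p : plane => p.1 * p.1 + p.2 * p.2 + 1)).
    by move=> p _; rewrite !expr2.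
  by apply: cont_onD; [apply: cont_onD; exact: cont_onM|exact: cont_on_cst].
have ci : cont_on setT (fun p : plane => (p.1 ^+ 2 + p.2 ^+ 2 + 1)^-1).
  by apply: cont_onV => // p _; rewrite gt_eqF// sinv_den.
apply: cont_on_vec3; apply: cont_onM => //.
- by apply: cont_onM => //; exact: cont_on_cst.
- by apply: cont_onM => //; exact: cont_on_cst.
- by apply: cont_onB => //; exact: cont_on_cst.
Qed.

(* Householder reflections move any point of the sphere to the north pole. *)
Lemma to_north (c : V3) : S2 c -> exists rho : V3 -> V3,
  [/\ cont_on setT rho, forall v, rho (rho v) = v, forall v, S2 v -> S2 (rho v) & rho c = north].
Proof.
move=> Sc; have [cn|nc] := pselect (c = north).
  by exists id; split=> //; exact: cont_on_id.
have d0 : 1 - c ord0 i2 != 0 by rewrite subr_eq0 eq_sym; apply/eqP => /(S2_north Sc).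
have E : c ord0 i0 ^+ 2 = 1 - c ord0 i1 ^+ 2 - c ord0 i2 ^+ 2.
  by move: Sc; rewrite /S2 /=; clear; lra.
pose k (v : V3) := (v ord0 i0 * c ord0 i0 + v ord0 i1 * c ord0 i1 + v ord0 i2 * (c ord0 i2 - 1)) / (1 - c ord0 i2).
pose rho (v : V3) := vec3 (v ord0 i0 - k v * c ord0 i0) (v ord0 i1 - k v * c ord0 i1) (v ord0 i2 - k v * (c ord0 i2 - 1)).
have kr v : k (rho v) = - k v.
  have e2 : (c ord0 i0 * c ord0 i0 + c ord0 i1 * c ord0 i1 + (c ord0 i2 - 1) * (c ord0 i2 - 1)) = 2 * (1 - c ord0 i2).
    by rewrite -expr2 E; ring.
  have -> : k (rho v) = k v - k v * (c ord0 i0 * c ord0 i0 + c ord0 i1 * c ord0 i1 + (c ord0 i2 - 1) * (c ord0 i2 - 1)) / (1 - c ord0 i2).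
    have hK : v ord0 i0 * c ord0 i0 + v ord0 i1 * c ord0 i1 + v ord0 i2 * (c ord0 i2 - 1) = k v * (1 - c ord0 i2).
      by rewrite /k divfK.
    transitivity ((v ord0 i0 * c ord0 i0 + v ord0 i1 * c ord0 i1 + v ord0 i2 * (c ord0 i2 - 1)
      - k v * (c ord0 i0 * c ord0 i0 + c ord0 i1 * c ord0 i1 + (c ord0 i2 - 1) * (c ord0 i2 - 1))) / (1 - c ord0 i2)).
      rewrite [LHS]/k /rho !vec3E; congr (_ / _); ring.
    by rewrite hK; field.
  by rewrite e2; field.
exists rho; split.
- have ck : cont_on setT k.
    apply: cont_onM; last exact: cont_on_cst.
    by apply: cont_onD; [apply: cont_onD|]; (apply: cont_onM; [apply: cont_on_coord; exact: cont_on_id|exact: cont_on_cst]).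
  by apply: cont_on_vec3; (apply: cont_onB; [apply: cont_on_coord; exact: cont_on_id|apply: cont_onM => //; exact: cont_on_cst]).
- have rE v : (rho v ord0 i0 = v ord0 i0 - k v * c ord0 i0) * (rho v ord0 i1 = v ord0 i1 - k v * c ord0 i1)
      * (rho v ord0 i2 = v ord0 i2 - k v * (c ord0 i2 - 1)) by rewrite /rho !vec3E.
  by move=> v; apply: eq_vec3; rewrite !rE kr; ring.
- move=> v; rewrite /S2 /= => Sv.
  have kE : v ord0 i0 * c ord0 i0 + v ord0 i1 * c ord0 i1 + v ord0 i2 * (c ord0 i2 - 1) = k v * (1 - c ord0 i2).
    by rewrite /k divfK.
  rewrite /rho !vec3E.
  transitivity (v ord0 i0 ^+ 2 + v ord0 i1 ^+ 2 + v ord0 i2 ^+ 2 -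
     2 * k v * (v ord0 i0 * c ord0 i0 + v ord0 i1 * c ord0 i1 + v ord0 i2 * (c ord0 i2 - 1))
     + k v ^+ 2 * (c ord0 i0 ^+ 2 + c ord0 i1 ^+ 2 + (c ord0 i2 - 1) ^+ 2)); first by ring.
  by rewrite Sv kE E; ring.
- have kc : k c = 1.
    rewrite /k; apply: (mulIf d0); rewrite divfK// mul1r -expr2 E; ring.
  by apply: eq_vec3; rewrite /rho /north !vec3E kc; ring.
Qed.

Definition chart_at (c : V3) (s : V3 -> plane) (t : plane -> V3) :=
  [/\ cont_on (S2 `\` [set c]) s, cont_on setT t, forall p, (S2 `\` [set c]) (t p),
   forall p, s (t p) = p & forall v, S2 v -> v <> c -> t (s v) = v].

Lemma chart_ex (c : V3) : S2 c -> exists s t, chart_at c s t.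
Proof.
move=> /[dup] Sc /to_north[rho [crho rhoK rhoS rhoc]].
have rn v : v <> c -> rho v <> north by move=> vc; rewrite -rhoc => E; apply: vc; rewrite -(rhoK v) E rhoK.
exists (fun v => sproj (rho v)), (fun p => rho (sinv p)); split.
- apply: (cont_on_comp (B := S2 `\` [set north])) sproj_cont _; first exact: cont_onS crho.
  by move=> v [Sv nv]; split; [exact: rhoS|exact: rn].
- exact: (cont_on_comp (B := setT) sinv_cont).
- move=> p; split; first by apply: rhoS; exact: sinv_S2.
  move=> /= pc; have : sinv p = north by rewrite -(rhoK (sinv p)) pc rhoc.
  move=> /(congr1 (fun v : V3 => v ord0 i2)); rewrite /north /sinv !vec3E => /eqP.
  have d0 := sinv_den p; rewrite -subr_eq0.
  have -> : (p.1 ^+ 2 + p.2 ^+ 2 + 1 - 2) / (p.1 ^+ 2 + p.2 ^+ 2 + 1) - 1 = - 2 / (p.1 ^+ 2 + p.2 ^+ 2 + 1).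
    by field; rewrite gt_eqF.
  by rewrite mulf_eq0 invr_eq0 (gt_eqF d0) oppr_eq0 pnatr_eq0.
- by move=> p; rewrite rhoK sinvK.
- by move=> v Sv vc; rewrite sprojK ?rhoK//; [exact: rhoS|exact: rn].
Qed.

End SphereCharts.

(** * Transfer of the plane results to the sphere *)

Section SphereTopology.
Variable R : realType.
Local Notation V3 := 'rV[R]_3.
Local Notation plane := (R * R)%type.
Local Notation S2 := (@S2 R).
Local Notation I01 := (`[0, 1]%classic : set R).

Definition sph_open (A : set V3) := A `<=` S2 /\
  forall x, A x -> exists2 d : R, 0 < d & forall y, S2 y -> `|y - x| < d -> A y.

Section Chart.
Variables (c : V3) (s : V3 -> plane) (t : plane -> V3).
Hypothesis ch : chart_at c s t.

Lemma chartK (A : set V3) v : A `<=` S2 -> ~ A c -> A v -> t (s v) = v.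
Proof.
have [_ _ _ _ ts] := ch => AS nAc Av; apply: ts; first exact: AS.
by move=> vc; rewrite -vc in nAc.
Qed.

Lemma chart_cont (A : set V3) : A `<=` S2 -> ~ A c -> cont_on A s.
Proof.
have [cs _ _ _ _] := ch => AS nAc; apply: cont_onS cs => v Av; split; first exact: AS.
by move=> /= vc; rewrite -vc in nAc.
Qed.

Lemma chart_openE (A : set V3) : A `<=` S2 -> ~ A c -> s @` A = t @^-1` A.
Proof.
move=> AS nAc; have [_ _ _ st _] := ch; apply/seteqP; split=> [_ [v Av <-]|p /= Ap].
  by rewrite /= (chartK AS nAc Av).
by exists (t p).
Qed.

Lemma chart_open (A : set V3) : sph_open A -> ~ A c -> open (s @` A).
Proof.
move=> [AS oA] nAc; rewrite chart_openE//; apply/open_normP => p /= Ap.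
have [_ ct tS _ _] := ch; have [d d0 dP] := oA _ Ap.
have [e e0 eP] := ct p I d d0; exists e => // q qp; apply: dP; first by have [] := tS q.
exact: eP.
Qed.

Lemma chart_conn (A : set V3) : A `<=` S2 -> ~ A c -> connected A -> connected (s @` A).
Proof. by move=> AS nAc; apply: image_conn; exact: chart_cont. Qed.

Lemma chart_cpt (A : set V3) : A `<=` S2 -> ~ A c -> compact A -> compact (s @` A).
Proof. by move=> AS nAc; apply: image_cpt; exact: chart_cont. Qed.

Lemma chart_closure (A : set V3) p : A `<=` S2 -> ~ A c -> p <> c -> closure A p -> closure (s @` A) (s p).
Proof.
move=> AS nAc pc cAp; have [cs _ _ _ _] := ch.
have Sp : S2 p by apply: (cpt_closed (@S2_cpt R)); exact: closureS cAp.
apply/closure_normP => e e0; have [d d0 dP] := cs p (conj Sp pc) e e0.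
have /closure_normP/(_ d d0)[y Ay yp] := cAp; exists (s y); first by exists y.
by apply: dP => //; split; [exact: AS|move=> /= yc; rewrite yc in Ay].
Qed.

Lemma chart_closureV (A : set V3) p : A `<=` S2 -> ~ A c -> closure (s @` A) p -> closure A (t p).
Proof.
move=> AS nAc /closure_normP cp; have [_ ct _ _ _] := ch.
apply/closure_normP => e e0; have [d d0 dP] := ct p I e e0.
have [_ [v Av <-] vp] := cp d d0; exists v => //.
by have := dP _ I vp; rewrite (chartK AS nAc Av).
Qed.

End Chart.

Lemma antipode_S2 (v : V3) : S2 v -> S2 (- v) /\ v <> - v.
Proof.
rewrite /S2 /= !mxE !sqrrN => Sv; split=> // E.
have z i : v ord0 i = 0.
  by have := congr1 (fun w : V3 => w ord0 i) E; rewrite mxE; clear; lra.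
by move: Sv; rewrite !z expr0n !addr0 => /eqP; rewrite eq_sym oner_eq0.
Qed.

Lemma S2_locally_connected (w : V3) (e : R) : S2 w -> 0 < e -> exists2 d : R, 0 < d &
  exists D, [/\ connected D, D `<=` S2, forall z, D z -> `|z - w| < e &
    forall z, S2 z -> `|z - w| < d -> D z].
Proof.
move=> Sw e0; have [Sc wc] := antipode_S2 Sw.
have [s [t ch]] := chart_ex Sc; have [cs ct tS st ts] := ch.
have [r r0 rP] := ct (s w) I e e0; rewrite ts// in rP.
have [d d0 dP] := cs w (conj Sw wc) r r0.
have cw : 0 < `|- w - w| by rewrite normr_gt0 subr_eq0; apply/eqP => E; apply: wc.
exists (Num.min d `|- w - w|); first by rewrite lt_min d0.
exists (t @` [set p | `|p - s w| < r]); split.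
- apply: image_conn; first exact: cont_onS ct.
  by apply: star_connected; exact: ball_star.
- by move=> _ [p _ <-]; have [] := tS p.
- by move=> _ [p /= pw <-]; exact: rP.
move=> z Sz; rewrite lt_min => /andP[zd zc].
have zc' : z <> - w by move=> E; rewrite E ltxx in zc.
by exists (s z); [exact: dP|rewrite ts].
Qed.

Lemma sph_component_open (A : set V3) x : sph_open A -> sph_open (connected_component A x).
Proof.
move=> [AS oA]; split; first by move=> y /connected_component_sub/AS.
move=> y Cy; have Ay := connected_component_sub Cy.
have [e e0 eP] := oA y Ay.
have [d d0 [D [cD DS De dD]]] := S2_locally_connected (AS _ Ay) e0.
exists d => // z Sz zy; apply: connected_component_trans Cy _.
exists D; last exact: dD.
split=> //; first by apply: dD; rewrite ?subrr ?normr0//; exact: AS.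
by move=> u Du; apply: eP; [exact: DS|exact: De].
Qed.

Lemma sph_closure_component (A : set V3) x :
  sph_open A -> closure (connected_component A x) `&` A `<=` connected_component A x.
Proof.
move=> oA y [/closure_normP cy Ay].
have [CS oC] := sph_component_open y oA.
have [d d0 dP] := oC y (connected_component_refl Ay).
have [z Cz zy] := cy d d0.
have Sz : S2 z by have [AS _] := oA; apply: AS; exact: connected_component_sub Cz.
by apply: connected_component_trans Cz _; apply: connected_component_sym; exact: dP.
Qed.

(** A point [c] off all six sets serves as the centre of projection to the plane. *)
Lemma K33_sphere (N H : 'I_3 -> set V3) (p : 'I_3 -> 'I_3 -> V3) (c : V3) :
  S2 c -> (forall i, ~ N i c) -> (forall j, ~ H j c) ->
  (forall i, [/\ N i `<=` S2, compact (N i) & connected (N i)]) ->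
  (forall i k, i != k -> N i `&` N k = set0) ->
  (forall j, sph_open (H j) /\ connected (H j)) ->
  (forall j l, j != l -> H j `&` H l = set0) ->
  (forall i j, N i `&` H j = set0) ->
  (forall i j, N i (p i j) /\ closure (H j) (p i j)) ->
  (forall i j l, j != ord_max -> l != j -> ~ closure (H l) (p i j)) -> False.
Proof.
move=> Sc Nc Hc NP dN HP dH NH pP psep.
have [s [t ch]] := chart_ex Sc; have [cs ct tS st ts] := ch.
have NS i : N i `<=` S2 by have [] := NP i.
have HS j : H j `<=` S2 by have [[]] := HP j.
have disj (A B : set V3) : A `<=` S2 -> B `<=` S2 -> ~ A c -> ~ B c -> A `&` B = set0 -> (s @` A) `&` (s @` B) = set0.
  move=> AS BS Ac Bc AB; rewrite -subset0 => q; rewrite (chart_openE ch AS Ac) (chart_openE ch BS Bc) => -[Aq Bq].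
  by have : (A `&` B) (t q) by []; rewrite AB.
have pc i j : p i j <> c by move=> E; apply: (Nc i); rewrite -E; exact: (pP i j).1.
apply: (@K33_sets R (fun i => s @` N i) (fun j => s @` H j) (fun i j => s (p i j))).
- by move=> i; have [NSi cN conN] := NP i; split; [exact: (chart_cpt ch)|exact: (chart_conn ch)].
- by move=> i k ik; apply: disj => //; exact: dN.
- by move=> j; have [oH cH] := HP j; split; [exact: (chart_open ch)|exact: (chart_conn ch)].
- by move=> j l jl; apply: disj => //; exact: dH.
- by move=> i j; apply: disj => //; exact: NH.
- move=> i j; have [Np Hp] := pP i j; split; first by exists (p i j).
  by apply: (chart_closure ch) => //; exact: HS.
- move=> i j l j2 lj /(chart_closureV ch (HS l) (Hc l)); rewrite ts//; [exact: psep|].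
  by apply: (NS i); have [] := pP i j.
Qed.

Lemma scc_loop (J : set V3) : simple_closed_curve J -> exists2 g, loop g & J = g @` I01.
Proof.
move=> [JS [g [cg [g01 [ig JE]]]]]; exists g => //; split=> //; exact/cont_onP.
Qed.

Lemma scc_cpt (J : set V3) : simple_closed_curve J -> compact J.
Proof. by move=> /scc_loop[g Lg ->]; exact: loop_arc_cpt. Qed.

Lemma chart_loop c s t (g : R -> V3) : chart_at c s t -> loop g -> g @` I01 `<=` S2 ->
  ~ (g @` I01) c -> loop (s \o g).
Proof.
move=> ch [cg g01 ig] gS gc; have [cs ct tS st ts] := ch; split.
- apply: (@cont_on_comp _ _ _ _ _ (g @` I01) g s) => //; first exact: (chart_cont ch gS gc).
- by rewrite /= g01.
- move=> a b a01 b01 /= E; apply: ig => //.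
  have Ig u : 0 <= u < 1 -> (g @` I01) (g u).
    by move=> /andP[u0 u1]; exists u => //; rewrite /= in_itv/= u0 ltW.
  by rewrite -(chartK ch gS gc (Ig a a01)) E (chartK ch gS gc (Ig b b01)).
Qed.

(** Projecting from a point [c] of [U] puts [U] around infinity, so the bounded Jordan domain of the
    chart lies on the other side of [J]. *)
Lemma jordan_side (J U : set V3) : simple_closed_curve J -> connected U -> U `<=` S2 ->
  U !=set0 -> U `&` J = set0 ->
  exists V, [/\ sph_open V, connected V, V !=set0, V `&` (U `|` J) = set0 & closure V = V `|` J].
Proof.
move=> scJ cU US [c Uc] UJ; have [JS _] := scJ; have [g Lg JE] := scc_loop scJ.
have Jc : ~ J c by move=> Jc; have : (U `&` J) c by []; rewrite UJ.
have [s [t ch]] := chart_ex (US c Uc); have [cs ct tS st ts] := ch.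
have Lsg : loop (s \o g) by apply: (chart_loop ch Lg); rewrite -JE.
have [V [oV cV [M MV] [v Vv] [VJ clV]]] := jordan_inside Lsg.
have tJ : t @` ((s \o g) @` I01) = J.
  apply/seteqP; split=> [_ [_ [u Iu <-] <-]|z Jz].
    have Ju : J (g u) by rewrite JE; exists u.
    by rewrite /= (chartK ch JS Jc Ju).
  have [u Iu gu] : (g @` I01) z by rewrite -JE.
  exists (s z); last by rewrite (chartK ch JS Jc Jz).
  by exists u => //=; rewrite gu.
have clW : closure (t @` V) = (t @` V) `|` J.
  apply/seteqP; split.
    move=> z; have -> : (t @` V) `|` J = t @` closure V by rewrite clV image_setU tJ.
    have ccl : compact (closure V).
      apply: (@plane_closed_cpt _ _ M); first exact: closed_closure.
      move=> w cw; rewrite leNgt; apply/negP => Mw.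
      have /closure_normP/(_ (`|w| - M))[|y Vy yw] := cw; first by rewrite subr_gt0.
      have := MV y Vy; have := ler_normB y (y - w); rewrite opprB addrC subrK.
      move: yw; clear; lra.
    have := cpt_closed (image_cpt (cont_onS (@subsetT _ _) ct) ccl).
    move=> /closed_normP cl /closure_normP h; apply: cl => e e0.
    by have [_ [y Vy <-] yz] := h e e0; exists (t y) => //; exists y => //; exact: subset_closure.
  move=> z; rewrite -{1}tJ -image_setU -clV => -[y cy <-].
  apply/closure_normP => e e0; have [d d0 dP] := ct y I e e0.
  have /closure_normP/(_ d d0)[x Vx xy] := cy; exists (t x); first by exists x.
  exact: dP.
have WJ z : (t @` V) z -> ~ J z.
  move=> [y Vy <-] Jt; have : (V `&` (s \o g) @` I01) y; last by rewrite VJ.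
  split=> //; have [u Iu gu] : (g @` I01) (t y) by rewrite -JE.
  by exists u => //=; rewrite gu st.
have oW : sph_open (t @` V).
  split; first by move=> _ [y _ <-]; have [] := tS y.
  move=> _ [y Vy <-]; have /open_normP/(_ y Vy)[d d0 dP] := oV.
  have [d' d'0 dP'] := cs (t y) (tS y) d d0; rewrite st in dP'.
  have tyc : 0 < `|c - t y| by rewrite normr_gt0 subr_eq0; apply/eqP => E; have [_] := tS y; rewrite -E; apply.
  exists (Num.min d' `|c - t y|); first by rewrite lt_min d'0.
  move=> z Sz; rewrite lt_min => /andP[zd zc].
  have zc' : z <> c by move=> E; rewrite E ltxx in zc.
  by exists (s z); [apply: dP; exact: dP'|rewrite ts].
exists (t @` V); split=> //.
- by apply: image_conn => //; exact: cont_onS ct.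
- by exists (t v); exists v.
rewrite -subset0 => z [Wz [Uz|/(WJ z Wz)//]].
suff : ~ (t @` V) z by [].
(* [U] avoids the frontier [J] of the domain and contains [c], which the chart omits; being
   connected, it never enters the domain. *)
apply: (@connected_local R _ U (fun z => ~ (t @` V) z) cU _ c z) => //; last first.
  by move=> [y _ yc]; have [_] := tS y; rewrite yc; apply.
move=> x Ux; have [Wx|nWx] := pselect ((t @` V) x).
  have [_ /(_ x Wx)[d d0 dP]] := oW; exists d => // y y' Uy Uy' yx y'x nW.
  by exfalso; apply: nW; apply: dP => //; exact: US.
have ncl : (~` closure (t @` V)) x.
  by rewrite clW => -[//|Jx]; have : (U `&` J) x by []; rewrite UJ.
have oC : open (~` closure (t @` V)) by apply: closed_openC; exact: closed_closure.
have [d d0 dP] := (open_normP _).1 oC x ncl.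
by exists d => // y y' Uy Uy' yx y'x _ /(@subset_closure _ _); exact: dP.
Qed.

(** The chart has to contain both [U] and [J], so its centre is taken in the opposite domain
    provided by [jordan_side]. *)
Lemma scc_side_ulc (J U : set V3) (x : V3) (r : R) : simple_closed_curve J -> connected U -> U `<=` S2 ->
  U !=set0 -> U `&` J = set0 -> J x -> 0 < r ->
  exists2 d : R, 0 < d & forall p q, U p -> U q -> `|p - x| < d -> `|q - x| < d ->
    exists D, [/\ connected D, D p, D q, D `<=` S2 & forall z, D z -> `|z - x| < r /\ ~ J z].
Proof.
move=> scJ cU US U0 UJ Jx r0; have [JS _] := scJ.
have [V [[VS _] cV [c Vc] VUJ _]] := jordan_side scJ cU US U0 UJ.
have Uc : ~ U c by move=> Uc; have : (V `&` (U `|` J)) c; [split=> //; left|rewrite VUJ].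
have Jc : ~ J c by move=> Jc; have : (V `&` (U `|` J)) c; [split=> //; right|rewrite VUJ].
have [s [t ch]] := chart_ex (VS c Vc); have [cs ct tS st ts] := ch.
have [g0 Lg0 JE0] := scc_loop scJ.
have [|g [Lg gx gE]] := @loop_rebase R _ g0 x Lg0; first by rewrite -JE0.
have JE : J = g @` I01 by rewrite gE.
have Lsg : loop (s \o g) by apply: (chart_loop ch Lg); rewrite -JE.
have tsx : t (s x) = x by exact: (chartK ch JS Jc Jx).
have [e e0 eP] := ct (s x) I r r0; rewrite tsx in eP.
have sUJ : (s @` U) `&` ((s \o g) @` I01) = set0.
  rewrite -subset0 => _ [[u Uu <-] [a Ia /= E]].
  have : (U `&` J) u; last by rewrite UJ.
  have Jg : J (g a) by rewrite JE; exists a.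
  by split=> //; rewrite -(chartK ch US Uc Uu) -E (chartK ch JS Jc Jg).
have [d d0 dP] := loop_side_ulc Lsg (chart_conn ch US Uc cU) sUJ e0.
rewrite /= gx in dP.
have Sx : (S2 `\` [set c]) x by split; [exact: JS|move=> /= xc; rewrite xc in Jx].
have [d' d'0 d'P] := cs x Sx d d0; exists d' => // p q Up Uq px qx.
have U' u : U u -> (S2 `\` [set c]) u by move=> Uu; split; [exact: US|move=> /= uc; rewrite uc in Uu].
have sU u : U u -> (s @` U) (s u) by move=> Uu; exists u.
have [D [cD Dp Dq Dr DJ]] := dP (s p) (s q) (sU p Up) (sU q Uq) (d'P _ (U' p Up) px) (d'P _ (U' q Uq) qx).
exists (t @` D); split.
- by apply: image_conn => //; exact: cont_onS ct.
- by exists (s p) => //; exact: (chartK ch US Uc Up).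
- by exists (s q) => //; exact: (chartK ch US Uc Uq).
- by move=> _ [y _ <-]; have [] := tS y.
move=> _ [y Dy <-]; split; first by apply: eP => //; exact: Dr.
rewrite JE => -[a Ia ga]; have : (D `&` (s \o g) @` I01) y; last by rewrite DJ.
by split=> //; exists a => //=; rewrite ga st.
Qed.

End SphereTopology.

(** * Rational maps of the sphere *)

Section ComplexRoots.
Variable R : realType.
Local Notation C := R[i].
Local Notation Re := (@complex.Re R).
Local Notation Im := (@complex.Im R).
Implicit Types (z h : C) (p q : {poly C}).

Lemma normc_ge0 z : 0 <= normc z.
Proof. by case: z => a b; exact: sqrtr_ge0. Qed.

Lemma Re_le_normc z : `|Re z| <= normc z.
Proof.
case: z => a b /=; rewrite -(@ler_pXn2r _ 2)// ?nnegrE ?sqrtr_ge0//.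
by rewrite sqr_sqrtr ?addr_ge0 ?sqr_ge0// real_normK ?num_real// lerDl sqr_ge0.
Qed.

Lemma Im_le_normc z : `|Im z| <= normc z.
Proof.
case: z => a b /=; rewrite -(@ler_pXn2r _ 2)// ?nnegrE ?sqrtr_ge0//.
by rewrite sqr_sqrtr ?addr_ge0 ?sqr_ge0// real_normK ?num_real// lerDr sqr_ge0.
Qed.

(** Multiplying by ['X - h%:P] scales the constant coefficient by [normc h] and the weighted bound
    by at most twice that, because [r <= normc h]; hence one factor 2 per root. *)
Lemma prodXsubC_coef_bound (s : seq C) (r : R) k : 0 < r -> (forall h, h \in s -> r <= normc h) ->
  normc (\prod_(h <- s) ('X - h%:P))`_k * r ^+ k <= 2 ^+ size s * normc (\prod_(h <- s) ('X - h%:P))`_0.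
Proof.
move=> r0; elim: s k => [|h s IHs] k hs.
  rewrite big_nil coefC /=; case: k => [|k]; first by rewrite expr0 mulr1 expr0 mul1r coefC.
  by rewrite normc0 mul0r expr0 mul1r normc_ge0.
have rh : r <= normc h by apply: hs; rewrite mem_head.
have {}IHs k' : normc (\prod_(h <- s) ('X - h%:P))`_k' * r ^+ k' <=
    2 ^+ size s * normc (\prod_(h <- s) ('X - h%:P))`_0.
  by apply: IHs => h' h's; apply: hs; rewrite inE h's orbT.
rewrite big_cons; move: IHs; set Q := \prod_(_ <- s) _ => IHs.
have E0 : (('X - h%:P) * Q)`_0 = - (h * Q`_0) by rewrite mulrBl coefB coefXM coefCM sub0r.
rewrite E0 normcN normcM.
have h0 : 0 <= normc h by exact: normc_ge0.
have Q0 : 0 <= 2 ^+ size s * normc Q`_0 by rewrite mulr_ge0 ?exprn_ge0 ?normc_ge0.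
have T1 : normc (h * Q`_k) * r ^+ k <= normc h * (2 ^+ size s * normc Q`_0).
  by rewrite normcM -mulrA ler_wpM2l.
have T2 : normc ('X * Q)`_k * r ^+ k <= normc h * (2 ^+ size s * normc Q`_0).
  case: k {T1} => [|k].
    have -> : ('X * Q)`_0 = 0 by rewrite coefXM.
    by rewrite normc0 mul0r mulr_ge0.
  have -> : ('X * Q)`_k.+1 = Q`_k by rewrite coefXM.
  rewrite exprS mulrCA; apply: ler_pM => //; first exact: ltW.
  by rewrite mulr_ge0 ?normc_ge0 ?exprn_ge0// ltW.
rewrite mulrBl coefB coefCM.
apply: (@le_trans _ _ ((normc ('X * Q)`_k + normc (h * Q`_k)) * r ^+ k)).
  rewrite ler_wpM2r ?exprn_ge0 ?(ltW r0)//.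
  by apply: le_trans (le_normcD _ _) _; rewrite normcN.
rewrite mulrDl exprS; apply: le_trans (lerD T2 T1) _.
rewrite [leRHS](_ : _ = normc h * (2 ^+ size s * normc Q`_0) + normc h * (2 ^+ size s * normc Q`_0))//.
move: (2 ^+ size s) (normc h) (normc Q`_0) => a b c; ring.
Qed.

(** Quantitative continuity of roots: if all roots had modulus at least [r], the bound of
    [prodXsubC_coef_bound] would fail. *)
Lemma root_near_zero (g : {poly C}) (r : R) k : 0 < r ->
  2 ^+ size g * normc g`_0 < normc g`_k * r ^+ k -> exists2 h, root g h & normc h < r.
Proof.
move=> r0 gk; have [s gE] := closed_field_poly_normal g.
have g0 : g != 0.
  apply/eqP => g0; move: gk; rewrite g0 !coef0 normc0 mul0r mulr0 ltxx//.
have l0 : lead_coef g != 0 by rewrite lead_coef_eq0.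
apply: contrapT => H.
have hs h : h \in s -> r <= normc h.
  move=> hs; rewrite leNgt; apply/negP => hr; apply: H; exists h => //.
  by rewrite gE rootZ// root_prod_XsubC.
have := prodXsubC_coef_bound k r0 hs; move: gk.
rewrite {2 3}gE !coefZ !normcM -mulrA [X in X < _]mulrCA => gk bd.
have nl : 0 < normc (lead_coef g).
  by rewrite lt_neqAle normc_ge0 andbT eq_sym; apply: contraNN l0 => /eqP/eq0_normc ->.
move: gk; rewrite ltr_pM2l// => /lt_le_trans/(_ bd).
have sg : size g = (size s).+1 by rewrite gE size_scale// size_prod_XsubC.
apply/negP; rewrite -leNgt ler_wpM2r ?normc_ge0// sg ler_eXn2l ?ltr1n//.
Qed.

Definition ccont (W : normedModType R) (A : set W) (F : W -> C) :=
  cont_on A (fun x => Re (F x)) /\ cont_on A (fun x => Im (F x)).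

Lemma ccont_cst (W : normedModType R) (A : set W) c : ccont A (fun=> c).
Proof. by split; exact: cont_on_cst. Qed.

Lemma ccontD (W : normedModType R) (A : set W) F G : ccont A F -> ccont A G -> ccont A (fun x : W => F x + G x).
Proof.
move=> [F1 F2] [G1 G2]; split.
  by apply: cont_on_eq (cont_onD F1 G1) => x _; case: (F x) (G x) => ? ? [].
by apply: cont_on_eq (cont_onD F2 G2) => x _; case: (F x) (G x) => ? ? [].
Qed.

Lemma ccontM (W : normedModType R) (A : set W) F G : ccont A F -> ccont A G -> ccont A (fun x : W => F x * G x).
Proof.
move=> [F1 F2] [G1 G2]; split.
  by apply: cont_on_eq (cont_onB (cont_onM F1 G1) (cont_onM F2 G2)) => x _; case: (F x) (G x) => ? ? [].
by apply: cont_on_eq (cont_onD (cont_onM F1 G2) (cont_onM F2 G1)) => x _; case: (F x) (G x) => ? ? [].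
Qed.

Lemma ccontN (W : normedModType R) (A : set W) F : ccont A F -> ccont A (fun x : W => - F x).
Proof.
move=> [F1 F2]; split.
  by apply: cont_on_eq (cont_onN F1) => x _; case: (F x).
by apply: cont_on_eq (cont_onN F2) => x _; case: (F x).
Qed.

Lemma ccont_poly (W : normedModType R) (A : set W) F p : ccont A F -> ccont A (fun x : W => p.[F x]).
Proof.
move=> cF; elim/poly_ind: p => [|p c IHp].
  have := ccont_cst A (0 : C) => -[a b]; split.
    by apply: cont_on_eq a => x _; rewrite horner0.
  by apply: cont_on_eq b => x _; rewrite horner0.
have [a b] := ccontD (ccontM IHp cF) (ccont_cst A c); split.
  by apply: cont_on_eq a => x _; rewrite hornerMXaddC.
by apply: cont_on_eq b => x _; rewrite hornerMXaddC.
Qed.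

Lemma ccont_normc (W : normedModType R) (A : set W) F : ccont A F -> cont_on A (fun x : W => normc (F x)).
Proof.
move=> [F1 F2]; apply: (cont_on_eq (f := fun x => Num.sqrt (Re (F x) * Re (F x) + Im (F x) * Im (F x)))).
  by move=> x _; case: (F x) => a b /=; rewrite !expr2.
apply: (@cont_on_compT R W R R A (fun x => Re (F x) * Re (F x) + Im (F x) * Im (F x)) (@Num.sqrt R)); last exact: sqrt_continuous.
by apply: cont_onD; exact: cont_onM.
Qed.

(** The source of openness: solutions of [p / q = y1 / y2] persist when the target moves. Translated
    by [z], the polynomial has zero constant and nonzero leading coefficient at [x], so
    [root_near_zero] applies nearby. *)
Lemma pencil_root (W : normedModType R) (A : set W) (x : W) (y1 y2 : W -> C) p q z (e : R) :
  A x -> ccont A y1 -> ccont A y2 -> y2 x * p.[z] = y1 x * q.[z] ->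
  y2 x *: p - y1 x *: q != 0 -> 0 < e ->
  exists2 d : R, 0 < d & forall x', A x' -> `|x' - x| < d ->
    exists2 z', normc (z' - z) < e & y2 x' * p.[z'] = y1 x' * q.[z'].
Proof.
move=> Ax c1 c2 E n0 e0.
pose P := p \Po ('X + z%:P); pose Q := q \Po ('X + z%:P).
pose g x' := y2 x' *: P - y1 x' *: Q.
have gE x' : g x' = (y2 x' *: p - y1 x' *: q) \Po ('X + z%:P).
  by rewrite /g /P /Q raddfB /= !comp_polyZ.
have gx0 : g x != 0.
  by rewrite gE -size_poly_eq0 size_comp_poly2 ?size_poly_eq0// size_XaddC.
pose k := (size (g x)).-1.
have gk : 0 < normc (g x)`_k.
  rewrite lt_neqAle normc_ge0 andbT eq_sym; apply/eqP => /eq0_normc /eqP.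
  by apply/negP; rewrite -/(lead_coef (g x)) lead_coef_eq0.
have g00 : (g x)`_0 = 0.
  by rewrite -horner_coef0 gE horner_comp !hornerE E subrr.
(* The degree of [g x'] may jump near [x], so the power of 2 uses a size bound common to all
   [x']. *)
pose n := maxn (size P) (size Q).
have sg x' : (size (g x') <= n)%N.
  apply: leq_trans (size_polyD _ _) _; rewrite size_polyN geq_max.
  by rewrite (leq_trans (size_scale_leq _ _) (leq_maxl _ _)) (leq_trans (size_scale_leq _ _) (leq_maxr _ _)).
have cg j : cont_on A (fun x' => normc (g x')`_j).
  apply: ccont_normc; have [a b] := ccontD (ccontM c2 (ccont_cst A P`_j)) (ccontN (ccontM c1 (ccont_cst A Q`_j))).
  by split; [apply: cont_on_eq a|apply: cont_on_eq b] => x' _; rewrite /g coefB !coefZ.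
have ek : 0 < e ^+ k by rewrite exprn_gt0.
have c0 : 0 < normc (g x)`_k / 2 * e ^+ k / 2 ^+ n by rewrite !(mulr_gt0, divr_gt0, exprn_gt0).
have [d1 d10 dP1] := cg 0%N x Ax _ c0.
have [|d2 d20 dP2] := cg k x Ax (normc (g x)`_k / 2); first by rewrite divr_gt0.
exists (Num.min d1 d2); first by rewrite lt_min d10.
move=> x' Ax'; rewrite lt_min => /andP[xd1 xd2].
have h1 := dP1 x' Ax' xd1; have h2 := dP2 x' Ax' xd2.
rewrite g00 normc0 subr0 ger0_norm ?normc_ge0// in h1.
have h3 : normc (g x)`_k / 2 < normc (g x')`_k.
  have := ler_norm (normc (g x)`_k - normc (g x')`_k); rewrite distrC.
  move: h2; move: (normc (g x)`_k) (normc (g x')`_k) `|_| => a b c; clear; lra.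
have [|h hr he] := @root_near_zero (g x') e k e0.
  apply: (@le_lt_trans _ _ (2 ^+ n * normc (g x')`_0)).
    by rewrite ler_wpM2r ?normc_ge0// ler_eXn2l// ltr1n.
  rewrite ltr_pdivlMr ?exprn_gt0// mulrC in h1; apply: (lt_trans h1).
  by rewrite ltr_pM2r.
exists (h + z); first by rewrite addrK.
move: hr; rewrite /root gE horner_comp !hornerE subr_eq0 => /eqP; exact.
Qed.

End ComplexRoots.

(** * Homogeneous coordinates: continuity, openness and finite fibres *)

Section RationalMaps.
Variable R : realType.
Local Notation C := R[i].
Local Notation V3 := 'rV[R]_3.
Local Notation plane := (R * R)%type.
Local Notation S2 := (@S2 R).
Local Notation Re := (@complex.Re R).
Local Notation Im := (@complex.Im R).
Implicit Types (a b c z : C) (p q : {poly C}).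

Definition hopf_den a b := Re a ^+ 2 + Im a ^+ 2 + Re b ^+ 2 + Im b ^+ 2.

(* The map C^2 \ 0 -> S^2 taking homogeneous coordinates [a : b] to the point of
   the sphere with stereographic coordinate a / b. *)
Definition hopf a b : V3 := let d := hopf_den a b in
  vec3 (2 * (Re a * Re b + Im a * Im b) / d) (2 * (Im a * Re b - Re a * Im b) / d)
    ((Re a ^+ 2 + Im a ^+ 2 - Re b ^+ 2 - Im b ^+ 2) / d).

Definition nz2 a b := ~ (a = 0 /\ b = 0).

Lemma hopf_den_gt0 a b : nz2 a b -> 0 < hopf_den a b.
Proof.
move=> nz; have h : 0 <= hopf_den a b by rewrite /hopf_den !addr_ge0 ?sqr_ge0.
rewrite lt_neqAle h andbT eq_sym; apply/eqP => E; apply: nz; move: E.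
rewrite /hopf_den; case: a b {h} => [x y] [u v] /= E.
have x0 := sqr_ge0 x; have y0 := sqr_ge0 y; have u0 := sqr_ge0 u; have v0 := sqr_ge0 v.
have z (w : R) : 0 <= w ^+ 2 -> w ^+ 2 <= 0 -> w = 0.
  by move=> w0 w1; apply/eqP; rewrite -sqrf_eq0 eq_le w1 w0.
have [hx hy hu hv] : [/\ x ^+ 2 <= 0, y ^+ 2 <= 0, u ^+ 2 <= 0 & v ^+ 2 <= 0].
  move: (x ^+ 2) (y ^+ 2) (u ^+ 2) (v ^+ 2) E x0 y0 u0 v0; clear => X Y U V E x0 y0 u0 v0.
  by split; lra.
by rewrite (z x x0 hx) (z y y0 hy) (z u u0 hu) (z v v0 hv).
Qed.

Lemma hopf_S2 a b : nz2 a b -> S2 (hopf a b).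
Proof.
move=> /hopf_den_gt0 d0; rewrite /S2 /= /hopf !vec3E; move: d0; rewrite /hopf_den.
by case: a b => [x y] [u v] /= d0; field; rewrite gt_eqF.
Qed.

Lemma hopf_scale c a b : c != 0 -> nz2 a b -> hopf (c * a) (c * b) = hopf a b.
Proof.
move=> c0 nz; have d0 := hopf_den_gt0 nz.
have c0' : 0 < Re c ^+ 2 + Im c ^+ 2.
  have : nz2 c 0 by move=> [c00 _]; rewrite c00 eqxx in c0.
  by move=> /hopf_den_gt0; rewrite /hopf_den /= expr0n !addr0.
have E : hopf_den (c * a) (c * b) = (Re c ^+ 2 + Im c ^+ 2) * hopf_den a b.
  by rewrite /hopf_den; case: a b c {nz d0 c0 c0'} => [x y] [u v] [s t] /=; ring.
have dn := lt0r_neq0 d0; have cn := lt0r_neq0 c0'.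
rewrite /hopf E; move: (hopf_den a b) dn cn => d; case: a b c {nz d0 c0 c0' E} => [x y] [u v] [s t] /= dn cn.
by apply: eq_vec3; rewrite !vec3E; field; rewrite dn cn.
Qed.

Lemma hopf_proportional a b a' b' : nz2 a b -> nz2 a' b' -> b' * a = a' * b -> hopf a b = hopf a' b'.
Proof.
move=> nz nz' E; have [a0|a0] := eqVneq a' 0.
  have b0 : b' != 0 by apply/eqP => b0; apply: nz'.
  have aa : a = 0 by apply: (mulfI b0); rewrite E a0 mul0r mulr0.
  have bn : b != 0 by apply/eqP => b0'; apply: nz.
  have -> : a = b / b' * a' by rewrite aa a0 mulr0.
  by rewrite -{2}(divfK b0 b) hopf_scale// mulf_neq0 ?invr_eq0.
have bE : b = a / a' * b' by rewrite mulrAC [a * _]mulrC E mulrAC divff// mul1r.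
have an : a != 0.
  by apply/eqP => aa; apply: nz; split=> //; rewrite bE aa !mul0r.
by rewrite bE -{1}(divfK a0 a) hopf_scale// mulf_neq0 ?invr_eq0.
Qed.

Lemma hopf_inj a b a' b' : nz2 a b -> nz2 a' b' -> hopf a b = hopf a' b' -> b' * a = a' * b.
Proof.
move=> nz nz' E; have d0 := lt0r_neq0 (hopf_den_gt0 nz); have d0' := lt0r_neq0 (hopf_den_gt0 nz').
have S1 := hopf_S2 nz; have S1' := hopf_S2 nz'.
(* Squared modulus of the determinant in terms of the inner product of the two unit vectors; equal
   vectors have inner product 1, so the determinant vanishes. *)
have D0 : S2 (hopf a b) -> hopf_den (b' * a - a' * b) 0 = hopf_den a b * hopf_den a' b' / 2 *
  (1 - (hopf a b ord0 i0 * hopf a' b' ord0 i0 + hopf a b ord0 i1 * hopf a' b' ord0 i1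
       + hopf a b ord0 i2 * hopf a' b' ord0 i2)).
  move=> _; rewrite /hopf !vec3E; move: d0 d0'; rewrite /hopf_den.
  case: a b a' b' {nz nz' E S1 S1'} => [x y] [u v] [x' y'] [u' v'] /= d0 d0'.
  by field; rewrite d0 d0'.
apply/eqP; rewrite -subr_eq0; apply/eqP; apply: contrapT => nE.
have /hopf_den_gt0 : nz2 (b' * a - a' * b) 0 by move=> [].
rewrite (D0 S1) E; move: S1'; rewrite /S2 /= !expr2 => ->.
by rewrite subrr mulr0 ltxx.
Qed.

(** Homogeneous coordinates admit no global continuous choice on the sphere. Each of the two
    formulas degenerates at one pole only, and the sign of the last coordinate of [x] selects the
    one that is safe near [x]. *)
Lemma hopf_section (x : V3) : S2 x -> exists y1 y2 : V3 -> C, [/\ ccont setT y1, ccont setT y2 &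
  exists2 d : R, 0 < d & forall x', S2 x' -> `|x' - x| < d -> nz2 (y1 x') (y2 x') /\ hopf (y1 x') (y2 x') = x'].
Proof.
move=> Sx.
have cc i : cont_on setT (fun v : V3 => v ord0 i) by apply: cont_on_coord; exact: cont_on_id.
have [x2|x2] := leP 0 (x ord0 i2).
  exists (fun v => Complex (1 + v ord0 i2) 0), (fun v => Complex (v ord0 i0) (- v ord0 i1)); split.
  - by split; [apply: (cont_onD _ (cc i2)); exact: cont_on_cst|exact: cont_on_cst].
  - by split; [exact: (cc i0)|exact: (cont_onN (cc i1))].
  exists 1 => // v Sv vx.
  have c0 : 1 + v ord0 i2 != 0.
    have := coord_le (v - x) i2; rewrite !mxE => h.
    have := ler_norm (- (v ord0 i2 - x ord0 i2)); rewrite normrN.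
    move: h vx x2; move: `|v - x| `|_ - _| => s t h1 h2 h3 h4; apply: lt0r_neq0; move: h1 h2 h3 h4; clear; lra.
  split; first by move=> [[/eqP]]; rewrite (negPf c0).
  have E : hopf_den (Complex (1 + v ord0 i2) 0) (Complex (v ord0 i0) (- v ord0 i1)) = 2 * (1 + v ord0 i2).
    move: Sv; rewrite /S2 /hopf_den /= sqrrN expr0n addr0 => Sv.
    by rewrite -addrA -[_ ^+ 2 + _ ^+ 2](addrK (v ord0 i2 ^+ 2)) Sv; ring.
  have E2 : v ord0 i0 ^+ 2 = 1 - v ord0 i1 ^+ 2 - v ord0 i2 ^+ 2.
    by move: Sv; rewrite /S2 /=; clear; lra.
  by apply: eq_vec3; rewrite /hopf E !vec3E /= ?E2; field.
exists (fun v => Complex (v ord0 i0) (v ord0 i1)), (fun v => Complex (1 - v ord0 i2) 0); split.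
- by split; [exact: (cc i0)|exact: (cc i1)].
- by split; [apply: (cont_onB _ (cc i2)); exact: cont_on_cst|exact: cont_on_cst].
exists 1 => // v Sv vx.
have c0 : 1 - v ord0 i2 != 0.
  have := coord_le (v - x) i2; rewrite !mxE => h.
  have := ler_norm (v ord0 i2 - x ord0 i2).
  move: h vx x2; move: `|v - x| `|_ - _| => s t h1 h2 h3 h4; apply: lt0r_neq0; move: h1 h2 h3 h4; clear; lra.
split; first by move=> [_ [/eqP]]; rewrite (negPf c0).
have E2 : v ord0 i0 ^+ 2 = 1 - v ord0 i1 ^+ 2 - v ord0 i2 ^+ 2.
  by move: Sv; rewrite /S2 /=; clear; lra.
have E : hopf_den (Complex (v ord0 i0) (v ord0 i1)) (Complex (1 - v ord0 i2) 0) = 2 * (1 - v ord0 i2).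
  by rewrite /hopf_den /= E2; ring.
by apply: eq_vec3; rewrite /hopf E !vec3E /= ?E2; field.
Qed.

Section Pencil.
Variables p q : {poly C}.
Hypothesis nz : forall z, nz2 p.[z] q.[z].
Hypothesis pencil : forall a b, nz2 a b -> b *: p - a *: q != 0.

Definition toC (w : plane) : C := Complex w.1 w.2.
Definition hopf_pq (w : plane) := hopf p.[toC w] q.[toC w].

Lemma hopf_pq_cont : cont_on setT hopf_pq.
Proof.
have ct : ccont setT toC.
  by split; [apply: cont_on_fst|apply: cont_on_snd]; exact: cont_on_id.
have [p1 p2] := ccont_poly p ct; have [q1 q2] := ccont_poly q ct.
have sq (f : plane -> R) : cont_on setT f -> cont_on setT (fun w => f w ^+ 2).
  by move=> cf; apply: cont_on_eq (cont_onM cf cf) => w _; rewrite expr2.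
have cd : cont_on setT (fun w => (hopf_den p.[toC w] q.[toC w])^-1).
  apply: cont_onV; last by move=> w _; apply: lt0r_neq0; exact: hopf_den_gt0.
  by apply: cont_onD; [apply: cont_onD; [apply: cont_onD|]|]; exact: sq.
apply: cont_on_vec3; apply: cont_onM => //.
- by apply: cont_onM; [exact: cont_on_cst|apply: cont_onD; exact: cont_onM].
- by apply: cont_onM; [exact: cont_on_cst|apply: cont_onB; exact: cont_onM].
- by apply: cont_onB; [apply: cont_onB; [apply: cont_onD|]|]; exact: sq.
Qed.

Lemma hopf_pq_open (w : plane) (e : R) : 0 < e -> exists2 d : R, 0 < d &
  forall x, S2 x -> `|x - hopf_pq w| < d -> exists2 w', `|w' - w| < e & hopf_pq w' = x.
Proof.
move=> e0; pose x0 := hopf_pq w.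
have Sx0 : S2 x0 by exact: hopf_S2.
have [y1 [y2 [c1 c2 [d d0 dP]]]] := hopf_section Sx0.
have [|n0 h0] := dP x0 Sx0; first by rewrite subrr normr0.
have E : y2 x0 * p.[toC w] = y1 x0 * q.[toC w] by apply: hopf_inj => //; rewrite h0.
have [d' d'0 d'P] := pencil_root (A := setT) I c1 c2 E (pencil n0) e0.
exists (Num.min d d'); first by rewrite lt_min d0.
move=> x Sx; rewrite lt_min => /andP[xd xd'].
have [z zw Ez] := d'P x I xd'; have [nx hx] := dP x Sx xd.
exists (Re z, Im z).
  rewrite pair_norm_lt /=; have rw := Re_le_normc (z - toC w); have iw := Im_le_normc (z - toC w).
  have -> : Re z - w.1 = Re (z - toC w) by case: (z).
  have -> : Im z - w.2 = Im (z - toC w) by case: (z).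
  by rewrite (le_lt_trans rw zw) (le_lt_trans iw zw).
have -> : hopf_pq (Re z, Im z) = hopf p.[z] q.[z] by rewrite /hopf_pq /toC; case: (z).
by rewrite -hx; exact: hopf_proportional.
Qed.

Lemma hopf_pq_fin (x : V3) : S2 x -> finite_set [set w | hopf_pq w = x].
Proof.
move=> Sx; have [y1 [y2 [_ _ [d d0 dP]]]] := hopf_section Sx.
have [|n0 h0] := dP x Sx; first by rewrite subrr normr0.
have [s gE] := closed_field_poly_normal (y2 x *: p - y1 x *: q).
have g0 := pencil n0.
apply: (@sub_finite_set _ _ [set` [seq (Re z, Im z) | z <- s]]); last exact: finite_seq.
move=> w /= hw; have E : y2 x * p.[toC w] = y1 x * q.[toC w] by apply: hopf_inj => //; rewrite -/(hopf_pq w) hw h0.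
have : root (y2 x *: p - y1 x *: q) (toC w) by rewrite /root !hornerE E subrr.
rewrite gE rootZ ?lead_coef_eq0// root_prod_XsubC => ws.
by apply/mapP; exists (toC w) => //; case: (w).
Qed.

End Pencil.

Section Chart.
Variables (cc : V3) (s : V3 -> plane) (t : plane -> V3) (f : V3 -> V3) (p q : {poly C}).
Hypothesis ch : chart_at cc s t.
Hypothesis nz : forall z, nz2 p.[z] q.[z].
Hypothesis pencil : forall a b, nz2 a b -> b *: p - a *: q != 0.
Hypothesis ft : forall w, f (t w) = hopf_pq p q w.

Lemma chart_map_S2 u : S2 u -> u <> cc -> S2 (f u).
Proof. by move=> Su uc; have [_ _ _ _ ts] := ch; rewrite -(ts u Su uc) ft; exact: hopf_S2. Qed.

Lemma chart_map_cont u (e : R) : S2 u -> u <> cc -> 0 < e ->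
  exists2 d : R, 0 < d & forall v, S2 v -> `|v - u| < d -> `|f v - f u| < e.
Proof.
move=> Su uc e0; have [cs ct tS st ts] := ch.
have [d d0 dP] := hopf_pq_cont nz (x := s u) I e0.
have [d' d'0 d'P] := cs u (conj Su uc) d d0.
have uc0 : 0 < `|cc - u| by rewrite normr_gt0 subr_eq0; apply/eqP => E; apply: uc.
exists (Num.min d' `|cc - u|); first by rewrite lt_min d'0.
move=> v Sv; rewrite lt_min => /andP[vd vc].
have vc' : v <> cc by move=> E; rewrite E ltxx in vc.
by rewrite -(ts u Su uc) -(ts v Sv vc') !ft; apply: dP => //; exact: d'P.
Qed.

Lemma chart_map_open u (e : R) : S2 u -> u <> cc -> 0 < e ->
  exists2 d : R, 0 < d & forall x, S2 x -> `|x - f u| < d -> exists v, [/\ S2 v, `|v - u| < e & f v = x].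
Proof.
move=> Su uc e0; have [cs ct tS st ts] := ch.
have [d d0 dP] := ct (s u) I e e0; rewrite (ts u Su uc) in dP.
have [d' d'0 d'P] := hopf_pq_open nz pencil (s u) d0.
exists d' => // x Sx xu; have [|w wd wx] := d'P x Sx; first by rewrite -ft (ts u Su uc).
by exists (t w); split; [have [] := tS w|exact: dP|rewrite ft].
Qed.

Lemma chart_map_fin x : S2 x -> finite_set [set u | S2 u /\ f u = x].
Proof.
move=> Sx; have [cs ct tS st ts] := ch.
apply: (@sub_finite_set _ _ (t @` [set w | hopf_pq p q w = x] `|` [set cc])); last first.
  by rewrite finite_setU; split; [apply: finite_image; exact: hopf_pq_fin|exact: finite_set1].
move=> u [Su fu]; have [->|uc] := pselect (u = cc); [by right|left].
by exists (s u); rewrite ?ts//= -ft ts.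
Qed.

End Chart.

End RationalMaps.

(** * A rational map in the charts at the two poles *)

Section RatS2.
Variable R : realType.
Local Notation C := R[i].
Local Notation V3 := 'rV[R]_3.
Local Notation plane := (R * R)%type.
Local Notation S2 := (@S2 R).
Local Notation Re := (@complex.Re R).
Local Notation Im := (@complex.Im R).

Definition nice_map (f : V3 -> V3) := [/\ forall u, S2 u -> S2 (f u), cont_on S2 f,
  forall u (e : R), S2 u -> 0 < e -> exists2 d : R, 0 < d &
    forall x, S2 x -> `|x - f u| < d -> exists v, [/\ S2 v, `|v - u| < e & f v = x] &
  forall x, S2 x -> finite_set [set u | S2 u /\ f u = x]].

(** The half turn about the first axis, which is [z |-> 1 / z] in the stereographic coordinate. *)
Definition flip (v : V3) := vec3 (v ord0 i0) (- v ord0 i1) (- v ord0 i2).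

Lemma flipK v : flip (flip v) = v.
Proof. by apply: eq_vec3; rewrite /flip !vec3E ?opprK. Qed.

Lemma flip_S2 v : S2 v -> S2 (flip v).
Proof. by rewrite /S2 /= /flip !vec3E !sqrrN. Qed.

Lemma flip_cont : cont_on setT flip.
Proof.
have c i : cont_on setT (fun v : V3 => v ord0 i) by apply: cont_on_coord; exact: cont_on_id.
by apply: cont_on_vec3 => //; exact: cont_onN.
Qed.

Lemma chart_north : chart_at (north R) (@sproj R) (@sinv R).
Proof.
split; [exact: sproj_cont|exact: sinv_cont| |exact: sinvK|exact: sprojK].
move=> p; split; first exact: sinv_S2.
move=> /= E; have := congr1 (fun v : V3 => v ord0 i2) E.
rewrite /north /sinv !vec3E; have d0 := sinv_den p.
move=> /(canRL (divfK (lt0r_neq0 d0))); rewrite mul1r; clear; lra.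
Qed.

Lemma chart_south : chart_at (flip (north R)) (fun v => sproj (flip v)) (fun w => flip (@sinv R w)).
Proof.
have [cs ct tS st ts] := chart_north; split.
- apply: (cont_on_comp (B := S2 `\` [set north R])) cs _; first exact: cont_onS flip_cont.
  move=> v [Sv nv]; split; first exact: flip_S2.
  by move=> /= E; apply: nv; rewrite /= -E flipK.
- exact: (cont_on_comp (B := setT) ct flip_cont).
- move=> w; have [Sw nw] := tS w; split; first exact: flip_S2.
  by move=> /= E; apply: nw; rewrite /= -(flipK (sinv w)) E flipK.
- by move=> w; rewrite flipK st.
- move=> v Sv nv; rewrite ts ?flipK//; first exact: flip_S2.
  by move=> E; apply: nv; rewrite -E flipK.
Qed.

Lemma stereo_invE (z : C) : stereo_inv (Some z) = hopf z 1.
Proof.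
rewrite /stereo_inv /hopf /hopf_den; case: z => x y /=.
by apply: eq_vec3; rewrite !mxE /= expr1n expr0n addr0 ?mulr1 ?mulr0 ?addr0 ?subr0.
Qed.

Lemma stereo_inv_inf (a : C) : a != 0 -> stereo_inv None = hopf a 0.
Proof.
move=> a0; have nz : nz2 a (0 : C) by move=> [E _]; rewrite E eqxx in a0.
have := hopf_den_gt0 nz; rewrite /hopf /hopf_den; case: a {a0 nz} => x y /= d0.
rewrite expr0n !addr0 in d0; apply: eq_vec3; rewrite !mxE /= ?expr0n ?mulr0 ?addr0 ?subr0 ?mulr0 ?mul0r//.
by rewrite divff// gt_eqF.
Qed.

Lemma hopf_div (a b : C) : nz2 a b -> stereo_inv (if b != 0 then Some (a / b) else None) = hopf a b.
Proof.
move=> nz; case: ifPn => [b0|/negPn/eqP b0].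
  rewrite stereo_invE; apply: hopf_proportional => //.
    by move=> [_ /eqP]; rewrite oner_eq0.
  by rewrite mulrCA divff //.
have a0 : a != 0 by apply/eqP => a0; apply: nz.
by rewrite b0 (stereo_inv_inf a0).
Qed.

Variables p q : {poly C}.
Hypothesis rat : is_rational_of_degree_ge2 p q.
Let n := rat_degree p q.
Local Notation f := (rat_S2 p q).

Let copq : coprimep p q. Proof. by case: rat. Qed.
Let n2 : (2 <= n)%N. Proof. by case: rat. Qed.
Let maxE : maxn (size p) (size q) = n.+1.
Proof. by move: n2; rewrite /n /rat_degree; case: (maxn _ _). Qed.
Let sp : (size p <= n.+1)%N. Proof. by rewrite -maxE leq_maxl. Qed.
Let sq : (size q <= n.+1)%N. Proof. by rewrite -maxE leq_maxr. Qed.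

Lemma rat_nz (z : C) : nz2 p.[z] q.[z].
Proof.
move=> [pz qz]; have rp : root p z by rewrite /root pz.
by have := coprimep_root copq rp; rewrite qz eqxx.
Qed.

(** A vanishing member would make [p] and [q] proportional; being coprime they would be constant,
    which the degree forbids. *)
Lemma rat_pencil (a b : C) : nz2 a b -> b *: p - a *: q != 0.
Proof.
move=> nz; apply/eqP => /eqP; rewrite subr_eq0 => /eqP E.
have [a0|a0] := eqVneq a 0.
  have b0 : b != 0 by apply/eqP => b0; apply: nz.
  have p0 : p = 0 by move: E; rewrite a0 scale0r => /eqP; rewrite scaler_eq0 (negPf b0) => /eqP.
  move: copq maxE n2; rewrite p0 coprime0p size_poly0 max0n => /eqp_size.
  by rewrite size_poly1 => -> [<-].
have [b0|b0] := eqVneq b 0.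
  have q0 : q = 0 by move: E; rewrite b0 scale0r => /esym/eqP; rewrite scaler_eq0 (negPf a0) => /eqP.
  move: copq maxE n2; rewrite q0 coprimep0 size_poly0 maxn0 => /eqp_size.
  by rewrite size_poly1 => -> [<-].
have pq : p %= q.
  by rewrite -(eqp_ltrans (eqp_scale p b0)) E eqp_scale.
have s1 : size p = 1%N.
  by move: copq; rewrite (eqp_coprimepl _ pq) coprimepp -(eqp_size pq) => /eqP.
move: maxE n2; rewrite -(eqp_size pq) maxnn s1 => -[<-]; by [].
Qed.

(** Reversal with respect to the degree [n] of the map rather than of [g], so that the reversed pair
    represents the map in the coordinate [1 / z]. *)
Definition rev_poly (g : {poly C}) := \poly_(i < n.+1) g`_(n - i).

Lemma rev_polyE (g : {poly C}) (z : C) : (size g <= n.+1)%N -> z != 0 -> (rev_poly g).[z] = z ^+ n * g.[z^-1].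
Proof.
move=> sg z0; rewrite horner_poly (horner_coef_wide _ sg) mulr_sumr.
rewrite (reindex_inj rev_ord_inj) /=; apply: eq_bigr => i _.
rewrite subSS subKn -1?ltnS// mulrCA; congr (_ * _).
by rewrite exprVn exprB ?unitfE // -ltnS.
Qed.

Lemma rev_poly0 (g : {poly C}) : (rev_poly g).[0] = g`_n.
Proof. by rewrite horner_coef0 coef_poly subn0. Qed.

Lemma rev_nz (z : C) : nz2 (rev_poly p).[z] (rev_poly q).[z].
Proof.
have [->|z0] := eqVneq z 0.
  rewrite !rev_poly0 => -[pn qn].
  have h (g : {poly C}) : (size g <= n.+1)%N -> g`_n = 0 -> (size g <= n)%N.
    move=> sg gn; rewrite leqNgt; apply/negP => ng.
    have sE : size g = n.+1 by apply/eqP; rewrite eqn_leq sg.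
    have : lead_coef g = 0 by rewrite /lead_coef sE.
    by move=> /eqP; rewrite lead_coef_eq0 => /eqP g0; rewrite g0 size_poly0 in sE.
  have := maxE; move: (h _ sp pn) (h _ sq qn) => h1 h2 E.
  by have : (maxn (size p) (size q) <= n)%N; [rewrite geq_max h1|rewrite E ltnn].
rewrite !rev_polyE// => -[/eqP + /eqP]; rewrite !mulf_eq0 !expf_eq0 (negPf z0) !andbF /=.
by move=> /eqP pz /eqP qz; exact: (rat_nz (conj pz qz)).
Qed.

Lemma rev_pencil (a b : C) : nz2 a b -> b *: rev_poly p - a *: rev_poly q != 0.
Proof.
move=> /rat_pencil; apply: contra_neq => E; apply/polyP => i; rewrite coef0.
have [ni|ni] := ltnP n i.
  by rewrite coefB !coefZ !nth_default ?mulr0 ?subrr// (leq_trans _ ni).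
have := congr1 (fun g : {poly C} => g`_(n - i)) E.
by rewrite coef0 !coefB !coefZ !coef_poly ltnS leq_subr subKn.
Qed.

Lemma rat_north (w : plane) : f (sinv w) = hopf_pq p q w.
Proof.
rewrite /rat_S2.
have -> : stereo (sinv w) = Some (toC w).
  have [_ _ tS st _] := chart_north; have := st w; rewrite /sproj /stereo => E.
  case: ifPn => [/eqP E2|_]; first by exfalso; have [Sw] := tS w; apply; exact: S2_north.
  by congr Some; rewrite /toC; congr Complex; [exact: (congr1 fst E)|exact: (congr1 snd E)].
by rewrite /= hopf_div//; exact: rat_nz.
Qed.

Lemma rat_south (w : plane) : f (flip (sinv w)) = hopf_pq (rev_poly p) (rev_poly q) w.
Proof.
rewrite /hopf_pq; have [w0|w0] := eqVneq (toC w) 0.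
  have -> : flip (sinv w) = north R.
    have w1 : w.1 = 0 by have := congr1 Re w0.
    have w2 : w.2 = 0 by have := congr1 Im w0.
    apply: eq_vec3; rewrite /flip /sinv /north !vec3E w1 w2 expr0n ?mulr0 ?mul0r ?oppr0//.
    by rewrite !add0r divr1 opprB -[2]/(1 + 1) addrK.
  rewrite /rat_S2 /stereo /north !vec3E eqxx /= w0 !rev_poly0.
  have lc (g : {poly C}) : size g = n.+1 -> g`_n = lead_coef g by rewrite /lead_coef => ->.
  have lc0 (g : {poly C}) : size g = n.+1 -> lead_coef g != 0.
    by move=> sg; rewrite lead_coef_eq0 -size_poly_eq0 sg.
  have [spq|spq|spq] := ltngtP (size p) (size q).
  - rewrite stereo_invE; have sqE : size q = n.+1 by rewrite -maxE; apply/esym/maxn_idPr/ltnW.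
    have -> : p`_n = 0 by apply: nth_default; rewrite -ltnS -sqE.
    rewrite (lc _ sqE); apply: hopf_proportional.
    + by move=> [_ /eqP]; rewrite oner_eq0.
    + by move=> [_ /eqP]; rewrite (negPf (lc0 _ sqE)).
    + by rewrite mulr0 mul0r.
  - have spE : size p = n.+1 by rewrite -maxE; apply/esym/maxn_idPl/ltnW.
    have -> : q`_n = 0 by apply: nth_default; rewrite -ltnS -spE.
    by rewrite (lc _ spE); apply: stereo_inv_inf; exact: lc0.
  - have spE : size p = n.+1 by rewrite -maxE -spq maxnn.
    have sqE : size q = n.+1 by rewrite -spq.
    rewrite (lc _ spE) (lc _ sqE); have := @hopf_div (lead_coef p) (lead_coef q).
    by rewrite (lc0 _ sqE) => -> // -[/eqP]; rewrite (negPf (lc0 _ spE)).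
have N0 : w.1 ^+ 2 + w.2 ^+ 2 != 0.
  apply: contraNN w0; rewrite paddr_eq0 ?sqr_ge0// !sqrf_eq0 => /andP[/eqP a /eqP b].
  by rewrite /toC a b.
have d0 := lt0r_neq0 (sinv_den w).
have E1 : 1 - flip (sinv w) ord0 i2 = 2 * (w.1 ^+ 2 + w.2 ^+ 2) / (w.1 ^+ 2 + w.2 ^+ 2 + 1).
  by rewrite /flip /sinv !vec3E; field.
have -> : f (flip (sinv w)) = stereo_inv (rat_eval p q (Some (toC w)^-1)).
  rewrite /rat_S2; congr (stereo_inv (rat_eval p q _)); rewrite /stereo.
  case: ifPn => [/eqP E2|_].
    exfalso; move: E1; rewrite E2 subrr => /esym/eqP; apply/negP.
    by rewrite !mulf_neq0 ?invr_eq0 ?pnatr_eq0.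
  rewrite E1 /flip /sinv !vec3E; congr Some; rewrite /toC.
  have -> : (Complex w.1 w.2)^-1 = Complex (w.1 / (w.1 ^+ 2 + w.2 ^+ 2)) (- (w.2 / (w.1 ^+ 2 + w.2 ^+ 2))) :> C by [].
  by congr Complex; field; rewrite N0 d0.
rewrite /= hopf_div; last exact: rat_nz.
rewrite !rev_polyE//; apply/esym; apply: hopf_scale; last exact: rat_nz.
by rewrite expf_neq0.
Qed.

Lemma rat_nice : nice_map f.
Proof.
have poles u : u <> north R \/ u <> flip (north R).
  have [->|] := pselect (u = north R); [right|by left].
  move=> /(congr1 (fun v : V3 => v ord0 i2)); rewrite /flip /north !vec3E; lra.
split.
- move=> u Su; have [h|h] := poles u.
    exact: (chart_map_S2 chart_north rat_nz rat_north).
  exact: (chart_map_S2 chart_south rev_nz rat_south).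
- move=> u Su e e0; have [h|h] := poles u.
    exact: (chart_map_cont chart_north rat_nz rat_north).
  exact: (chart_map_cont chart_south rev_nz rat_south).
- move=> u e Su e0; have [h|h] := poles u.
    exact: (chart_map_open chart_north rat_nz rat_pencil rat_north).
  exact: (chart_map_open chart_south rev_nz rev_pencil rat_south).
(* For finiteness one chart is enough, since the centre adds at most one point to a fibre. *)
- exact: (chart_map_fin chart_north rat_nz rat_pencil rat_north).
Qed.

End RatS2.

Lemma infinite_idxS (I J : set nat) : I `<=` J -> infinite_idx I -> infinite_idx J.
Proof. by move=> IJ iI N; have [n Nn In] := iI N; exists n => //; exact: IJ. Qed.

Lemma pigeonhole_idx (T : eqType) (B : set T) (I : set nat) (r : nat -> T -> Prop) :
  finite_set B -> infinite_idx I -> (forall n, I n -> exists2 b, B b & r n b) ->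
  exists2 b, B b & infinite_idx (I `&` r^~ b).
Proof.
move=> /finite_seqP[s ->]; elim: s I => [|b s IHs] I iI h.
  by have [n _ In] := iI 0%N; have [] := h n In.
have [ib|nb] := pselect (infinite_idx (I `&` r^~ b)).
  by exists b => //=; rewrite mem_head.
have /existsNP[N hN] := nb.
have [||c cs ic] := IHs (I `&` [set n | (N <= n)%N]).
- move=> N'; have [n] := iI (maxn N N'); rewrite geq_max => /andP[n1 n2] In.
  by exists n => //; split.
- move=> n [In /= Nn]; have [c /= + rc] := h n In; rewrite inE => /orP[/eqP cb|cs].
    by exfalso; apply: hN; exists n => //; rewrite -cb.
  by exists c.
- exists c; first by rewrite /= inE; apply/orP; right.
  by apply: infinite_idxS ic => n [[In _] rn].
Qed.

(** * Preimages of connected sets under open maps with finite fibres *)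

Section NiceMaps.
Variable R : realType.
Local Notation V3 := 'rV[R]_3.
Local Notation S2 := (@S2 R).
Variable f : V3 -> V3.
Hypothesis nf : nice_map f.

Definition pre (A : set V3) := S2 `&` f @^-1` A.

Lemma pre_cpt (A : set V3) : closed A -> compact (pre A).
Proof.
have [_ cf _ _] := nf => cA; apply: (sub_cpt _ (@S2_cpt R)) => [|u []//].
by apply: closed_preimage => //; exact: cpt_closed (@S2_cpt R).
Qed.

Lemma pre_open (A : set V3) : sph_open A -> sph_open (pre A).
Proof.
have [fS cf _ _] := nf => -[AS oA]; split=> [u []//|u [Su Au]].
have [d d0 dP] := oA _ Au; have [e e0 eP] := cf u Su d d0.
by exists e => // v Sv vu; split=> //; apply: dP; [exact: fS|exact: eP].
Qed.

Lemma image_closure (H : set V3) y : H `<=` S2 -> closure (f @` H) y -> exists2 h, closure H h & f h = y.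
Proof.
have [fS cf _ _] := nf => HS cy.
have cS : closed S2 := cpt_closed (@S2_cpt R).
have cHS : closure H `<=` S2 by move=> z /(closureS HS); rewrite -(closure_id _).1.
have cI : compact (f @` closure H).
  apply: image_cpt; first exact: cont_onS cf.
  by apply: (sub_cpt _ (@S2_cpt R)) => //; exact: closed_closure.
have /(_ y) := cpt_closed cI; case; last by move=> h ch fh; exists h.
by move: y cy; apply: closureS => _ [h Hh <-]; exists h => //; exact: subset_closure.
Qed.

(** The image of the component is open because the map is, and closed in [C]: a limit of image
    points has a preimage in the closure of the component, and within [pre C] that closure adds
    nothing. *)
Lemma component_pre_onto (C : set V3) w t : sph_open C -> connected C -> pre C w -> C t ->
  exists2 v, connected_component (pre C) w v & f v = t.
Proof.
have [fS cf of_ _] := nf => oC cC prew Ct.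
set H := connected_component (pre C) w.
have [HS oH] : sph_open H by apply: sph_component_open; exact: pre_open.
have Hw : H w by exact: connected_component_refl.
have [_ Cfw] := prew; have [CS oC'] := oC.
suff : (f @` H) t by move=> [v Hv <-]; exists v.
apply: (@connected_local R _ C (f @` H) cC _ (f w) t) => //.
move=> y Cy; have [[h Hh hy]|nH] := pselect ((f @` H) y).
  have [e e0 eP] := oH h Hh; have [d d0 dP] := of_ h e (HS h Hh) e0.
  exists d => // y' z Cy' Cz y'y zy _; rewrite -hy in zy.
  by have [v [Sv vh <-]] := dP z (CS z Cz) zy; exists v => //; exact: eP.
have nc : (~` closure (f @` H)) y.
  move=> /(image_closure HS)[h ch fh]; apply: nH; exists h => //.
  apply: sph_closure_component; first exact: pre_open.
  split=> //; split; last by rewrite /= fh.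
  have := closureS HS ch; rewrite -(closure_id _).1//; exact: cpt_closed (@S2_cpt R).
have oc : open (~` closure (f @` H)) by apply: closed_openC; exact: closed_closure.
have [d d0 dP] := (open_normP _).1 oc y nc; exists d => // y' z Cy' Cz y'y _ Hy'.
by exfalso; apply: (dP y' y'y); exact: subset_closure.
Qed.

Definition pieces (C : set V3) : set (set V3) := [set connected_component (pre C) w | w in pre C].

(** Every piece maps onto [C], so it contains a point of the finite fibre over a fixed [t]. *)
Lemma pieces_finite (C : set V3) : sph_open C -> connected C -> C !=set0 -> finite_set (pieces C).
Proof.
move=> oC cC [t Ct]; have [_ _ _ ff] := nf; have [CS _] := oC.
apply: (@sub_finite_set _ _ [set connected_component (pre C) v | v in [set v | S2 v /\ f v = t]]); last first.
  by apply: finite_image; apply: ff; exact: CS.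
move=> _ [w prew <-]; have [v Hv fv] := component_pre_onto oC cC prew Ct.
exists v; last by rewrite -(same_connected_component Hv).
by split=> //; have [] := connected_component_sub Hv.
Qed.

Lemma pieceP (C B : set V3) : sph_open C -> pieces C B -> [/\ sph_open B, connected B, B `<=` pre C & B !=set0].
Proof.
move=> oC [w prew <-]; split.
- by apply: sph_component_open; exact: pre_open.
- exact: component_connected.
- exact: connected_component_sub.
- by exists w; exact: connected_component_refl.
Qed.

(** Openness gives points of [pre C] converging to [s]; among finitely many pieces, one contains
    infinitely many of them. *)
Lemma closure_pieces (C : set V3) s : sph_open C -> connected C -> C !=set0 -> S2 s -> closure C (f s) ->
  exists2 B, pieces C B & closure B s.
Proof.
move=> oC cC C0 Ss cs; have [fS cf of_ _] := nf; have [CS _] := oC.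
have /choice[w wP] : forall n : nat, exists w, pre C w /\ `|w - s| < n.+1%:R^-1.
  move=> n; have [|d d0 dP] := of_ s n.+1%:R^-1 Ss; first by rewrite invr_gt0.
  have /closure_normP/(_ d d0)[c Cc cfs] := cs.
  by have [v [Sv vs fv]] := dP c (CS c Cc) cfs; exists v; split=> //; split; rewrite //= fv.
have [||B BB iB] := @pigeonhole_idx _ (pieces C) setT (fun n B => B (w n)) (pieces_finite oC cC C0).
- by move=> N; exists N.
- move=> n _; have [pw _] := wP n; exists (connected_component (pre C) (w n)).
    by exists (w n).
  exact: connected_component_refl.
exists B => //; apply/closure_normP => e e0; have [N NP] := natSinv_lt e0.
have [n Nn [_ Bn]] := iB N; exists (w n) => //; have [_ ws] := wP n.
exact: lt_trans ws (NP n Nn).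
Qed.

(** Open maps of compacta are confluent. If [t] were missed, a clopen part [G] of [pre P] around the
    component would avoid the fibre of [t], while its image is open and closed in the connected
    [P]. *)
Lemma component_pre_continuum (P : set V3) u : P `<=` S2 -> compact P -> connected P -> pre P u ->
  f @` connected_component (pre P) u = P.
Proof.
have [fS cf of_ _] := nf => PS cP conP pu.
apply/seteqP; split=> [_ [v /connected_component_sub[_ Pv] <-]//|t Pt].
apply: contrapT => nt.
have cA : compact (pre P) by apply: pre_cpt; exact: cpt_closed.
pose Z := pre [set t].
have cZ : closed Z by apply: cpt_closed; apply: pre_cpt; apply: cpt_closed; exact: compact_set1.
have [|G [GA Gu cG cAG GZ]] := component_clopen cA pu cZ.
  by rewrite -subset0 => v [Mv [_ /= fv]]; apply: nt; exists v.
have GS : G `<=` S2 by move=> v /GA[].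
have cptG : compact G by exact: sub_cpt cG cA GA.
have GP : f @` G = P.
  apply: conn_clopen => //.
  - by move=> _ [v /GA[_ Pv] <-].
  - by exists (f u); exists u.
  - by apply: cpt_closed; apply: image_cpt => //; exact: cont_onS cf.
  - apply/closed_normP => y hy.
    have Py : P y.
      have /closed_normP := cpt_closed cP; apply => e e0.
      by have [z [Pz _] zy] := hy e e0; exists z.
    split=> // -[g Gg gy].
    have [e e0 eP] : exists2 e : R, 0 < e & forall v, `|v - g| < e -> ~ (pre P `\` G) v.
      have /open_normP/(_ g) := closed_openC cAG; case; first by move=> [_].
      by move=> e e0 eP; exists e.
    have [d d0 dP] := of_ g e (GS g Gg) e0; rewrite gy in dP.
    have [z [Pz nz] zy] := hy d d0; have [v [Sv vg fv]] := dP z (PS z Pz) zy.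
    apply: (eP v vg); split; first by split; rewrite //= fv.
    by move=> Gv; apply: nz; exists v.
have : (f @` G) t by rewrite GP.
move=> [v Gv fv]; have : (G `&` Z) v; last by rewrite GZ.
by split=> //; split; [exact: GS|].
Qed.

End NiceMaps.

(** * Monotone maps onto Peano spaces *)

Section PeanoImages.
Variables (R : realType) (E V : normedModType R) (L : set E) (g : E -> V).
Hypothesis cL : compact L.
Hypothesis cg : cont_on L g.
Hypothesis fib : forall a, L a -> connected (L `&` g @^-1` [set g a]).

Lemma closed_img (C : set E) : closed C -> closed (g @` (L `&` C)).
Proof.
move=> cC; apply: cpt_closed; apply: image_cpt; first by apply: cont_onS cg => x [].
by apply: (sub_cpt _ cL) => [|x []//]; apply: closedI => //; exact: cpt_closed.
Qed.

(** Connected fibres make a clopen part [B] of the preimage saturated. As [g] maps closed subsets of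
    [L] to closed sets, the image of [B] is clopen in [N], even when [N] itself is not closed. *)
Lemma monotone_preimage (N : set V) : N `<=` g @` L -> connected N -> connected (L `&` g @^-1` N).
Proof.
move=> NL cN B B0 [Op oO BO] [C cC BC].
have BA : B `<=` L `&` g @^-1` N by rewrite BC => x [].
have sat a b : L a -> L b -> g a = g b -> B a -> B b.
  move=> La Lb gab Ba; have [_ Na] := BA a Ba.
  pose F := L `&` g @^-1` [set g a].
  have FB : F `&` B = F.
    apply: (fib La); first by exists a; split=> //; split.
      exists Op => //; rewrite BO; apply/seteqP; split=> x [Fx].
        by move=> [_ Ox]; split.
      by move=> Ox; split=> //; split=> //; have [Lx gx] := Fx; split=> //=; rewrite gx.
    exists C => //; rewrite BC; apply/seteqP; split=> x [Fx].
      by move=> [_ Ox]; split.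
    by move=> Ox; split=> //; split=> //; have [Lx gx] := Fx; split=> //=; rewrite gx.
  have : F b by split=> //=; rewrite gab.
  by rewrite -FB => -[].
have gBN : g @` B `<=` N by move=> _ [x /BA[_ Nx] <-].
have E1 : g @` B = N `&` g @` (L `&` C).
  apply/seteqP; split=> [_ [x Bx <-]|y [Ny [x [Lx Cx] gx]]].
    split; first by apply: gBN; exists x.
    by exists x => //; move: Bx; rewrite BC => -[[Lx _] Cx].
  by exists x => //; rewrite BC; split=> //; split; rewrite //= gx.
have E2 : g @` B = N `&` ~` (g @` (L `&` ~` Op)).
  apply/seteqP; split=> [_ [x Bx <-]|y [Ny nO]].
    split; first by apply: gBN; exists x.
    move=> [z [Lz nOz] gz]; have : B z by apply: (sat x) => //; have [] := BA x Bx.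
    by rewrite BO => -[].
  have [x Lx gx] := NL y Ny; exists x => //; rewrite BO; split; first by split; rewrite //= gx.
  by apply: contrapT => nOx; apply: nO; exists x.
have gB : g @` B = N.
  apply: cN; first by have [b Bb] := B0; exists (g b); exists b.
    exists (~` (g @` (L `&` ~` Op))) => //; apply: closed_openC; apply: closed_img; exact: open_closedC.
  by exists (g @` (L `&` C)) => //; exact: closed_img.
apply/seteqP; split=> // x [Lx Nx].
have [b Bb gb] : (g @` B) (g x) by rewrite gB.
by apply: (sat b) => //; have [] := BA b Bb.
Qed.

(** * Small subcontinua joining the two boundary parts *)

Hypothesis pY : peano_space (g @` L).
Variables (W d1 d2 : set E) (m : nat -> E).
Hypothesis cW : closed W.
Hypothesis WL : W `<=` L.
Hypothesis cd1 : closed d1.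
Hypothesis cd2 : closed d2.
Hypothesis Wint : forall z, W z -> ~ d1 z -> ~ d2 z ->
  exists2 d : R, 0 < d & forall y, L y -> `|y - z| < d -> W y.
Let M n := connected_component W (m n).
Hypothesis M_inj : injective M.
Hypothesis M_d1 : forall n, M n `&` d1 !=set0.
Hypothesis M_d2 : forall n, M n `&` d2 !=set0.

Let cptW : compact W. Proof. exact: sub_cpt cW cL WL. Qed.
Let M_closed n : closed (M n). Proof. exact: component_closed. Qed.
Let MW n : M n `<=` W. Proof. exact: connected_component_sub. Qed.
Let M_conn n : connected (M n). Proof. exact: component_connected. Qed.

Let slab n c (e : R) := M n `&` g @^-1` [set y | `|y - c| <= e].

Let slab_cpt n c e : compact (slab n c e).
Proof.
apply: (sub_cpt _ cptW); last by move=> x [/MW].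
apply: closed_preimage => //; last exact: closed_cball.
by apply: cont_onS cg => x /MW/WL.
Qed.

(* Small pieces of [M n] reach [d1 `|` d2]: otherwise infinitely many [M n]
   enter the preimage of a small connected neighbourhood in the Peano space,
   and that connected preimage would have to stay inside [W]. *)
Lemma small_piece_reaches (e : R) : 0 < e -> exists N, forall n s, (N <= n)%N -> M n s ->
  connected_component (slab n (g s) e) s `&` (d1 `|` d2) !=set0.
Proof.
move=> e0; apply: contrapT => H.
pose bad n s := M n s /\ ~ (connected_component (slab n (g s) e) s `&` (d1 `|` d2) !=set0).
pose I := [set n | exists s, bad n s].
have iI : infinite_idx I.
  move=> N; apply: contrapT => HN; apply: H; exists N => n s Nn Ms.
  by apply: contrapT => ns; apply: HN; exists n => //; exists s.
have /choice[s sP] : forall n, exists s, I n -> bad n s.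
  by move=> n; have [[s sn]|nI] := pselect (I n); [exists s|exists (m n)].
have gL n : I n -> L (s n) by move=> /sP[/MW/WL].
have [cY [_ [lcY finY]]] := pY.
pose Y n := connected_component (g @` L) (g (s n)).
have gMY n z : I n -> M n z -> Y n (g z).
  move=> In Mz; exists (g @` M n); last by exists z.
  split; first by exists (s n) => //; have [] := sP n In.
    by move=> _ [w /MW/WL Lw <-]; exists w.
  by apply: image_conn => //; apply: cont_onS cg => w /MW/WL.
(* The image of a bad [M n] has diameter above [e], since otherwise its slab is all of [M n], which
   meets [d1]. Only finitely many components of the Peano space are that large. *)
have [|Y0 Y0c iI'] := pigeonhole_idx (r := fun n C => Y n = C) (finY e e0) iI.
  move=> n In; exists (Y n) => //; split.
    by exists (g (s n)) => //; exists (s n) => //; exact: gL.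
  have [Ms ns] := sP n In.
  have [z Mz ze] : exists2 z, M n z & e < `|g (s n) - g z|.
    apply: contrapT => Hz; apply: ns.
    have slabE : slab n (g (s n)) e = M n.
      apply/seteqP; split=> [z []//|z Mz]; split=> //=; rewrite leNgt distrC; apply/negP => ez.
      by apply: Hz; exists z.
    rewrite slabE (connected_component_id Ms (@M_conn n)).
    by have [z [Mz dz]] := M_d1 n; exists z; split=> //; left.
  exists (g (s n)), (g z); split; first exact: gMY.
  by split=> //; exact: gMY.
have [x Lx xP] := @cluster_seq R E L s _ cL iI' (fun n InY => gL n InY.1).
have [[y0 Yy0 Y0E] _] := Y0c.
have cY0 : closed Y0 by rewrite Y0E; apply: component_closed; exact: cpt_closed.
have sY0 n : (I `&` (fun n => Y n = Y0)) n -> Y0 (g (s n)).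
  by move=> [In <-]; apply: gMY => //; have [] := sP n In.
have gx : Y0 (g x).
  have /closed_normP := cY0; apply => r r0; have [d d0 dP] := cg Lx r0.
  have [n _ [In /= sx]] := xP d d0 0%N; exists (g (s n)); first exact: sY0.
  by apply: dP => //; exact: gL In.1.
have e3 : 0 < e / 3 by rewrite divr_gt0.
(* With radius [e / 3], values of [g] on the closure [K] differ by at most [2 * e / 3], so [F], the
   component of [s n1] in the part of [K] inside [W], stays in the slab. *)
have [|N [[Op [oO NE]] [cN [Nx Ne]]]] := lcY Y0 _ (g x) gx (e / 3) e3; first by exists y0.
have Y0L : Y0 `<=` g @` L by rewrite Y0E; exact: connected_component_sub.
have NL : N `<=` g @` L by move=> y; rewrite NE => -[/Y0L].
pose A := L `&` g @^-1` N.
have cA : connected A by exact: monotone_preimage.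
pose K := closure A.
have KL : K `<=` L.
  move=> z cz; have := @closureS _ A L (fun z h => h.1) z cz.
  by rewrite -(closure_id _).1//; exact: cpt_closed.
have cK : compact K by apply: (sub_cpt _ cL KL); exact: closed_closure.
have gK z : K z -> `|g z - g x| <= e / 3.
  move=> /[dup] /KL Lz /closure_normP cz; rewrite leNgt; apply/negP => h.
  have [|d d0 dP] := cg Lz (e := `|g z - g x| - e / 3); first by rewrite subr_gt0.
  have [w [Lw Nw] wz] := cz d d0; have h1 := dP w Lw wz.
  have h2 : `|g w - g x| < e / 3.
    by have := Ne _ Nw; rewrite -ball_normE /ball_ /= distrC.
  have h3 : `|g z - g x| <= `|g w - g x| + `|g w - g z|.
    have -> : g z - g x = (g w - g x) - (g w - g z) by rewrite opprB [RHS]addrC addrA subrK.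
    exact: ler_normB.
  by move: h1 h2 h3; lra.
have [d d0 dP] : exists2 d : R, 0 < d & forall n, (I `&` (fun n => Y n = Y0)) n -> `|s n - x| < d -> A (s n).
  have Ox : Op (g x) by move: Nx; rewrite NE => -[].
  have [r r0 rP] := (open_normP Op).1 oO _ Ox.
  have [d d0 dP] := cg Lx r0; exists d => // n InY sx; have Ls := gL n InY.1.
  split=> //; rewrite /= NE; split; first exact: sY0.
  by apply: rP; exact: dP.
have [n1 _ [I1 s1]] := xP d d0 0%N.
have [n2 n12 [I2 s2]] := xP d d0 n1.+1.
have A1 := dP n1 I1 s1; have A2 := dP n2 I2 s2.
have KA : A `<=` K by exact: subset_closure.
pose KW := K `&` W.
have cKW : compact KW by apply: (sub_cpt _ cK) => [|z []//]; apply: closedI => //; exact: cpt_closed.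
have [Ms1 ns1] := sP n1 I1.1.
have [Ms2 _] := sP n2 I2.1.
have KWs1 : KW (s n1) by split; [exact: KA|exact: MW Ms1].
pose F := connected_component KW (s n1).
have FM : F `<=` M n1.
  move=> z Fz; apply: (connected_component_trans Ms1).
  by exists F => //; split; [exact: connected_component_refl|move=> w /connected_component_sub[]|exact: component_connected].
have Fslab : F `<=` slab n1 (g (s n1)) e.
  move=> z Fz; split; first exact: FM.
  have h1 := gK _ (connected_component_sub Fz).1; have h2 := gK _ (KA _ A1).
  rewrite /=; have -> : `|g z - g (s n1)| = `|(g z - g x) - (g (s n1) - g x)|.
    by congr `|_|; rewrite opprB addrA subrK.
  by apply: le_trans (ler_normB _ _) _; move: h1 h2 e0; lra.
have Fd : F `&` (d1 `|` d2) = set0.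
  rewrite -subset0 => z [Fz dz]; apply: ns1; exists z; split=> //.
  exists F => //; split=> //; [exact: connected_component_refl|exact: component_connected].
have [|G [GKW Gs cG cKWG Gd]] := component_clopen cKW KWs1 _ Fd.
  exact: closedU.
(* Off [d1] and [d2] the set [W] is a neighbourhood in [L], so [G] is clopen in all of the connected
   [K]. Then [K] lies in [W] and joins two different [M n]. *)
have GK : G = K.
  apply: conn_clopen => //.
  - exact: connected_closure.
  - by move=> z /GKW[].
  - by exists (s n1).
  - apply/closed_normP => z hz.
    have Kz : K z.
      by have /closed_normP := cpt_closed cK; apply => r r0; have [y [Ky _] yz] := hz r r0; exists y.
    split=> // Gz; have [_ Wz] := GKW z Gz.
    have nd : ~ (d1 `|` d2) z by move=> dz; have : (G `&` (d1 `|` d2)) z by []; rewrite Gd.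
    have [||r r0 rP] := Wint Wz; [by move=> h; apply: nd; left|by move=> h; apply: nd; right|].
    have [_] : (KW `\` G) z; last by [].
    have /closed_normP := cKWG; apply => q q0.
    have [|y [Ky nGy]] := hz (Num.min q r); first by rewrite lt_min q0.
    rewrite lt_min => /andP[yq yr]; exists y => //; split=> //; split=> //.
    by apply: rP => //; exact: KL.
have KsubW : K `<=` W by rewrite -GK => z /GKW[].
have : M n1 = M n2.
  have M12 : M n1 (s n2).
    apply: (connected_component_trans Ms1); exists K; last exact: KA.
    by split=> //; [exact: KA|exact: connected_closure].
  by rewrite /M (same_connected_component M12) (same_connected_component Ms2).
by move=> /M_inj n12'; rewrite n12' ltnn in n12.
Qed.

(** Points whose pieces of radius [e / 2] reach [d1] and those whose pieces reach [d2] cover the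
    connected [M n]. Somewhere both kinds accumulate, and there the piece of radius [e] reaches
    both. *)
Lemma small_crossing (e : R) : 0 < e -> exists N, forall n, (N <= n)%N ->
  exists F c, [/\ F `<=` M n, closed F, connected F, F `&` d1 !=set0 &
    F `&` d2 !=set0 /\ forall z, F z -> `|g z - c| <= e].
Proof.
move=> e0; have e2 : 0 < e / 2 by rewrite divr_gt0.
have [N NP] := small_piece_reaches e2; exists N => n Nn.
pose G (d : set E) := [set s | M n s /\ connected_component (slab n (g s) (e / 2)) s `&` d !=set0].
have GM s : M n s -> G d1 s \/ G d2 s.
  move=> Ms; have [z [Cz [dz|dz]]] := NP n s Nn Ms; [left|right]; by split=> //; exists z.
have Gd d : M n `&` d !=set0 -> exists s, G d s.
  move=> [z [Mz dz]]; exists z; split=> //; exists z; split=> //.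
  by apply: connected_component_refl; split=> //=; rewrite subrr normr0 ltW.
(* if pieces reaching [d] cluster at [s], then a slightly larger piece at [s] reaches [d] *)
have limit d s : closed d -> M n s ->
    (forall r : R, 0 < r -> exists2 s', G d s' & `|s' - s| < r) ->
    connected_component (slab n (g s) e) s `&` d !=set0.
  move=> cd Ms hs; apply/set0P/eqP => Cd.
  have Ss : slab n (g s) e s by split=> //=; rewrite subrr normr0 ltW.
  have [H [HS Hs cH cSH Hd]] := component_clopen (@slab_cpt n (g s) e) Ss cd Cd.
  have [r r0 rP] : exists2 r : R, 0 < r & forall z, `|z - s| < r -> ~ (slab n (g s) e `\` H) z.
    have /open_normP/(_ s) := closed_openC cSH; case; first by move=> [_].
    by move=> r r0 rP; exists r.
  have [r' r'0 r'P] := cg (WL (MW Ms)) e2.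
  have [|s' [Ms' [z [Cz dz]]]] := hs (Num.min r r'); first by rewrite lt_min r0.
  rewrite lt_min => /andP[sr sr'].
  have gs : `|g s' - g s| < e / 2 by apply: r'P => //; exact: WL (MW Ms').
  have sub : slab n (g s') (e / 2) `<=` slab n (g s) e.
    move=> w [Mw /= gw]; split=> //=.
    have -> : g w - g s = (g w - g s') + (g s' - g s) by rewrite addrA subrK.
    by apply: le_trans (ler_normD _ _) _; move: gw gs; lra.
  have Ss' : slab n (g s') (e / 2) s' by split=> //=; rewrite subrr normr0 ltW.
  have Hs' : H s'.
    by apply: contrapT => nH; apply: (rP s' sr); split=> //; exact: sub.
  pose C' := connected_component (slab n (g s') (e / 2)) s'.
  have C'H : C' `&` H = C'.
    apply: conn_clopen.
    - exact: component_connected.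
    - by move=> w [].
    - by exists s'; split=> //; exact: connected_component_refl.
    - by apply: closedI => //; apply: component_closed; apply: cpt_closed; exact: slab_cpt.
    - have -> : C' `\` (C' `&` H) = C' `&` (slab n (g s) e `\` H).
        apply/seteqP; split=> w [C'w h]; split=> //.
          by split; [exact: sub (connected_component_sub C'w)|move=> Hw; apply: h].
        by move=> [_]; have [_] := h.
      by apply: closedI => //; apply: component_closed; apply: cpt_closed; exact: slab_cpt.
  have : (H `&` d) z; last by rewrite Hd.
  by split=> //; have : C' z by []; rewrite -C'H => -[].
have [s Ms [C1 C2]] : exists2 s, M n s & connected_component (slab n (g s) e) s `&` d1 !=set0 /\
    connected_component (slab n (g s) e) s `&` d2 !=set0.
  apply: contrapT => Hn.
  have loc s : M n s -> exists2 r : R, 0 < r & (forall y, M n y -> `|y - s| < r -> ~ G d1 y) \/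
      (forall y, M n y -> `|y - s| < r -> ~ G d2 y).
    move=> Ms; apply: contrapT => Hs; apply: Hn; exists s => //; split; apply: limit => // r r0.
      apply: contrapT => nr; apply: Hs; exists r => //; left=> y My yr Gy; apply: nr; by exists y.
    apply: contrapT => nr; apply: Hs; exists r => //; right=> y My yr Gy; apply: nr; by exists y.
  have [a [Ma Ga]] := Gd d1 (M_d1 n); have [b [Mb Gb]] := Gd d2 (M_d2 n).
  have Gab s : G d1 s -> G d2 s -> False.
    move=> [Ms G1] [_ G2]; have [r r0 [h|h]] := loc s Ms.
      by apply: (h s) => //; rewrite subrr normr0.
    by apply: (h s) => //; rewrite subrr normr0.
  have : G d1 b.
    apply: (@connected_local R E (M n) (G d1) (@M_conn n) _ a b) => //.
    move=> s Ms; have [r r0 [h|h]] := loc s Ms; exists r => // y z My Mz yr zr.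
      by move=> /(h y My yr).
    by move=> _; have [//|/(h z Mz zr)] := GM z Mz.
  by move=> /Gab; apply.
exists (connected_component (slab n (g s) e) s), (g s); split=> //.
- by move=> z /connected_component_sub[].
- by apply: component_closed; apply: cpt_closed; exact: slab_cpt.
- exact: component_connected.
- by split=> // z /connected_component_sub[].
Qed.

End PeanoImages.

(** * Crossings of an annulus *)

Section Annuli.
Variable R : realType.
Local Notation V3 := 'rV[R]_3.
Local Notation S2 := (@S2 R).
Local Notation I01 := (`[0, 1]%classic : set R).

Lemma sph_open_setD (K : set V3) : closed K -> sph_open (S2 `\` K).
Proof.
move=> /closed_openC/open_normP oK; split=> [v []//|v [Sv nK]].
by have [d d0 dP] := oK v nK; exists d => // y Sy yv; split=> //; exact: dP.
Qed.

Lemma sph_openI (A B : set V3) : sph_open A -> open B -> sph_open (A `&` B).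
Proof.
move=> [AS oA] /open_normP oB; split=> [v [/AS]//|v [Av Bv]].
have [d d0 dP] := oA v Av; have [e e0 eP] := oB v Bv.
exists (Num.min d e); first by rewrite lt_min d0.
by move=> y Sy; rewrite lt_min => /andP[yd ye]; split; [exact: dP|exact: eP].
Qed.

Lemma sph_open_disjoint_closure (V U : set V3) : sph_open V -> U `<=` S2 -> V `&` U = set0 -> V `&` closure U = set0.
Proof.
move=> [VS oV] US VU; rewrite -subset0 => v [Vv /closure_normP cv].
have [d d0 dP] := oV v Vv; have [u Uu uv] := cv d d0.
by have : (V `&` U) u; [split=> //; apply: dP => //; exact: US|rewrite VU].
Qed.

Variables (J1 J2 U : set V3).
Hypothesis scJ1 : simple_closed_curve J1.
Hypothesis scJ2 : simple_closed_curve J2.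
Hypothesis J12 : J1 `&` J2 = set0.
Hypothesis UJ : U_between J1 J2 U.

Lemma scc_nonempty (J : set V3) : simple_closed_curve J -> J !=set0.
Proof.
move=> /scc_loop[g Lg ->]; exists (g 0); exists 0 => //.
by rewrite /= in_itv/= lexx ler01.
Qed.

Lemma between_facts : [/\ sph_open U, connected U, U !=set0, U `&` (J1 `|` J2) = set0 &
  closure U = U `|` (J1 `|` J2)].
Proof.
have [[z [Dz UE]] bU] := UJ.
have oD : sph_open (S2 `\` (J1 `|` J2)).
  by apply: sph_open_setD; apply: closedU; apply: cpt_closed; exact: scc_cpt.
split.
- by rewrite UE; exact: sph_component_open.
- by rewrite UE; exact: component_connected.
- by rewrite UE; exists z; exact: connected_component_refl.
- by rewrite UE -subset0 => v [/connected_component_sub[]].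
- rewrite -bU setDE setUIr setUCr setIT; apply/seteqP; split=> v; first by right.
  by move=> [|//]; exact: subset_closure.
Qed.

Lemma between_max (D : set V3) p : connected D -> D `<=` S2 `\` (J1 `|` J2) -> D p -> U p -> D `<=` U.
Proof.
have [[z [Dz UE]] bU] := UJ; rewrite UE => cD DS Dp Up v Dv.
by apply: (connected_component_trans Up); exists D.
Qed.

Lemma side_max (J V V' : set V3) : sph_open V -> connected V' -> V' `<=` S2 -> closure V = V `|` J ->
  V' `&` J = set0 -> V' `&` V !=set0 -> V' `<=` V.
Proof.
move=> [VS oV] cV' VS' clV V'J [w [V'w Vw]] v V'v.
apply: (@connected_local R _ V' V cV' _ w v) => //.
move=> x V'x; have [Vx|nVx] := pselect (V x).
  have [d d0 dP] := oV x Vx; exists d => // y y' V'y V'y' _ y'x _.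
  by apply: dP => //; exact: VS'.
have nc : (~` closure V) x.
  by rewrite clV => -[//|Jx]; have : (V' `&` J) x by []; rewrite V'J.
have oC : open (~` closure V) by apply: closed_openC; exact: closed_closure.
have [d d0 dP] := (open_normP _).1 oC x nc.
by exists d => // y y' _ _ yx _ Vy; exfalso; apply: (dP y yx); exact: subset_closure.
Qed.

(** Neither disc meets [J1] or [J2]. If the discs met, each would therefore contain the other, and
    their frontiers [J1] and [J2] would not be disjoint. *)
Lemma between_sides : exists V1 V2, [/\ sph_open V1 /\ sph_open V2, connected V1 /\ connected V2,
  (V1 !=set0 /\ V2 !=set0), V1 `&` closure U = set0 /\ V2 `&` closure U = set0 &
  [/\ J1 `<=` closure V1, J2 `<=` closure V2 & closure V1 `&` closure V2 = set0]].
Proof.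
have [oU cU U0 UJ0 clU] := between_facts; have [US _] := oU.
have UJ1 : U `&` J1 = set0 by rewrite -subset0 => v [Uv Jv]; have : (U `&` (J1 `|` J2)) v; [split=> //; left|rewrite UJ0].
have UJ2 : U `&` J2 = set0 by rewrite -subset0 => v [Uv Jv]; have : (U `&` (J1 `|` J2)) v; [split=> //; right|rewrite UJ0].
have [V1 [oV1 cV1 V10 V1U clV1]] := jordan_side scJ1 cU US U0 UJ1.
have [V2 [oV2 cV2 V20 V2U clV2]] := jordan_side scJ2 cU US U0 UJ2.
have dU (V J : set V3) : V `&` (U `|` J) = set0 -> V `&` U = set0.
  by move=> h; rewrite -subset0 => v [Vv Uv]; have : (V `&` (U `|` J)) v; [split=> //; left|rewrite h].
have V1c := sph_open_disjoint_closure oV1 US (dU _ _ V1U).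
have V2c := sph_open_disjoint_closure oV2 US (dU _ _ V2U).
have noJ (V : set V3) : V `&` closure U = set0 -> V `&` J1 = set0 /\ V `&` J2 = set0.
  move=> h; split; rewrite -subset0 => v [Vv Jv]; (suff : (V `&` closure U) v by rewrite h).
    by split=> //; rewrite clU; right; left.
  by split=> //; rewrite clU; right; right.
have [V1J1 V1J2] := noJ _ V1c; have [V2J1 V2J2] := noJ _ V2c.
have V12 : V1 `&` V2 = set0.
  rewrite -subset0 => w [V1w V2w].
  have s12 : V1 `<=` V2.
    by apply: (side_max oV2 cV1 oV1.1 clV2 V1J2); exists w.
  have s21 : V2 `<=` V1.
    by apply: (side_max oV1 cV2 oV2.1 clV1 V2J1); exists w.
  have VE : V1 = V2 by apply/seteqP.
  have [j Jj] := scc_nonempty scJ1.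
  have : (V2 `|` J2) j by rewrite -clV2 -VE clV1; right.
  move=> [V2j|J2j]; first by have : (V2 `&` J1) j by []; rewrite V2J1.
  by have : (J1 `&` J2) j by []; rewrite J12.
exists V1, V2; split=> //; split.
- by rewrite clV1 => v; right.
- by rewrite clV2 => v; right.
rewrite clV1 clV2 -subset0 => v [[a|a] [b|b]].
- by have : (V1 `&` V2) v by []; rewrite V12.
- by have : (V1 `&` J2) v by []; rewrite V1J2.
- by have : (V2 `&` J1) v by []; rewrite V2J1.
- by have : (J1 `&` J2) v by []; rewrite J12.
Qed.

(** [U] is locally connected along its boundary, so one component of a small part of [U] contains
    all points of [U] near [x]. *)
Lemma between_piece (x : V3) (r : R) : (J1 `|` J2) x -> 0 < r ->
  exists C, [/\ sph_open C, connected C, C !=set0, C `<=` U `&` [set z | `|z - x| < r] &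
    exists2 d : R, 0 < d & forall t, closure U t -> `|t - x| < d -> closure C t].
Proof.
have [oU cU U0 UJ0 clU] := between_facts; have [US _] := oU.
move=> Jx r0.
have [J [J' [scJ scJ' Jx' JJ' JJE]]] : exists J J', [/\ simple_closed_curve J, simple_closed_curve J',
   J x, J `&` J' = set0 & J `|` J' = J1 `|` J2].
  case: Jx => Jx; [exists J1, J2|exists J2, J1]; split=> //; first by rewrite setIC.
  by rewrite setUC.
have UJJ : U `&` (J `|` J') = set0 by rewrite JJE.
have UnJ : U `&` J = set0.
  by rewrite -subset0 => v [Uv Jv]; have : (U `&` (J `|` J')) v; [split=> //; left|rewrite UJJ].
have [s s0 sP] : exists2 s : R, 0 < s & forall a b, [set x] a -> J' b -> s <= `|a - b|.
  apply: cpt_dist; [exact: compact_set1|apply: cpt_closed; exact: scc_cpt|].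
  by rewrite -subset0 => v [-> J'x]; have : (J `&` J') x by []; rewrite JJ'.
(* Closer than [s] to [x] the other curve is absent, so small connected sets that avoid [J] and
   start in [U] remain in [U]. *)
pose r' := Num.min r s.
have r'0 : 0 < r' by rewrite lt_min r0.
have [d d0 dP] := scc_side_ulc scJ cU US U0 UnJ Jx' r'0.
have cUx : closure U x by rewrite clU; right.
pose dd := Num.min d r'.
have dd0 : 0 < dd by rewrite lt_min d0.
have /closure_normP/(_ dd dd0)[p Up] := cUx; rewrite lt_min => /andP[pd pr'].
pose G := U `&` [set z | `|z - x| < r'].
have oG : sph_open G by apply: sph_openI => //; exact: open_ball.
have Gp : G p by [].
exists (connected_component G p); split.
- exact: sph_component_open.
- exact: component_connected.
- by exists p; exact: connected_component_refl.
- move=> z /connected_component_sub[Uz /= zr]; split=> //=; apply: lt_le_trans zr _.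
  by rewrite ge_min lexx.
exists dd => // t /closure_normP ct tx; apply/closure_normP => e e0.
have [|q Uq] := ct (Num.min e (dd - `|t - x|)); first by rewrite lt_min e0 subr_gt0.
rewrite lt_min => /andP[qe qt]; exists q => //.
have : `|q - x| < dd.
  have -> : q - x = (q - t) + (t - x) by rewrite addrA subrK.
  by apply: le_lt_trans (ler_normD _ _) _; rewrite -ltrBrDr.
rewrite lt_min => /andP[qd qr'].
have [D [cD Dp Dq DS Dr]] := dP p q Up Uq pd qd.
exists D => //; split=> //.
have DU : D `<=` U.
  apply: (between_max cD _ Dp Up) => z Dz; split; first exact: DS.
  rewrite -JJE => -[Jz|J'z]; first by have [_] := Dr z Dz.
  have [zr _] := Dr z Dz; have := sP x z erefl J'z.
  by rewrite distrC leNgt (lt_le_trans zr)// ge_min lexx orbT.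
by move=> z Dz; split; [exact: DU|have [] := Dr z Dz].
Qed.

Section Crossings.
Variable f : V3 -> V3.
Hypothesis nf : nice_map f.

(** Boundary bumping: if the component of [F] in [M] minus [B] stayed off the closure of [B], a
    clopen part around it would be clopen in the connected [M], which meets that closure at [u]. *)
Lemma reach_boundary (M B F : set V3) u : compact M -> connected M -> M `<=` S2 -> sph_open B ->
  F `<=` M -> connected F -> F `&` closure B = set0 -> F !=set0 -> M u -> closure B u ->
  exists N, [/\ compact N, connected N, N `<=` M `\` B, F `<=` N & N `&` closure B !=set0].
Proof.
move=> cM conM MS [BS oB] FM cF FB [s Fs] Mu Bu.
have nBs : ~ B s by move=> Bs; have : (F `&` closure B) s; [split=> //; exact: subset_closure|rewrite FB].
have cMB : closed (M `\` B).
  apply/closed_normP => z hz.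
  have Mz : M z.
    by have /closed_normP := cpt_closed cM; apply => e e0; have [y [My _] yz] := hz e e0; exists y.
  split=> // Bz; have [d d0 dP] := oB z Bz; have [y [My nBy] yz] := hz d d0.
  by apply: nBy; apply: dP => //; exact: MS.
have cptMB : compact (M `\` B) by apply: (sub_cpt cMB cM) => z [].
exists (connected_component (M `\` B) s); split.
- by apply: (sub_cpt _ cptMB); [exact: component_closed|exact: connected_component_sub].
- exact: component_connected.
- exact: connected_component_sub.
- apply: connected_component_max => // z Fz; split; first exact: FM.
  by move=> Bz; have : (F `&` closure B) z; [split=> //; exact: subset_closure|rewrite FB].
apply/set0P/eqP => NB.
have [|G [GMB Gs cG cMBG GB]] := component_clopen cptMB _ (@closed_closure _ B) NB.
  by split=> //; exact: FM.
have GM : G = M.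
  apply: conn_clopen => //.
  - by move=> z /GMB[].
  - by exists s.
  have -> : M `\` G = ((M `\` B) `\` G) `|` (M `&` closure B).
    apply/seteqP; split=> z.
      move=> [Mz nG]; have [Bz|nB] := pselect (B z); [right; split=> //; exact: subset_closure|by left].
    move=> [[[Mz _] nG]//|[Mz cB]]; split=> // Gz.
    by have : (G `&` closure B) z by []; rewrite GB.
  by apply: closedU => //; apply: closedI; [exact: cpt_closed|exact: closed_closure].
by have : (G `&` closure B) u; [rewrite GM|rewrite GB].
Qed.

(** The fibre is finite, so a small sphere around [u] avoids it. A connected set mapped closer than
    [r2] to [x] then cannot cross that sphere. *)
Lemma fibre_gap x u (e : R) : S2 u -> f u = x -> 0 < e ->
  exists r1 r2 : R, [/\ 0 < r1, r1 < e, 0 < r2 & forall v, S2 v -> `|v - u| = r1 -> r2 <= `|f v - x|].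
Proof.
have [fS cf of_ ff] := nf => Su fu e0.
have finF : finite_set [set v | S2 v /\ f v = x] by apply: ff; rewrite -fu; exact: fS.
have [d d0 dP] : exists2 d : R, 0 < d & forall a b, [set u] a -> ([set v | S2 v /\ f v = x] `\` [set u]) b -> d <= `|a - b|.
  apply: cpt_dist; first exact: compact_set1.
    by apply: cpt_closed; apply: finite_compact; exact: finite_setD.
  by rewrite -subset0 => v [vu [_ nvu]]; exact: nvu.
pose r1 := Num.min d e / 2.
have m0 : 0 < Num.min d e by rewrite lt_min d0.
have r10 : 0 < r1 by rewrite divr_gt0.
have r1m : r1 < Num.min d e by rewrite ltr_pdivrMr// ltr_pMr// ltr1n.
have [r1d r1e] : r1 < d /\ r1 < e by move: r1m; rewrite lt_min => /andP[].
pose S := S2 `&` [set v | `|v - u| = r1].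
have cS : compact S.
  apply: (sub_cpt _ (@S2_cpt R)) => [|v []//].
  by apply: closedI; [exact: cpt_closed (@S2_cpt R)|exact: closed_sphere].
have [|r2 r20 r2P] := cpt_dist (image_cpt (cont_onS (@subIsetl _ _ _) cf) cS) (cpt_closed (@compact_set1 _ x)).
  rewrite -subset0 => _ [[v [Sv /= vr] <-] /= fv].
  have : d <= `|u - v|.
    apply: dP => //; split=> //= vu; move: vr; rewrite vu subrr normr0 => r10'.
    by rewrite -r10' ltxx in r10.
  by rewrite distrC vr leNgt r1d.
exists r1, r2; split=> // v Sv vr; apply: r2P => //; exists v => //.
Qed.

Lemma crossings_approach (M F : nat -> set V3) (w : nat -> V3) (u : V3) (e : R) :
  (forall n, [/\ compact (M n), connected (M n) & M n `<=` pre f (closure U)]) ->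
  (forall n k, n <> k -> M n `&` M k = set0) ->
  (forall n, [/\ F n `<=` M n, connected (F n), F n `&` f @^-1` J1 !=set0 & F n `&` f @^-1` J2 !=set0]) ->
  (forall n, M n (w n)) -> S2 u -> (J1 `|` J2) (f u) ->
  (forall r : R, 0 < r -> exists N, forall n, (N <= n)%N -> `|w n - u| < r) ->
  0 < e -> exists N, forall n, (N <= n)%N -> exists2 z, F n z & `|z - u| < e.
Proof.
have [fS cf of_ ff] := nf.
move=> MP Mdisj FP Mw Su Jfu wu e0; apply: contrapT => HN.
have MS n : M n `<=` S2 by move=> v; have [_ _ h] := MP n; move=> /h[].
have MU n v : M n v -> closure U (f v) by have [_ _ h] := MP n; move=> /h[].
have [oU cU U0 UJ0 clU] := between_facts; have [US _] := oU.
have [V1 [V2 [[oV1 oV2] [cV1 cV2] [V10 V20] [V1U V2U] [J1V1 J2V2 V12]]]] := between_sides.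
have [r1 [r2 [r10 r1e r20 rP]]] := fibre_gap Su erefl e0.
have [C [oC cC C0 CU [d d0 dP]]] := between_piece Jfu r20.
have [a a0 aP] := cf u Su d d0.
have m0 : 0 < Num.min a r1 by rewrite lt_min a0.
have [N1 N1P] := wu _ m0.
pose I0 := [set n | (N1 <= n)%N /\ forall z, F n z -> e <= `|z - u|].
have iI0 : infinite_idx I0.
  move=> N; apply: contrapT => hN; apply: HN; exists (maxn N N1) => n; rewrite geq_max => /andP[nN nN1].
  apply: contrapT => hn; apply: hN; exists n => //; split=> // z Fz.
  by rewrite leNgt; apply/negP => zu; apply: hn; exists z.
(* Three pigeonhole choices in a row: a piece near [u], then a component over each side disc, all
   touched by infinitely many of the continua. *)
have [|B pB iI1] := pigeonhole_idx (r := fun n B => closure B (w n)) (pieces_finite nf oC cC C0) iI0.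
  move=> n [nN _]; have := N1P n nN; rewrite lt_min => /andP[wa _].
  have Sw : S2 (w n) by exact: MS (Mw n).
  apply: closure_pieces => //; apply: dP; first exact: MU (Mw n).
  exact: aP.
have [|H1 pH1 iI2] := pigeonhole_idx (r := fun n H => exists z, [/\ F n z, J1 (f z) & closure H z])
   (pieces_finite nf oV1 cV1 V10) iI1.
  move=> n _; have [FM _ [z [Fz Jz]] _] := FP n.
  have [H pH cH] := closure_pieces nf oV1 cV1 V10 (MS _ _ (FM _ Fz)) (J1V1 _ Jz).
  by exists H => //; exists z.
have [|H2 pH2 iI3] := pigeonhole_idx (r := fun n H => exists z, [/\ F n z, J2 (f z) & closure H z])
   (pieces_finite nf oV2 cV2 V20) iI2.
  move=> n _; have [FM _ _ [z [Fz Jz]]] := FP n.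
  have [H pH cH] := closure_pieces nf oV2 cV2 V20 (MS _ _ (FM _ Fz)) (J2V2 _ Jz).
  by exists H => //; exists z.
have [oB conB Bpre B0] := pieceP nf oC pB.
have [oH1 conH1 H1pre _] := pieceP nf oV1 pH1.
have [oH2 conH2 H2pre _] := pieceP nf oV2 pH2.
(* Three indices give vertices of the graph, the fourth a centre of projection. *)
have [n0 _ In0] := iI3 0%N; have [n1 n01 In1] := iI3 n0.+1.
have [n2 n12 In2] := iI3 n1.+1; have [n3 n23 In3] := iI3 n2.+1.
(* the closure of the piece [B] contains [u], so [B] cannot cross the sphere of radius [r1] around [u] *)
have Bu z : B z -> `|z - u| < r1.
  have [[[[n0N _] cBw] _] _] := In0.
  have := N1P n0 n0N; rewrite lt_min => /andP[_ wr].
  have /closure_normP/(_ (r1 - `|w n0 - u|))[|b Bb bw] := cBw; first by rewrite subr_gt0.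
  have br : `|b - u| < r1.
    have -> : b - u = (b - w n0) + (w n0 - u) by rewrite addrA subrK.
    by apply: le_lt_trans (ler_normD _ _) _; rewrite -ltrBrDr.
  move=> Bz; apply: (@connected_local R _ B (fun z => `|z - u| < r1) conB _ b z) => //.
  move=> y By; have yr : `|y - u| != r1.
    apply/eqP => yr; have [Sy Cy] := Bpre y By; have := rP y Sy yr.
    by rewrite leNgt; have [_ /= ->] := CU _ Cy.
  have c0 : 0 < `| `|y - u| - r1| by rewrite normr_gt0 subr_eq0.
  exists (`| `|y - u| - r1|) => // p q Bp Bq py qy pr.
  have hp := ler_normB (p - u) (p - y); have hq := ler_normD (q - y) (y - u).
  rewrite opprB addrC addrA subrK in hp; rewrite addrA subrK in hq.
  move: py qy pr hp hq; move: `|p - y| `|q - y| `|p - u| `|q - u| `|y - u| => A1 A2 A3 A4 A5.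
  by case: (ger0P (A5 - r1)) => h; lra.
have cBu z : closure B z -> `|z - u| <= r1.
  move=> cz; apply: (@closure_ball_sub _ _ u r1); apply: closureS cz => y /Bu //.
have FcB n : I0 n -> F n `&` closure B = set0.
  move=> [_ hn]; rewrite -subset0 => z [/hn ez /cBu zr].
  by have := le_lt_trans (le_trans ez zr) r1e; rewrite ltxx.
have I3P n : (((I0 `&` (fun n => closure B (w n))) `&` (fun n => exists z, [/\ F n z, J1 (f z) & closure H1 z]))
   `&` (fun n => exists z, [/\ F n z, J2 (f z) & closure H2 z])) n ->
   exists N, [/\ [/\ compact N, connected N & N `<=` M n `\` B], F n `<=` N & N `&` closure B !=set0].
  move=> [[[In cBw] _] _]; have [FM cF [z [Fz _]] _] := FP n; have [cM conM _] := MP n.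
  have [|N [cN conN NM FN NB]] := reach_boundary cM conM (@MS n) oB FM cF (FcB n In) _ (Mw n) cBw.
    by exists z.
  by exists N; split.
have clpre (V : set V3) H z : H `<=` pre f V -> S2 z -> closure H z -> closure V (f z).
  move=> Hpre Sz /closure_normP cz; apply/closure_normP => s s0.
  have [d' d'0 d'P] := cf z Sz s s0; have [y Hy yz] := cz d' d'0.
  by have [Sy Vy] := Hpre y Hy; exists (f y) => //; exact: d'P.
pose nn (i : 'I_3) := nth n0 [:: n0; n1; n2] i.
have nnI i : (((I0 `&` (fun n => closure B (w n))) `&` (fun n => exists z, [/\ F n z, J1 (f z) & closure H1 z]))
   `&` (fun n => exists z, [/\ F n z, J2 (f z) & closure H2 z])) (nn i).
  by rewrite /nn; case: i => -[|[|[|//]]] k.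
have nn3 i : nn i <> n3.
  by rewrite /nn; case: i => -[|[|[|//]]] k /= E; move: n01 n12 n23; rewrite E ?ltnn// => a1 a2 a3;
   [have := ltn_trans a1 (ltn_trans a2 a3)|have := ltn_trans a2 a3]; rewrite ltnn.
have nn_inj i k : i != k -> nn i <> nn k.
  rewrite -val_eqE /nn; case: i => -[|[|[|//]]] hi; case: k => -[|[|[|//]]] hk //= _ E; move: n01 n12;
   rewrite E ?ltnn// => a1 a2; by have := ltn_trans a1 a2; rewrite ltnn.
have /choice[N NP] : forall i, exists N, [/\ [/\ compact N, connected N & N `<=` M (nn i) `\` B], F (nn i) `<=` N & N `&` closure B !=set0].
  by move=> i; exact: I3P (nnI i).
(* The default value [B] of [nth] sits at index 2, which is [ord_max]: the piece whose closure may
   touch those of [H1] and [H2] takes the exempt place. *)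
pose H (j : 'I_3) := nth B [:: H1; H2] j.
have HP j : sph_open (H j) /\ connected (H j) by rewrite /H; case: j => -[|[|[|//]]] k.
have VU0 (V : set V3) H' z n : V `&` closure U = set0 -> H' `<=` pre f V -> H' z -> M n z -> False.
  move=> VU Hp Hz Mz; have [_ Vfz] := Hp z Hz.
  by have : (V `&` closure U) (f z); [split=> //; exact: MU Mz|rewrite VU].
have NH i j : N i `&` H j = set0.
  rewrite -subset0 => z [Nz Hz]; have [[_ _ NM] _ _] := NP i; have [Mz nBz] := NM z Nz.
  move: Hz; rewrite /H; case: j => -[|[|[|//]]] k //= Hz.
    exact: (VU0 V1 H1 z _ V1U H1pre Hz Mz).
  exact: (VU0 V2 H2 z _ V2U H2pre Hz Mz).
(* The contacts with [H1] and [H2] are taken in [F], away from the closure of [B], and the closed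
   side discs are disjoint. The contact with [B] comes from boundary bumping. *)
have /choice[p pP] : forall q : 'I_3 * 'I_3, exists z, [/\ N q.1 z, closure (H q.2) z &
    forall l, q.2 != ord_max -> l != q.2 -> ~ closure (H l) z].
  move=> [i j] /=; have [[_ _ NM] FN NB] := NP i.
  have [[[In _] [z1 [F1 Jz1 cz1]]] [z2 [F2 Jz2 cz2]]] := nnI i.
  have nB z : F (nn i) z -> ~ closure B z.
    by move=> Fz cz; have : (F (nn i) `&` closure B) z by []; rewrite FcB.
  have SF z : F (nn i) z -> S2 z by have [FM _ _ _] := FP (nn i) => /FM/MS.
  have n12' z : S2 z -> closure H1 z -> closure H2 z -> False.
    move=> Sz c1 c2; have : (closure V1 `&` closure V2) (f z); last by rewrite V12.
    by split; [exact: clpre c1|exact: clpre c2].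
  rewrite /H; case: j => -[|[|[|//]]] k /=.
  - exists z1; split=> //; first exact: FN.
    case=> -[|[|[|//]]] hl //= _ _; [exact: n12' (SF _ F1) cz1|exact: nB].
  - exists z2; split=> //; first exact: FN.
    case=> -[|[|[|//]]] hl //= _ _; [by move=> c1; exact: n12' (SF _ F2) c1 cz2|exact: nB].
  - have [z [Nz cz]] := NB; exists z; split=> // l /negP h; exfalso; apply: h; exact/eqP/val_inj.
(* A point of the fourth [F] is off the other continua and off [B], and off [H1] and [H2] because
   their images avoid the closure of [U]. *)
have [FM3 _ [c [Fc _]] _] := FP n3.
have Mc : M n3 c by exact: FM3.
have V1V2 : V1 `&` V2 = set0.
  rewrite -subset0 => z [a1 a2]; have : (closure V1 `&` closure V2) z; last by rewrite V12.
  by split; exact: subset_closure.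
have pdisj (A A' X X' : set V3) : A `<=` pre f X -> A' `<=` pre f X' -> X `&` X' = set0 -> A `&` A' = set0.
  move=> AX AX' XX; rewrite -subset0 => z [/AX[_ Xz] /AX'[_ Xz']].
  by have : (X `&` X') (f z) by []; rewrite XX.
have CV (V : set V3) : V `&` closure U = set0 -> V `&` C = set0.
  move=> VU; rewrite -subset0 => z [Vz /CU[Uz _]].
  by have : (V `&` closure U) z; [split=> //; exact: subset_closure|rewrite VU].
have H12 := pdisj _ _ _ _ H1pre H2pre V1V2.
have H1B := pdisj _ _ _ _ H1pre Bpre (CV _ V1U).
have H2B := pdisj _ _ _ _ H2pre Bpre (CV _ V2U).
apply: (@K33_sphere R N H (fun i j => p (i, j)) c).
- exact: MS Mc.
- move=> i Nc; have [[_ _ NM] _ _] := NP i; have [Mc' _] := NM c Nc.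
  by have : (M (nn i) `&` M n3) c by []; rewrite Mdisj//; exact: nn3.
- move=> j; rewrite /H; case: j => -[|[|[|//]]] k /= Hc.
  + exact: (VU0 V1 H1 c _ V1U H1pre Hc Mc).
  + exact: (VU0 V2 H2 c _ V2U H2pre Hc Mc).
  + have [[[In _] _] _] := In3; have : (F n3 `&` closure B) c; last by rewrite FcB.
    by split=> //; exact: subset_closure.
- by move=> i; have [[cN conN NM] _ _] := NP i; split=> // z /NM[/MS].
- move=> i k ik; rewrite -subset0 => z [Nz Nz'].
  have [[_ _ NM] _ _] := NP i; have [[_ _ NM'] _ _] := NP k.
  have : (M (nn i) `&` M (nn k)) z by split; [have [] := NM z Nz|have [] := NM' z Nz'].
  by rewrite Mdisj//; exact: nn_inj.
- exact: HP.
- move=> j l; rewrite -val_eqE /H; case: j => -[|[|[|//]]] hj; case: l => -[|[|[|//]]] hl //= _.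
  + by rewrite setIC.
  + by rewrite setIC.
  + by rewrite setIC.
- exact: NH.
- by move=> i j; have [] := pP (i, j).
- by move=> i j l j2 lj; have [_ _ h] := pP (i, j); exact: (h l j2 lj).
Qed.

End Crossings.
End Annuli.

(** * The Schoenflies relation *)

Section SchoenfliesPairs.
Variables (R : realType) (V : normedModType R).
Local Notation V3 := 'rV[R]_3.
Local Notation S2 := (@S2 R).

(** Nearest points need not exist. Instead [z n] attains every precision [k.+1%:R^-1] with [k <= n]
    that [A n] permits, so one sequence serves all [e]. *)
Lemma near_points (A : nat -> set V3) (x : V3) : (forall n, A n !=set0) ->
  (forall e : R, 0 < e -> exists N, forall n, (N <= n)%N -> exists2 z, A n z & `|z - x| < e) ->
  exists z : nat -> V3, (forall n, A n (z n)) /\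
    forall e : R, 0 < e -> exists N, forall n, (N <= n)%N -> `|z n - x| < e.
Proof.
move=> A0 Ax.
have best n m : exists z, A n z /\ forall k, (k < m)%N ->
    (exists2 z', A n z' & `|z' - x| < k.+1%:R^-1) -> `|z - x| < k.+1%:R^-1.
  elim: m => [|m [z [Az zP]]]; first by have [z Az] := A0 n; exists z; split.
  have [[z' Az' z'm]|nz] := pselect (exists2 z', A n z' & `|z' - x| < m.+1%:R^-1).
    exists z'; split=> // k; rewrite ltnS => km _; apply: lt_le_trans z'm _.
    by rewrite lef_pV2 ?posrE ?ltr0n// ler_nat ltnS.
  exists z; split=> // k; rewrite ltnS leq_eqVlt => /orP[/eqP -> //|km]; exact: zP.
have /choice[z zP] := fun n => best n n.+1.
exists z; split=> [n|e e0]; first by have [] := zP n.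
have [k kP] := natSinv_lt e0.
have [|N NP] := Ax k.+1%:R^-1; first by rewrite invr_gt0.
exists (maxn N k) => n; rewrite geq_max => /andP[Nn kn].
have [_ h] := zP n; apply: lt_trans (kP k (leqnn k)).
by apply: h => //; exact: NP.
Qed.

Variables (f : V3 -> V3) (K : set V3) (g : V3 -> V).
Hypothesis nf : nice_map f.
Hypothesis KS : K `<=` S2.
Hypothesis cK : compact K.
Local Notation L := (pre f K).
Hypothesis cg : cont_on L g.

Let cL : compact L. Proof. by apply: pre_cpt => //; exact: cpt_closed. Qed.

(** A component of the preimage has connected image, so it lies over one component of [C]; this
    makes [component_pre_continuum] available for a disconnected [C]. *)
Lemma component_pre_component (C : set V3) z u : C `<=` S2 -> connected_component C z (f u) -> S2 u ->
  connected_component (pre f C) u = connected_component (pre f (connected_component C z)) u.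
Proof.
have [_ cf _ _] := nf => CS Cu Su; apply/seteqP; split=> v.
  move=> Dv; exists (connected_component (pre f C) u) => //; split.
  - apply: connected_component_refl; split=> //; exact: connected_component_sub Cu.
  - move=> w Dw; have [Sw _] := connected_component_sub Dw; split=> //=.
    apply: (connected_component_trans Cu); exists (f @` connected_component (pre f C) u); last by exists w.
    split.
    + exists u => //; apply: connected_component_refl; split=> //; exact: connected_component_sub Cu.
    + by move=> _ [w' /connected_component_sub[_ Cw'] <-].
    + apply: image_conn; last exact: component_connected.
      by apply: cont_onS cf => w' /connected_component_sub[].
  - exact: component_connected.
move=> Dv; exists (connected_component (pre f (connected_component C z)) u) => //; split.
- exact: connected_component_refl.
- by move=> w /connected_component_sub[Sw /connected_component_sub].
- exact: component_connected.
Qed.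

Hypothesis fib : forall a, L a -> connected (L `&` g @^-1` [set g a]).
Hypothesis pY : peano_space (g @` L).

Lemma schoenflies_lift (x y u : V3) : schoenflies_rel K x y -> S2 u -> f u = x ->
  exists v, [/\ S2 v, f v = y & g u = g v].
Proof.
have [fS cf of_ ff] := nf.
move=> [xy [J1 [J2 [scJ1 [scJ2 [J12 [J1x [J2y [U [UJ [P [Pinj [Pcomp [PJ [Q [[cQ [Q0 PQ]] [Qx Qy]]]]]]]]]]]]]]]]].
move=> Su fu.
have [oU cU U0 UJ0 clU] := between_facts scJ1 scJ2 UJ; have [US _] := oU.
pose CK := closure U `&` K.
have cCK : compact CK by apply: (sub_cpt _ cK) => [|z []//]; apply: closedI; [exact: closed_closure|exact: cpt_closed].
have CKS : CK `<=` S2 by move=> z [_ /KS].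
have nearP q : Q q -> forall e : R, 0 < e -> exists N, forall n, (N <= n)%N -> exists2 z, P n z & `|z - q| < e.
  move=> Qq e e0; have [N _ NP] := PQ e e0; exists N => n Nn.
  by have [_ /(_ q Qq)[z Pz qz]] := NP n Nn; exists z => //; rewrite distrC.
have PPS n : P n `<=` S2 by have [z _ ->] := Pcomp n => w /connected_component_sub/CKS.
have nearu e : 0 < e -> exists N, forall n, (N <= n)%N -> exists2 v, pre f (P n) v & `|v - u| < e.
  move=> e0; have [d d0 dP] := of_ u e Su e0; rewrite fu in dP.
  have [N NP] := nearP x Qx d d0; exists N => n Nn; have [z Pz zx] := NP n Nn.
  by have [v [Sv vu fv]] := dP z (PPS n z Pz) zx; exists v => //; split; rewrite //= fv.
(* discard the first [N0] sets so that all preimages are non-empty *)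
have [N0 N0P] := nearu 1 ltr01.
pose P' n := P (N0 + n)%N.
have shift (A : nat -> set V3) (w : V3) : (forall e : R, 0 < e -> exists N, forall n, (N <= n)%N -> exists2 z, A n z & `|z - w| < e) ->
  forall e : R, 0 < e -> exists N, forall n, (N <= n)%N -> exists2 z, A (N0 + n)%N z & `|z - w| < e.
  move=> h e e0; have [N NP] := h e e0; exists N => n Nn; apply: NP.
  exact: leq_trans Nn (leq_addl _ _).
have PP n : [/\ P' n `<=` CK, compact (P' n), connected (P' n) & P' n !=set0].
  have [z Cz PE] := Pcomp (N0 + n)%N; rewrite /P' PE; split.
  - exact: connected_component_sub.
  - by apply: (sub_cpt _ cCK); [apply: component_closed; exact: cpt_closed|exact: connected_component_sub].
  - exact: component_connected.
  - by exists z; exact: connected_component_refl.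
have [|yy [Pyy yyP]] := @near_points P' y _ (shift P y (nearP y Qy)).
  by move=> n; have [_ _ _ h] := PP n.
have [|uu [Puu uuP]] := @near_points (fun n => pre f (P' n)) u _ (shift (fun n => pre f (P n)) u nearu).
  by move=> n; have [v Pv _] := N0P (N0 + n)%N (leq_addr _ _); exists v.
pose W := pre f CK.
have cW : closed W by apply: cpt_closed; apply: pre_cpt => //; exact: cpt_closed.
have WL : W `<=` L by move=> z [Sz [_ Kz]].
have Wu n : W (uu n) by have [Sz Pz] := Puu n; split=> //; have [h _ _ _] := PP n; exact: h.
pose M n := connected_component W (uu n).
(* Confluence: [M n], chosen near [u], covers [P' n] and so contains a point over [yy n]. These
   points cluster at [v]. *)
have fM n : f @` M n = P' n.
  have [z Cz PE] := Pcomp (N0 + n)%N; have [Sz Pz] := Puu n.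
  have Pz' : connected_component CK z (f (uu n)) by rewrite -/CK in PE; rewrite -PE.
  rewrite /M (component_pre_component CKS Pz' Sz) -[X in pre f X]PE.
  by have [_ cP conP _] := PP n; apply: component_pre_continuum => // w; exact: PPS.
have /choice[vv vvP] : forall n, exists v, M n v /\ f v = yy n.
  by move=> n; have : (f @` M n) (yy n); [rewrite fM|move=> [v Mv fv]; exists v].
have MS n z : M n z -> S2 z by move=> /connected_component_sub[].
have [v Sv vP] : exists2 v, S2 v & forall e : R, 0 < e -> infinite_idx (setT `&` [set n | `|vv n - v| < e]).
  apply: (cluster_seq (@S2_cpt R)) => [N|n _]; first by exists N.
  by have [Mv _] := vvP n; exact: MS Mv.
have [phi [phi_lt _ phiP]] := subsequence vP.
have phi_ge k : (k <= phi k)%N.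
  by elim: k => // k IHk; exact: leq_ltn_trans IHk (phi_lt k).
have phi_mono k l : (k < l)%N -> (phi k < phi l)%N.
  elim: l => // l IHl; rewrite ltnS leq_eqVlt => /orP[/eqP ->|/IHl h]; first exact: phi_lt.
  exact: ltn_trans h (phi_lt l).
have phi_inj k l : k <> l -> phi k <> phi l.
  move=> kl E; have [h|h|//] := ltngtP k l; by have := phi_mono _ _ h; rewrite E ltnn.
have fv : f v = y.
  apply/eqP; rewrite -subr_eq0 -normr_le0 leNgt; apply/negP => fvy.
  have e2 : 0 < `|f v - y| / 2 by rewrite divr_gt0.
  have [d d0 dP] := cf v Sv _ e2; have [N NP] := yyP _ e2.
  have [n Nn [_ /= vn]] := vP d d0 N; have [Mv fvn] := vvP n.
  have h1 := dP (vv n) (MS n _ Mv) vn; have h2 := NP n Nn; rewrite -fvn in h2.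
  have : `|f v - y| <= `|f (vv n) - y| + `|f (vv n) - f v|.
    have -> : f v - y = (f (vv n) - y) - (f (vv n) - f v) by rewrite opprB [RHS]addrC addrA subrK.
    exact: ler_normB.
  move: h1 h2; move: `|f (vv n) - f v| `|f (vv n) - y| `|f v - y| => a b c h1 h2 h3.
  by move: h1 h2 h3; lra.
exists v; split=> //.
have M_eq n k w : M n w -> M k w -> n = k.
  move=> Mn Mk; have E : M n = M k by rewrite /M (same_connected_component Mn) (same_connected_component Mk).
  by apply: (@addnI N0); apply: Pinj; rewrite -/(P' n) -/(P' k) -!fM E.
have Mdisj n k : n <> k -> M n `&` M k = set0.
  by move=> nk; rewrite -subset0 => w [Mn Mk]; apply: nk; exact: M_eq Mn Mk.
have Mcpt n : compact (M n).
  by apply: (sub_cpt _ (@S2_cpt R)); [exact: component_closed|exact: MS].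
apply/eqP; rewrite -subr_eq0 -normr_le0 leNgt; apply/negP => guv.
(* Four steps lead from [g u] to [g v]: to a point of [F n] near [u], to the centre [c n], to a
   point of [F n] near [v], and to [g v], all measured after applying [g]. *)
pose e := `|g u - g v| / 4.
have e0 : 0 < e by rewrite divr_gt0.
have clJ J : simple_closed_curve J -> closed (pre f J).
  by move=> scJ; apply: cpt_closed; apply: pre_cpt => //; apply: cpt_closed; exact: scc_cpt.
have MJ (J : set V3) n : P' n `&` J !=set0 -> M n `&` pre f J !=set0.
  move=> [z [Pz Jz]]; have : (f @` M n) z by rewrite fM.
  by move=> [w Mw fw]; exists w; split=> //; split; [exact: MS Mw|rewrite /= fw].
have [||||N NP] := @small_crossing R _ V L g cL cg fib pY W (pre f J1) (pre f J2) uu cW WL (clJ _ scJ1) (clJ _ scJ2) _ _ _ _ e e0.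
- move=> z [Sz [Uz Kz]] n1 n2.
  have Ufz : U (f z).
    have : closure U (f z) by [].
    by rewrite clU => -[//|[Jz|Jz]]; exfalso; [apply: n1|apply: n2].
  have [_ oU'] := oU; have [d d0 dP] := oU' _ Ufz; have [d' d'0 d'P] := cf z Sz d d0.
  exists d' => // w [Sw Kw] wz; split=> //; split=> //; apply: subset_closure.
  by apply: dP; [exact: fS|exact: d'P].
- move=> n k E; apply: (M_eq n k (uu n)); first exact: connected_component_refl.
  by rewrite /M -E; exact: connected_component_refl.
- by move=> n; apply: MJ; have [] := PJ (N0 + n)%N.
- by move=> n; apply: MJ; have [] := PJ (N0 + n)%N.
pose psi k := phi (k + N)%N.
have psi_ge k : (k <= psi k)%N by apply: leq_trans (phi_ge _); exact: leq_addr.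
have psiN k : (N <= psi k)%N by apply: leq_trans (phi_ge _); exact: leq_addl.
have /choice[F FP] : forall k, exists F : set V3, exists c, [/\ F `<=` M (psi k), closed F, connected F, F `&` pre f J1 !=set0 &
    F `&` pre f J2 !=set0 /\ forall z, F z -> `|g z - c| <= e].
  by move=> k; exact: NP.
have /choice[c cP] := FP.
have Lz z : S2 z -> K (f z) -> L z by split.
have Kx : K x.
  have /closed_normP := cpt_closed cK; apply => r r0; have [n nP] := nearP x Qx r r0.
  have [z Pz zx] := nP n (leqnn n); exists z => //.
  by have [z' _ PE] := Pcomp n; move: Pz; rewrite PE => /connected_component_sub[].
have Ky : K y.
  have /closed_normP := cpt_closed cK; apply => r r0; have [n nP] := nearP y Qy r r0.
  have [z Pz zx] := nP n (leqnn n); exists z => //.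
  by have [z' _ PE] := Pcomp n; move: Pz; rewrite PE => /connected_component_sub[].
have [ru ru0 ruP] : exists2 r : R, 0 < r & forall z, L z -> `|z - u| < r -> `|g z - g u| < e.
  by have [|r r0 rP] := cg (x := u) _ e0; [split; rewrite //= fu|exists r].
have [rv rv0 rvP] : exists2 r : R, 0 < r & forall z, L z -> `|z - v| < r -> `|g z - g v| < e.
  by have [|r r0 rP] := cg (x := v) _ e0; [split; rewrite //= fv|exists r].
have hM k : [/\ compact (M (psi k)), connected (M (psi k)) & M (psi k) `<=` pre f (closure U)].
  by split=> //; [exact: component_connected|move=> z /connected_component_sub[Sz [Uz _]]].
have hd n k : n <> k -> M (psi n) `&` M (psi k) = set0.
  by move=> nk; apply: Mdisj; apply: phi_inj => /addIn.
have hF k : [/\ F k `<=` M (psi k), connected (F k), F k `&` f @^-1` J1 !=set0 & F k `&` f @^-1` J2 !=set0].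
  have [FM _ conF [z1 [Fz1 [_ Jz1]]] [[z2 [Fz2 [_ Jz2]]] _]] := cP k.
  by split=> //; [exists z1|exists z2].
(* The same [F] is shown to approach [u], following [uu], and then [v], following [vv]; a single
   small [F n] near both points links their values. *)
have [Nu NuP] : exists N, forall n, (N <= n)%N -> exists2 z, F n z & `|z - u| < ru.
  apply: (crossings_approach scJ1 scJ2 J12 UJ nf hM hd hF (w := fun k => uu (psi k))) => //.
  - by move=> n; exact: connected_component_refl.
  - by rewrite fu; left.
  - move=> r r0; have [N' N'P] := uuP r r0; exists N' => n N'n; apply: N'P.
    exact: leq_trans N'n (psi_ge n).
have [Nv NvP] : exists N, forall n, (N <= n)%N -> exists2 z, F n z & `|z - v| < rv.
  apply: (crossings_approach scJ1 scJ2 J12 UJ nf hM hd hF (w := fun k => vv (psi k))) => //.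
  - by move=> n; have [] := vvP (psi n).
  - by rewrite fv; right.
  - move=> r r0; have [N' N'P] := natSinv_lt r0; exists N' => n N'n.
    apply: lt_trans (phiP _) _; apply: N'P; exact: leq_trans N'n (leq_addr _ _).
pose n := maxn Nu Nv.
have [z1 Fz1 z1u] := NuP n (leq_maxl _ _); have [z2 Fz2 z2v] := NvP n (leq_maxr _ _).
have [FM _ _ _ [_ Fc]] := cP n.
have FL z : F n z -> L z by move=> /FM/connected_component_sub/WL.
have a1 := ruP z1 (FL z1 Fz1) z1u; have a2 := rvP z2 (FL z2 Fz2) z2v.
have a3 := Fc z1 Fz1; have a4 := Fc z2 Fz2.
have h : `|g u - g v| <= (`|g z1 - c n| + `|g z1 - g u|) + (`|g z2 - c n| + `|g z2 - g v|).
  have -> : g u - g v = ((g z1 - c n) - (g z1 - g u)) - ((g z2 - c n) - (g z2 - g v)).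
    have E (a b w : V) : (a - b) - (a - w) = w - b by rewrite opprB [LHS]addrC addrA subrK.
    by rewrite !E opprB addrA subrK.
  apply: le_trans (ler_normB _ _) _; apply: lerD; exact: ler_normB.
have E4 : `|g u - g v| = 4 * e by rewrite /e mulrCA divff ?mulr1.
suff : (`|g z1 - c n| + `|g z1 - g u|) + (`|g z2 - c n| + `|g z2 - g v|) < (e + e) + (e + e).
  by rewrite -!mulr2n -mulrnA -mulr_natl -E4 ltNge h.
by apply: ltrD; exact: ler_ltD.
Qed.

End SchoenfliesPairs.

(** * The lifted relation, its closedness, and the theorem *)

Section LiftedRelation.
Variables (R : realType) (V : normedModType R).
Local Notation V3 := 'rV[R]_3.
Local Notation S2 := (@S2 R).

Lemma schoenflies_rel_sym (K : set V3) x y : schoenflies_rel K x y -> schoenflies_rel K y x.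
Proof.
move=> [xy [J1 [J2 [s1 [s2 [J12 [Jx [Jy [U [UJ [P [Pi [Pc [PJ [Q [PQ [Qx Qy]]]]]]]]]]]]]]]]].
split; first by move=> yx; apply: xy.
exists J2, J1; rewrite setIC; do 5 (split=> //); exists U; split.
  by move: UJ; rewrite /U_between (setUC J1).
exists P; do 2 (split=> //); split; first by move=> n; have [] := PJ n.
by exists Q.
Qed.

Lemma schoenflies_rel_in (K : set V3) x y : compact K -> schoenflies_rel K x y -> K x.
Proof.
move=> /cpt_closed/closed_normP cK.
move=> [_ [_ [_ [_ [_ [_ [_ [_ [U [_ [P [_ [Pc [_ [Q [[_ [_ PQ]] [Qx _]]]]]]]]]]]]]]]]].
apply: cK => e e0; have [N _ NP] := PQ e e0.
have [_ /(_ x Qx)[z Pz xz]] := NP N (leqnn N); exists z; last by rewrite distrC.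
by have [w _ PE] := Pc N; move: Pz; rewrite PE => /connected_component_sub[].
Qed.

(** Pointwise form, in terms of [g], of one inclusion between the projections of the fibres over [x]
    and [y]. *)
Definition lifts (f : V3 -> V3) (g : V3 -> V) (x y : V3) :=
  forall u, S2 u -> f u = x -> exists v, [/\ S2 v, f v = y & g u = g v].

(** Openness moves [u] to points over nearby [x']; their partners over [y'] cluster on the compact
    sphere, and continuity of [f] and [g] carries both equations to the limit. *)
Lemma lifts_closed (f : V3 -> V3) (g : V3 -> V) (K : set V3) (x y : V3) : nice_map f ->
  K `<=` S2 -> cont_on (pre f K) g -> K x -> K y ->
  (forall e : R, 0 < e -> exists x' y', [/\ K x', K y', `|x' - x| < e, `|y' - y| < e & lifts f g x' y']) ->
  lifts f g x y.
Proof.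
move=> [fS cf of_ _] KS cg Kx Ky near u Su fu.
have /choice[w wP] : forall n : nat, exists w : V3 * V3, [/\ pre f K w.1 /\ pre f K w.2, `|w.1 - u| < n.+1%:R^-1,
    `|f w.2 - y| < n.+1%:R^-1 & g w.1 = g w.2].
  move=> n; have n0 : 0 < n.+1%:R^-1 :> R by rewrite invr_gt0.
  have [d d0 dP] := of_ u _ Su n0; rewrite fu in dP.
  have [|x' [y' [Kx' Ky' x'x y'y xy]]] := near (Num.min d n.+1%:R^-1); first by rewrite lt_min d0.
  move: x'x y'y; rewrite !lt_min => /andP[x'd _] /andP[_ y'n].
  have [u' [Su' u'u fu']] := dP x' (KS _ Kx') x'd; have [v' [Sv' fv' gg]] := xy u' Su' fu'.
  by exists (u', v'); split=> //=; rewrite ?fv'//; split; split; rewrite //= ?fu' ?fv'.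
have [||v Sv vP] := @cluster_seq R _ S2 (fun n => (w n).2) setT (@S2_cpt R).
- by move=> N; exists N.
- by move=> n _; have [[_ []]] := wP n.
have fv : f v = y.
  apply/eqP; rewrite -subr_eq0 -normr_le0 leNgt; apply/negP => fvy.
  have e2 : 0 < `|f v - y| / 2 by rewrite divr_gt0.
  have [d d0 dP] := cf v Sv _ e2; have [N NP] := natSinv_lt e2.
  have [n Nn [_ /= vn]] := vP d d0 N; have [[_ [Sw _]] _ wy _] := wP n.
  have h1 := dP _ Sw vn; have h2 := lt_trans wy (NP n Nn).
  suff : `|f v - y| < `|f v - y| by rewrite ltxx.
  rewrite [ltRHS]splitr; apply: le_lt_trans (ler_distD (f (w n).2) _ _) _.
  by apply: ltrD => //; rewrite distrC.
exists v; split=> //; apply/eqP; rewrite -subr_eq0 -normr_le0 leNgt; apply/negP => guv.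
have e2 : 0 < `|g u - g v| / 2 by rewrite divr_gt0.
have [|d d0 dP] := cg u _ _ e2; first by split; rewrite //= fu.
have [|d' d'0 d'P] := cg v _ _ e2; first by split; rewrite //= fv.
have [N NP] := natSinv_lt d0; have [n Nn [_ /= vn]] := vP d' d'0 N.
have [[L1 L2] wu _ gE] := wP n.
have h1 := dP _ L1 (lt_trans wu (NP n Nn)); have h2 := d'P _ L2 vn.
suff : `|g u - g v| < `|g u - g v| by rewrite ltxx.
rewrite [ltRHS]splitr; apply: le_lt_trans (ler_distD (g (w n).1) _ _) _.
apply: ltrD; first by rewrite distrC.
by rewrite gE.
Qed.

End LiftedRelation.

Theorem theorem7p1 (R : realType) (K : set 'rV[R]_3) (p q : {poly R[i]})
  (D : set (set 'rV[R]_3)) :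
  K `<=` @S2 R -> compact K ->
  is_rational_of_degree_ge2 p q ->
  let f := rat_S2 p q in
  let L := [set z | @S2 R z /\ K (f z)] in
  finest_peano_decomposition L D ->
  let approx := fun x y : 'rV[R]_3 =>
    K x /\ K y /\
    proj_set D [set z | @S2 R z /\ f z = x] = proj_set D [set z | @S2 R z /\ f z = y] in
  ((forall x, K x -> approx x x) /\
   (forall x y, approx x y -> approx y x) /\
   (forall x y z, approx x y -> approx y z -> approx x z) /\
   closed [set xy | approx xy.1 xy.2]) /\
  (forall x y, schoenflies_closure K (x, y) -> approx x y).
Proof.
move=> KS cK pq f L [[D1 [D2 [D3 _]]] [[V [g [/cont_onP cg [gD pY]]]] _]] approx.
have nf : nice_map f := rat_nice pq.
(* On [L] the fibres of [g] are exactly the members of [D], hence connected. *)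
have fib a : L a -> connected (L `&` g @^-1` [set g a]).
  move=> La; have [A DA Aa] := D3 a La; have [_ [AL [_ cA]]] := D1 A DA.
  suff -> : L `&` g @^-1` [set g a] = A by [].
  apply/seteqP; split=> z.
    move=> [Lz /= gz]; have [B DB [Bz Ba]] := (gD z a Lz La).1 gz.
    by rewrite (D2 A B) //; exists a.
  by move=> Az; split; [exact: AL|apply/(gD z a (AL z Az) La); exists A].
have sub x y : K x -> K y -> lifts f g x y ->
    proj_set D [set z | S2 z /\ f z = x] `<=` proj_set D [set z | S2 z /\ f z = y].
  move=> Kx Ky xy A [DA [u [Au [Su fu]]]]; split=> //.
  have [v [Sv fv gE]] := xy u Su fu.
  have Lu : L u by split=> //; rewrite fu.
  have Lv : L v by split=> //; rewrite fv.
  have [B DB [Bu Bv]] := (gD u v Lu Lv).1 gE.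
  by exists v; split=> //; rewrite (D2 A B) //; exists u.
have lift x y : K x -> K y ->
    proj_set D [set z | S2 z /\ f z = x] `<=` proj_set D [set z | S2 z /\ f z = y] -> lifts f g x y.
  move=> Kx Ky xy u Su fu; have Lu : L u by split=> //; rewrite fu.
  have [A DA Au] := D3 u Lu.
  have [|_ [v [Av [Sv fv]]]] := xy A; first by split=> //; exists u.
  exists v; split=> //; apply/(gD u v Lu); first by split=> //; rewrite fv.
  by exists A.
have approxP x y : approx x y <-> [/\ K x, K y, lifts f g x y & lifts f g y x].
  split=> [[Kx [Ky E]]|[Kx Ky xy yx]]; first by split=> //; apply: lift => //; rewrite E.
  by split=> //; split=> //; apply/seteqP; split; exact: sub.
have approx_closed : closed [set xy | approx xy.1 xy.2].
  apply/closed_normP => -[x y] near.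
  have {}near (e : R) : 0 < e -> exists x' y', [/\ approx x' y', `|x' - x| < e & `|y' - y| < e].
    move=> e0; have [[x' y'] h] := near e e0; rewrite pair_norm_lt /= => /andP[x'x y'y].
    by exists x', y'.
  have /closed_normP clK := cpt_closed cK.
  have Kx : K x by apply: clK => e /near[x' [y' [[Kx' _] h _]]]; exists x'.
  have Ky : K y by apply: clK => e /near[x' [y' [[_ [Ky' _]] _ h]]]; exists y'.
  apply/approxP; split=> //; apply: (lifts_closed nf KS cg) => // e /near[x' [y' [/approxP[h1 h2 h3 h4] h5 h6]]].
    by exists x', y'.
  by exists y', x'.
split.
  split; first by move=> x Kx; split.
  split; first by move=> x y [Kx [Ky E]]; split=> //; split.
  split=> // x y z [Kx [_ E1]] [_ [Kz E2]]; split=> //; split=> //.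
  by rewrite E1.
(* The relation being closed, only genuine Schoenflies pairs have to be treated; symmetry yields the
   second inclusion. *)
move=> x y xy; suff /(_ (x, y) xy) : schoenflies_closure K `<=` [set xy | approx xy.1 xy.2] by [].
rewrite [X in _ `<=` X](closure_id _).1//; apply: closureS => -[x' y'] /= h.
have h' := schoenflies_rel_sym h.
apply/approxP; split; [exact: schoenflies_rel_in h|exact: schoenflies_rel_in h'|..].
  by move=> u Su fu; exact: (schoenflies_lift nf KS cK cg fib pY h Su fu).
by move=> u Su fu; exact: (schoenflies_lift nf KS cK cg fib pY h' Su fu).
Qed.
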